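(* Assume that $E$ satisfies (K1)–(K3) and (K6). In addition, assume that $\Theta_E:=E^\sharp/E$ is an inner function in $\mathbb C_+$. Then (K5) holds for $\tau=\infty$; that is, for every $0\le t<\infty$, neither $+1$ nor $-1$ is an eigenvalue of the operator $$\mathsf K[t]:f(x)\mapsto\mathbf 1_{(-\infty,t)}(x)\int_{-\infty}^tK(x+y)f(y)\,dy\quad\text{on }L^2(-\infty,t).$$
   Context: Notation: $\mathbb C_+=\{z:\Im z>0\}$; $F^\sharp(z)=\overline{F(\bar z)}$; $(\mathsf Ff)(z)=\int_{-\infty}^\infty f(x)e^{izx}\,dx$; $\mathbf 1_A$ is the characteristic function of $A\subset\mathbb R$; $\ll$ is the Vinogradov symbol. An inner function in $\mathbb C_+$ is a bounded analytic function $\theta$ on $\mathbb C_+$ with $\lim_{y\to0+}|\theta(x+iy)|=1$ for almost all $x\in\mathbb R$. Conditions on $E$: (K1) There exist $c>0$ and a discrete subset $\mathcal Z\subset\mathbb C$ (possibly empty or infinite) with $0\notin\mathcal Z$, contained in the horizontal strip $-c\le\Im z\le c$ and closed under $z\mapsto\bar z$ and $z\mapsto-z$, such that $E$ is analytic in $\mathbb C\setminus\mathcal Z$ and $E^\sharp(z)=E(-z)$ for $z\in\mathbb C\setminus\mathcal Z$. (K2) There exists a real-valued continuous function $K$ on $\mathbb R$ such that $|K(x)|\ll\exp(c|x|)$ as $|x|\to\infty$ and $E^\sharp(z)/E(z)=(\mathsf FK)(z)$ for $\Im(z)>c$, where $c$ is the constant in (K1). (K3) $K$ vanishes on $(-\infty,0)$.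 (K6) The function $E^\sharp(z)/E(z)$ cannot be expressed as a ratio of two entire functions of exponential type. Under (K2) and (K3), $\mathsf K[t]$ is well-defined, Hilbert–Schmidt and self-adjoint. *)

(* Defs.v *)
From HB Require Import structures.
From mathcomp Require Import all_boot all_order all_algebra.
From mathcomp Require Import all_classical all_reals all_analysis.
From mathcomp.real_closed Require Import complex.
Set Implicit Arguments.
Unset Strict Implicit.
Unset Printing Implicit Defensive.
Import Order.TTheory GRing.Theory Num.Theory.
Import numFieldNormedType.Exports.
Local Open Scope classical_set_scope.
Local Open Scope complex_scope.
Local Open Scope ring_scope.

Section defs.
Context (R : realType).
Local Notation C := R[i].
Local Notation leb := (@lebesgue_measure R).
Local Notation Re := complex.Re.
Local Notation Im := complex.Im.
Local Notation normc := ComplexField.Normc.normc.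

Implicit Types (D Z : set C) (E F G : C -> C) (K : R -> R) (f : R -> C)
  (c t : R).

(* Complex differentiability at every point of D; this is analyticity when D
   is open.  [R[i]^o] is the complex field with the norm topology, as a normed
   space over itself. *)
Definition holomorphic_on D F :=
  forall z, D z -> derivable (F : C^o -> C^o) z 1.

Definition upper_half_plane : set C := [set z : C | 0 < Im z].

Definition sharp F : C -> C := fun z => conjc (F (conjc z)).

Definition cexp (z : C) : C := (expR (Re z))%:C * (cos (Im z) +i* sin (Im z)).

Definition Cintegral (A : set R) f : C :=
  (\int[leb]_(x in A) Re (f x)) +i* (\int[leb]_(x in A) Im (f x)).

(* The integral is meant where it converges absolutely; for f = K as in condK2
   and condK3 this is the case whenever c < Im z. *)
Definition fourier f (z : C) : C :=
  Cintegral setT (fun x => f x * cexp ('i%C * z * x%:C)).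

Definition exponential_type F :=
  exists A B : R, forall z, normc (F z) <= A * expR (B * normc z).

Definition inner_function (theta : C -> C) :=
  [/\ holomorphic_on upper_half_plane theta,
      exists M : R, forall z : C, 0 < Im z -> normc (theta z) <= M
    & {ae leb, forall x, normc (theta (x +i* y)) @[y --> 0^'+] --> (1 : R)}].

(* E^sharp / E is a quotient of two analytic functions on the complement of Z,
   so it agrees with a function on D when it does so outside of Z and of the
   zeros of E: the values of E on Z and of the division by 0 are irrelevant.
   (E = 0, for which this is void, is excluded by condK6: take F = G = 1.) *)
Definition sharp_quotient_eq_on D Z E F :=
  forall z, D z -> ~ Z z -> E z != 0 -> sharp E z / E z = F z.

(* Discreteness of Z in the complex plane: no accumulation point, so that the
   complement of Z is open. *)
Definition condK1 c Z E :=
  [/\ 0 < c,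
      [/\ limit_point (Z : set C^o) = set0, ~ Z 0,
          forall z, Z z -> - c <= Im z <= c,
          forall z, Z z -> Z (conjc z)
        & forall z, Z z -> Z (- z)],
      holomorphic_on (~` Z) E
    & forall z, ~ Z z -> sharp E z = E (- z)].

Definition condK2 c Z E K :=
  [/\ continuous K,
      exists M : R,
        (\forall x \near +oo, `|K x| <= M * expR (c * `|x|)) /\
        (\forall x \near -oo, `|K x| <= M * expR (c * `|x|))
    & sharp_quotient_eq_on [set z : C | c < Im z] Z E
        (fourier (fun x => (K x)%:C))].

Definition condK3 K := forall x, x < 0 -> K x = 0.

Definition condK6 Z E :=
  ~ exists F G,
      [/\ holomorphic_on setT F /\ exponential_type F,
          holomorphic_on setT G /\ exponential_type G,
          exists z, G z != 0
        & sharp_quotient_eq_on [set z | G z != 0] Z E (fun z => F z / G z)].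

(* The singularities of E^sharp / E in the upper half-plane are removable:
   the inner function is its analytic continuation. *)
Definition sharp_quotient_inner Z E :=
  exists theta, inner_function theta /\
    sharp_quotient_eq_on upper_half_plane Z E theta.

(* Square-integrable functions, equality in the Hilbert space L^2(A) being
   equality almost everywhere on A. *)
Definition L2 (A : set R) f :=
  [/\ measurable_fun A (fun x => Re (f x)),
      measurable_fun A (fun x => Im (f x))
    & (\int[leb]_(x in A) (normc (f x) ^+ 2)%:E < +oo)%E].

Definition opK K t f : R -> C := fun x =>
  (\1_`]-oo, t[ x)%:C * Cintegral `]-oo, t[ (fun y => (K (x + y))%:C * f y).

Definition is_eigenvalue (A : set R) (T : (R -> C) -> R -> C) (lambda : C) :=
  exists f,
    [/\ L2 A f,
        ~ {ae leb, forall x, A x -> f x = 0}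
      & {ae leb, forall x, A x -> T f x = lambda * f x}].

End defs.

(* Main.v *)
Require Import Defs.
From mathcomp Require Import all_boot all_order all_algebra.
From mathcomp Require Import all_classical all_reals all_analysis.
From mathcomp.real_closed Require Import complex.
From mathcomp Require Import measurable_realfun.
From mathcomp Require Import ring lra.
Set Implicit Arguments.
Unset Strict Implicit.
Unset Printing Implicit Defensive.
Import Order.TTheory GRing.Theory Num.Theory.
Import numFieldNormedType.Exports.
Local Open Scope classical_set_scope.
Local Open Scope complex_scope.
Local Open Scope ring_scope.

(** An eigenfunction for the eigenvalue 1 or -1 would write E^sharp / E as a
quotient of two entire functions of exponential type, against [condK6].

Let f be an eigenfunction of K[t] for lambda = 1 or -1. As K is real, the real
and imaginary parts of f solve the same equation; let g be one of them that
does not vanish almost everywhere. The function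
u(x) = int_{y < t} K(x + y) g(y) dy is continuous, vanishes for x <= -t, and
g = lambda u almost everywhere on (-oo, t) because lambda^2 = 1. With T = 2t,
v(r) = u(r - t) and h(s) = lambda v(T - s), the equation for u becomes a
convolution v = K * h on the half-line ([eigenfunction_volterra]).

Convolution with K does not increase the norm of L^2(0, X), for any X: its
symbol, the Laplace transform of K, is E^sharp / E, an inner function and
hence bounded by 1. But h lives on [0, T], and there it is the mirror image of
v up to sign, so v already has on [0, T] the whole norm that h allows.
Therefore v vanishes beyond T, and h(s) = lambda v(T - s) vanishes for s < 0.
Thus v and h are continuous with compact support: their Laplace transforms V
and W are entire of exponential type ([lap_compact_entire]), W is not
identically zero ([lap_neq0]), and V = (E^sharp / E) W on the half-plane
Im z > c ([lap_convolution]). The identity theorem ([identity_theorem])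
carries E(-z) W(z) = V(z) E(z) over to the whole complement of the
singularities, which is the forbidden representation ([quotient_excluded]).

The contraction property ([volterra_contraction]) is obtained without
Plancherel's theorem, from polynomials on the circle. The map
w |-> iY(1 - w) sends the unit disc into the upper half-plane and 0 to iY, so
phi(w) = Theta(iY(1 - w)) is analytic and bounded by 1 in the disc. Its Taylor
coefficients at 0 are b_m = int_0^oo K(x) e^{-Yx} (Yx)^m / m! dx, and the
lower triangular Toeplitz matrix with entries b_{n-k} is a contraction
([toeplitz_contraction]). The sum over m of h((n - m)/Y) b_m is the integral
of K(x) times the mean of h(n/Y - m/Y) for m Poisson distributed with
parameter Yx; as Y grows, m/Y concentrates at x and this tends to
(K * h)(n/Y) ([dconv_cvg]), so the matrix inequalities tend to the inequality
between the integrals of v^2 and h^2.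

The bound 1 for inner functions ([inner_le1]) is the Poisson integral estimate;
it and the identity theorem are derived from Goursat's theorem on rectangles
([goursat], [goursat_exc]). *)

Local Notation Re := complex.Re.
Local Notation Im := complex.Im.
Local Notation normc := ComplexField.Normc.normc.
Local Notation normcM := ComplexField.Normc.normcM.
Local Notation normcV := ComplexField.Normc.normcV.


(** * Integrals of continuous functions over segments *)

Section seg.
Context (R : realType).
Local Notation leb := (@lebesgue_measure R).
Implicit Types (f g : R -> R) (a b k e : R).

(** Continuity is two-sided also at the end points, so that it passes to
sub-segments and to neighbouring ones without restricting the topology. *)
Definition cont_on a b f := forall x, a <= x <= b -> {for x, continuous f}.

Lemma cont_on_within a b f : cont_on a b f -> {within `[a, b], continuous f}.
Proof.
move=> cf; apply: continuous_in_subspaceT => x.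
by rewrite inE /= in_itv /= => /cf.
Qed.

Lemma integrable_seg a b f :
  cont_on a b f -> leb.-integrable `[a, b] (EFin \o f).
Proof.
by move=> cf; apply: continuous_compact_integrable;
  [exact: segment_compact|exact: cont_on_within].
Qed.

Lemma seg_cst a b k : a <= b -> \int[leb]_(x in `[a, b]) k = k * (b - a).
Proof.
move=> ab; rewrite Rintegral_cst//; congr (_ * _).
have := congr1 fine (lebesgue_measure_itv `[a, b]); rewrite /= lte_fin => ->.
by case: ltgtP ab => // [->]; rewrite subrr.
Qed.

Lemma integrable_cst_seg a b k : leb.-integrable `[a, b] (EFin \o cst k).
Proof. by apply: integrable_seg => x _; exact: cvg_cst. Qed.

Lemma seg_split a m b f : a <= m -> m <= b -> cont_on a b f ->
  \int[leb]_(x in `[a, b]) f x =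
  \int[leb]_(x in `[a, m]) f x + \int[leb]_(x in `[m, b]) f x.
Proof.
move=> am mb cf; have := integrable_seg cf => fi.
have := @Rintegral_itvB R f (BLeft a) (BRight b) m fi.
rewrite !bnd_simp => /(_ am mb) E.
rewrite -(@Rintegral_itv_obnd_cbnd R m (BRight b)).
  by rewrite -E addrC subrK.
apply: integrableS fi => //= x /=; rewrite !in_itv /= => /andP[mx ->].
by rewrite (le_trans am (ltW mx)).
Qed.

Lemma seg_le a b f g : cont_on a b f -> cont_on a b g ->
  (forall x, a <= x <= b -> f x <= g x) ->
  \int[leb]_(x in `[a, b]) f x <= \int[leb]_(x in `[a, b]) g x.
Proof.
move=> cf cg fg; apply: le_Rintegral; [by []|exact: integrable_seg..|].
by move=> x /=; rewrite in_itv /= => /fg.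
Qed.

Lemma seg_le_cst a b f k : a <= b -> cont_on a b f ->
  (forall x, a <= x <= b -> f x <= k) ->
  \int[leb]_(x in `[a, b]) f x <= k * (b - a).
Proof.
move=> ab cf fk; rewrite -(seg_cst k ab); apply: seg_le => // x _.
exact: cvg_cst.
Qed.

Lemma seg_ge_cst a b f k : a <= b -> cont_on a b f ->
  (forall x, a <= x <= b -> k <= f x) ->
  k * (b - a) <= \int[leb]_(x in `[a, b]) f x.
Proof.
move=> ab cf fk; rewrite -(seg_cst k ab); apply: seg_le => // x _.
exact: cvg_cst.
Qed.

Lemma seg_near_cst a b f k e : a <= b -> cont_on a b f ->
  (forall x, a <= x <= b -> `|f x - k| <= e) ->
  `|\int[leb]_(x in `[a, b]) f x - k * (b - a)| <= e * (b - a).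
Proof.
move=> ab cf fk.
have lo := @seg_ge_cst a b f (k - e) ab cf.
have hi := @seg_le_cst a b f (k + e) ab cf.
rewrite ler_norml; apply/andP; split.
  have : (k - e) * (b - a) <= \int[leb]_(x in `[a, b]) f x.
    by apply: lo => x /fk; rewrite ler_norml => /andP[]; lra.
  by rewrite mulrBl; lra.
have : \int[leb]_(x in `[a, b]) f x <= (k + e) * (b - a).
  by apply: hi => x /fk; rewrite ler_norml => /andP[]; lra.
by rewrite mulrDl; lra.
Qed.

Lemma seg_norm_le a b f k : a <= b -> cont_on a b f ->
  (forall x, a <= x <= b -> `|f x| <= k) ->
  `|\int[leb]_(x in `[a, b]) f x| <= k * (b - a).
Proof.
move=> ab cf fk; have := @seg_near_cst a b f 0 k ab cf.
by rewrite mul0r subr0; apply => x /fk; rewrite subr0.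
Qed.

Lemma cont_onD a b f g : cont_on a b f -> cont_on a b g ->
  cont_on a b (fun x => f x + g x).
Proof. by move=> cf cg x xab; apply: cvgD; [exact: cf|exact: cg]. Qed.

Lemma cont_onB a b f g : cont_on a b f -> cont_on a b g ->
  cont_on a b (fun x => f x - g x).
Proof. by move=> cf cg x xab; apply: cvgB; [exact: cf|exact: cg]. Qed.

Lemma cont_onM a b f g : cont_on a b f -> cont_on a b g ->
  cont_on a b (fun x => f x * g x).
Proof. by move=> cf cg x xab; apply: cvgM; [exact: cf|exact: cg]. Qed.

Lemma segD a b f g : cont_on a b f -> cont_on a b g ->
  \int[leb]_(x in `[a, b]) (f x + g x) =
  \int[leb]_(x in `[a, b]) f x + \int[leb]_(x in `[a, b]) g x.
Proof. by move=> cf cg; apply: RintegralD => //; exact: integrable_seg. Qed.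

Lemma segB a b f g : cont_on a b f -> cont_on a b g ->
  \int[leb]_(x in `[a, b]) (f x - g x) =
  \int[leb]_(x in `[a, b]) f x - \int[leb]_(x in `[a, b]) g x.
Proof. by move=> cf cg; apply: RintegralB => //; exact: integrable_seg. Qed.

Lemma segZ a b f k : cont_on a b f ->
  \int[leb]_(x in `[a, b]) (k * f x) = k * \int[leb]_(x in `[a, b]) f x.
Proof. by move=> cf; apply: RintegralZl => //; exact: integrable_seg. Qed.

Lemma seg_eq a b f g : (forall x, a <= x <= b -> f x = g x) ->
  \int[leb]_(x in `[a, b]) f x = \int[leb]_(x in `[a, b]) g x.
Proof.
by move=> fg; apply: eq_Rintegral => x; rewrite inE /= in_itv /= => /fg.
Qed.

Lemma cont_epsP f x : {for x, continuous f} <->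
  (forall e : R, 0 < e -> exists2 d : R, 0 < d &
     forall y, `|y - x| < d -> `|f y - f x| < e).
Proof.
split=> [cf e e0|H].
  have /cvgrPdist_lt/(_ _ e0) := cf.
  move/nbhs_ballP => [d /= d0 dP]; exists d => // y yx.
  by rewrite distrC; apply: dP; rewrite /ball /= distrC.
apply/cvgrPdist_lt => e e0; have [d d0 dP] := H e e0.
apply/nbhs_ballP; exists d => //= y; rewrite /ball /= distrC => yx.
by rewrite distrC; exact: dP.
Qed.

End seg.

(** * Complex differentiability at a point *)

Section cplx.
Context (R : realType).
Local Notation C := R[i].
Implicit Types (z w h : C) (F G : C -> C) (x y : R).

Lemma complexnormE z : `|z| = (normc z)%:C. Proof. by []. Qed.

Lemma normc_ge0 z : 0 <= normc z.
Proof. by rewrite -ler0c -complexnormE. Qed.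

Lemma normc_gt0 z : (0 < normc z) = (z != 0).
Proof. by rewrite -normr_gt0 complexnormE ltcR. Qed.

Lemma normcB z w : normc (z - w) = normc (w - z).
Proof. by rewrite -normcN opprB. Qed.

Lemma le_normcB z w : normc (z - w) <= normc z + normc w.
Proof. by rewrite -(normcN w); exact: le_normcD. Qed.

Lemma le_normc_sub z w : normc z - normc w <= normc (z - w).
Proof. by rewrite lerBlDr -{1}(subrK w z); exact: le_normcD. Qed.

Lemma normc_Re z : `|Re z| <= normc z.
Proof. by have := normc_ge_Re z; rewrite complexnormE lecR. Qed.

Lemma normcE2 z : normc z ^+ 2 = Re z ^+ 2 + Im z ^+ 2.
Proof.
case: z => a b /=; rewrite sqr_sqrtr//.
by rewrite addr_ge0// sqr_ge0.
Qed.

Lemma normc_Im z : `|Im z| <= normc z.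
Proof.
rewrite -(ler_pXn2r (_ : 0 < 2)%N)// ?nnegrE ?normc_ge0//.
by rewrite normcE2 real_normK ?num_real// lerDr sqr_ge0.
Qed.

Lemma normc_le_ReIm z : normc z <= `|Re z| + `|Im z|.
Proof.
rewrite -(ler_pXn2r (_ : 0 < 2)%N)// ?nnegrE ?normc_ge0 ?addr_ge0//.
rewrite normcE2 -[Re z ^+ 2]real_normK ?num_real//.
rewrite -[Im z ^+ 2]real_normK ?num_real//.
have := normr_ge0 (Re z); have := normr_ge0 (Im z); nra.
Qed.

Lemma normc_real x : normc x%:C = `|x|.
Proof. by rewrite /= expr0n /= addr0 sqrtr_sqr. Qed.

Lemma normc_conj z : normc (conjc z) = normc z.
Proof. by case: z => a b /=; rewrite sqrrN. Qed.

Lemma normc_i : normc 'i%C = 1 :> R.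
Proof. by rewrite /= expr0n expr1n add0r sqrtr1. Qed.

Lemma normc1' : normc (1 : C) = 1. Proof. by rewrite (normc_real 1) normr1. Qed.

Lemma normcX z n : normc (z ^+ n) = normc z ^+ n.
Proof.
elim: n => [|n IH]; first by rewrite !expr0 normc1'.
by rewrite !exprS normcM IH.
Qed.

Lemma cReD z w : Re (z + w) = Re z + Re w. Proof. by case: z; case: w. Qed.
Lemma cImD z w : Im (z + w) = Im z + Im w. Proof. by case: z; case: w. Qed.
Lemma cReN z : Re (- z) = - Re z. Proof. by case: z. Qed.
Lemma cImN z : Im (- z) = - Im z. Proof. by case: z. Qed.
Lemma cReB z w : Re (z - w) = Re z - Re w. Proof. by rewrite cReD cReN. Qed.
Lemma cImB z w : Im (z - w) = Im z - Im w. Proof. by rewrite cImD cImN. Qed.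
Lemma cReM z w : Re (z * w) = Re z * Re w - Im z * Im w.
Proof. by case: z; case: w. Qed.
Lemma cImM z w : Im (z * w) = Re z * Im w + Im z * Re w.
Proof. by case: z; case: w. Qed.
Lemma cReV z : Re z^-1 = Re z / (Re z ^+ 2 + Im z ^+ 2).
Proof. by case: z. Qed.
Lemma cImV z : Im z^-1 = - (Im z / (Re z ^+ 2 + Im z ^+ 2)).
Proof. by case: z. Qed.

Lemma complex_eq z w : Re z = Re w -> Im z = Im w -> z = w.
Proof. by case: z; case: w => a b c d /= -> ->. Qed.

(** The derivative with a linear error term, which composes without dividing
by the increment. *)
Definition cderiv F z d := forall e : R, 0 < e -> exists2 r : R, 0 < r &
  forall h, normc h < r -> normc (F (z + h) - F z - d * h) <= e * normc h.

Definition chol F z := derivable (F : C^o -> C^o) z 1.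

Lemma cholP F z : chol F z <-> exists d, cderiv F z d.
Proof.
split=> [|[d Hd]].
  move=> /cvg_ex[/= l /cvgrPdist_le Hl]; exists l => e e0.
  have e0C : 0 < (e%:C : C) by rewrite ltcR.
  have /nbhs_ballP[r /= r0 rP] := Hl _ e0C.
  have [Im0 r0R] : Im r = 0 /\ 0 < Re r.
    by move: r0; rewrite ltcE /= => /andP[/eqP -> ->].
  exists (Re r) => // h hr.
  have [->|h0] := eqVneq h 0.
    rewrite addr0 subrr mulr0 subr0; have -> : normc (0 : C) = 0.
      by rewrite (normc_real 0) normr0.
    by rewrite mulr0.
  have := rP h; rewrite /ball /= sub0r normrN complexnormE.
  have -> : r = (Re r)%:C by apply: complex_eq.
  rewrite ltcR hr => /(_ isT h0).
  rewrite complexnormE lecR -[h%:A]/(h * 1) mulr1.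
  rewrite -[h^-1 *: _]/(h^-1 * _) => H.
  have -> : F (z + h) - F z - l * h = - (h * (l - h^-1 * (F (h + z) - F z))).
    by rewrite [z + h]addrC; field.
  by rewrite normcN normcM mulrC ler_wpM2r ?normc_ge0.
apply/cvg_ex; exists d; apply/cvgrPdist_le => /= e e0.
have [Im0 e0R] : Im e = 0 /\ 0 < Re e.
  by move: e0; rewrite ltcE /= => /andP[/eqP -> ->].
have [r r0 rP] := Hd _ e0R.
apply/nbhs_ballP; exists r%:C => /=; first by rewrite ltcR.
move=> h; rewrite /ball /= sub0r normrN complexnormE ltcR => hr h0.
have -> : e = (Re e)%:C by apply: complex_eq.
rewrite complexnormE lecR -[h%:A]/(h * 1) mulr1 -[h^-1 *: _]/(h^-1 * _).
have -> : d - h^-1 * (F (h + z) - F z) = - (h^-1 * (F (z + h) - F z - d * h)).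
  by rewrite [z + h]addrC; field.
rewrite normcN normcM normcV.
have hp : 0 < normc h by rewrite normc_gt0.
by rewrite mulrC ler_pdivrMr// rP.
Qed.

Definition ccont F z := forall e : R, 0 < e -> exists2 r : R, 0 < r &
  forall h, normc h < r -> normc (F (z + h) - F z) < e.

Lemma cderiv_cont F z d : cderiv F z d -> ccont F z.
Proof.
move=> H e e0; have [r r0 rP] := H 1 ltr01.
have m0 : 0 < Num.min r (e / (2 + normc d)).
  by rewrite lt_min r0 divr_gt0// ltr_wpDr// normc_ge0.
exists (Num.min r (e / (2 + normc d))) => // h; rewrite lt_min => /andP[hr he].
have := rP _ hr; rewrite mul1r => Hh.
have -> : F (z + h) - F z = (F (z + h) - F z - d * h) + d * h by rewrite subrK.
apply: le_lt_trans (le_normcD _ _) _.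
rewrite normcM.
have d0 := normc_ge0 d; have h0 := normc_ge0 h.
move: he; rewrite ltr_pdivlMr; last by lra.
nra.
Qed.

Lemma chol_cont F z : chol F z -> ccont F z.
Proof. by move=> /cholP[d]; exact: cderiv_cont. Qed.

(** The paths used are horizontal and vertical lines, which do not increase
distances. *)
Lemma cont_path F (p : R -> C) x : ccont F (p x) ->
  (forall y, normc (p y - p x) <= `|y - x|) ->
  {for x, continuous (fun s => Re (F (p s)))} /\
  {for x, continuous (fun s => Im (F (p s)))}.
Proof.
move=> cF pL; split; apply/cont_epsP => e e0; have [r r0 rP] := cF e e0;
  exists r => // y yx; have := rP (p y - p x) (le_lt_trans (pL y) yx);
  rewrite [p x + _]addrC subrK; apply: le_lt_trans.
- by rewrite -cReB; exact: normc_Re.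
- by rewrite -cImB; exact: normc_Im.
Qed.

Lemma hline_lip c x y : normc ((y +i* c) - (x +i* c)) <= `|y - x|.
Proof.
apply: le_trans (normc_le_ReIm _) _; rewrite /= subrr normr0 addr0.
by [].
Qed.

Lemma vline_lip c x y : normc ((c +i* y) - (c +i* x)) <= `|y - x|.
Proof.
by apply: le_trans (normc_le_ReIm _) _; rewrite /= subrr normr0 add0r.
Qed.

Lemma chol_cst k z : chol (fun=> k) z.
Proof. exact: derivable_cst. Qed.

Lemma chol_id z : chol id z.
Proof. exact: derivable_id. Qed.

Lemma cholD F G z : chol F z -> chol G z -> chol (fun w => F w + G w) z.
Proof. exact: derivableD. Qed.

Lemma cholB F G z : chol F z -> chol G z -> chol (fun w => F w - G w) z.
Proof. exact: derivableB. Qed.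

Lemma cholM F G z : chol F z -> chol G z -> chol (fun w => F w * G w) z.
Proof. exact: derivableM. Qed.

Lemma cholV F z : F z != 0 -> chol F z -> chol (fun w => (F w)^-1) z.
Proof. exact: derivableV. Qed.

Lemma cderiv_comp F G z d d' : cderiv G z d -> cderiv F (G z) d' ->
  cderiv (fun w => F (G w)) z (d' * d).
Proof.
move=> HG HF e e0.
have n0 := normc_ge0 d; have n0' := normc_ge0 d'.
pose e1 := e / (2 * (normc d + 1)).
pose e2 := Num.min 1 (e / (2 * (normc d' + 1))).
have e1_0 : 0 < e1 by rewrite divr_gt0// mulr_gt0//; lra.
have e2_0 : 0 < e2 by rewrite lt_min ltr01 divr_gt0// mulr_gt0//; lra.
have [r1 r10 r1P] := HF _ e1_0; have [r2 r20 r2P] := HG _ e2_0.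
have q0 : 0 < r1 / (normc d + 1) by rewrite divr_gt0//; lra.
exists (Num.min r2 (r1 / (normc d + 1))); first by rewrite lt_min r20.
move=> h; rewrite lt_min => /andP[h2 hq].
have h0 := normc_ge0 h.
have P2 := r2P _ h2; set k := G (z + h) - G z in P2.
have kh : normc k <= (normc d + e2) * normc h.
  have -> : k = (k - d * h) + d * h by rewrite subrK.
  apply: le_trans (le_normcD _ _) _.
  by rewrite normcM mulrDl addrC lerD2l.
have e21 : e2 <= 1 by rewrite ge_min lexx.
have kr : normc k < r1.
  by move: hq; rewrite ltr_pdivlMr; [nra|lra].
have P1 := r1P _ kr.
have -> : F (G (z + h)) - F (G z) - d' * d * h =
    (F (G z + k) - F (G z) - d' * k) + d' * (k - d * h).
  by rewrite /k [G z + _]addrC subrK; ring.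
apply: le_trans (le_normcD _ _) _; rewrite normcM.
have A1 : e1 * (normc d + e2) <= e / 2.
  have <- : e1 * (normc d + 1) = e / 2 by rewrite /e1; field; lra.
  by rewrite ler_pM2l//; lra.
have A2 : normc d' * e2 <= e / 2.
  have <- : (normc d' + 1) * (e / (2 * (normc d' + 1))) = e / 2 by field; lra.
  have := ge_min e2 1 (e / (2 * (normc d' + 1))).
  rewrite lexx => H; apply: ler_pM => //; first exact: ltW.
    by lra.
  by rewrite ge_min lexx orbT.
have B1 : e1 * normc k <= e1 * (normc d + e2) * normc h.
  by rewrite -mulrA ler_pM2l.
have B2 : normc d' * normc (k - d * h) <= normc d' * e2 * normc h.
  by rewrite -mulrA ler_wpM2l.
nra.
Qed.

Lemma chol_comp F G z : chol G z -> chol F (G z) -> chol (fun w => F (G w)) z.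
Proof.
move=> /cholP[d HG] /cholP[d' HF]; apply/cholP; exists (d' * d).
exact: cderiv_comp.
Qed.

Lemma cholX F z n : chol F z -> chol (fun w => F w ^+ n) z.
Proof.
move=> HF; elim: n => [|n IH]; first exact: chol_cst.
by under eq_fun do rewrite exprS; exact: cholM.
Qed.

Lemma chol_near F G z r : 0 < r ->
  (forall w, normc (w - z) < r -> F w = G w) -> chol F z -> chol G z.
Proof.
move=> r0 FG /cholP[d H]; apply/cholP; exists d => e e0.
have [s s0 sP] := H e e0; exists (Num.min r s); first by rewrite lt_min r0.
move=> h; rewrite lt_min => /andP[hr hs].
have zz : normc (z - z) < r by rewrite subrr (normc_real 0) normr0.
have zh : normc (z + h - z) < r by rewrite [z + h]addrC addrK.
by rewrite -!FG//; exact: sP.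
Qed.

End cplx.

(** * Goursat's theorem on rectangles *)

Section goursat.
Context (R : realType).
Local Notation C := R[i].
Local Notation leb := (@lebesgue_measure R).
Implicit Types (z w h k : C) (g F G : C -> C) (a b c d x y : R).

(** The real part of the integral of g dz along the positively oriented boundary
of [a, b] x [c, d]. Keeping only the real part makes it a combination of real
integrals; a unimodular factor in front of g recovers any other component. *)
Definition Phi g a b c d : R :=
  \int[leb]_(x in `[a, b]) (Re (g (x +i* c)) - Re (g (x +i* d))) -
  \int[leb]_(y in `[c, d]) (Im (g (b +i* y)) - Im (g (a +i* y))).

Definition hcont g a b c := forall x, a <= x <= b -> ccont g (x +i* c).
Definition vcont g c d a := forall y, c <= y <= d -> ccont g (a +i* y).

Lemma hcont_on g a b c : hcont g a b c ->
  cont_on a b (fun x => Re (g (x +i* c))) /\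
  cont_on a b (fun x => Im (g (x +i* c))).
Proof.
move=> H; split=> x /H cg;
by have [] := cont_path (p := fun x => x +i* c) cg (fun y => hline_lip c x y).
Qed.

Lemma vcont_on g c d a : vcont g c d a ->
  cont_on c d (fun y => Re (g (a +i* y))) /\
  cont_on c d (fun y => Im (g (a +i* y))).
Proof.
move=> H; split=> x /H cg;
by have [] := cont_path (p := fun y => a +i* y) cg (fun y => vline_lip a x y).
Qed.

Lemma Phi_splitH g a m b c d : a <= m -> m <= b ->
  hcont g a b c -> hcont g a b d ->
  vcont g c d a -> vcont g c d m -> vcont g c d b ->
  Phi g a b c d = Phi g a m c d + Phi g m b c d.
Proof.
move=> am mb hc hd va vm vb; rewrite /Phi.
rewrite (seg_split am mb); last first.
  by apply: cont_onB; [exact: (hcont_on hc).1|exact: (hcont_on hd).1].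
have [[_ ia] [_ im] [_ ib]] := And3 (vcont_on va) (vcont_on vm) (vcont_on vb).
rewrite [X in _ - X = _]segB// [X in _ = _ - X + _]segB//.
by rewrite [X in _ = _ + (_ - X)]segB//; ring.
Qed.

Lemma Phi_splitV g a b c m d : c <= m -> m <= d ->
  vcont g c d a -> vcont g c d b ->
  hcont g a b c -> hcont g a b m -> hcont g a b d ->
  Phi g a b c d = Phi g a b c m + Phi g a b m d.
Proof.
move=> cm md va vb hc hm hd; rewrite /Phi.
rewrite [X in _ - X](seg_split cm md); last first.
  by apply: cont_onB; [exact: (vcont_on vb).2|exact: (vcont_on va).2].
have [[ia _] [im _] [ib _]] := And3 (hcont_on hc) (hcont_on hm) (hcont_on hd).
rewrite [X in X - _ = _]segB// [X in _ = X - _ + _]segB//.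
by rewrite [X in _ = _ + (X - _)]segB//; ring.
Qed.

Lemma Phi_bound g a b c d M : a <= b -> c <= d ->
  hcont g a b c -> hcont g a b d -> vcont g c d a -> vcont g c d b ->
  (forall x, a <= x <= b -> normc (g (x +i* c)) <= M /\ normc (g (x +i* d)) <= M) ->
  (forall y, c <= y <= d -> normc (g (a +i* y)) <= M /\ normc (g (b +i* y)) <= M) ->
  `|Phi g a b c d| <= 2 * M * (b - a + (d - c)).
Proof.
move=> ab cd hc hd va vb bh bv.
have [[rc _] [rd _]] := conj (hcont_on hc) (hcont_on hd).
have [[_ ia] [_ ib]] := conj (vcont_on va) (vcont_on vb).
apply: le_trans (ler_normB _ _) _; rewrite mulrDr; apply: lerD.
  apply: seg_norm_le => //; first exact: cont_onB.
  move=> x /bh [h1 h2]; apply: le_trans (ler_normB _ _) _.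
  by have := normc_Re (g (x +i* c)); have := normc_Re (g (x +i* d)); lra.
apply: seg_norm_le => //; first exact: cont_onB.
move=> y /bv [h1 h2]; apply: le_trans (ler_normB _ _) _.
by have := normc_Im (g (a +i* y)); have := normc_Im (g (b +i* y)); lra.
Qed.

(** The affine part g p + q (z - p) contributes l l' Im q to each of the two
integrals in [Phi], and these cancel; what remains is the error term e (l + l')
integrated over the boundary. *)
Lemma Phi_local g p q : cderiv g p q -> forall e : R, 0 < e -> exists2 r : R, 0 < r &
  forall x y l l', 0 <= l -> 0 <= l' -> l + l' < r ->
    x <= Re p <= x + l -> y <= Im p <= y + l' ->
    (forall z, x <= Re z <= x + l -> y <= Im z <= y + l' -> ccont g z) ->
    `|Phi g x (x + l) y (y + l')| <= 2 * e * (l + l') ^+ 2.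
Proof.
move=> H e e0; have [r r0 rP] := H e e0; exists r => //.
move=> x y l l' l0 l0' ll xp yp cg.
have near z : x <= Re z <= x + l -> y <= Im z <= y + l' ->
    normc (g z - g p - q * (z - p)) <= e * (l + l').
  move=> xz yz; have zp : normc (z - p) <= l + l'.
    apply: le_trans (normc_le_ReIm _) _; rewrite cReB cImB.
    by apply: lerD; rewrite ler_norml; lra.
  have := rP (z - p) (le_lt_trans zp ll); rewrite [p + _]addrC subrK => hz.
  by apply: le_trans hz _; rewrite ler_pM2l.
have hx : x <= x + l by lra.
have hy : y <= y + l' by lra.
have H1 : `|\int[leb]_(s in `[x, x + l])
   (Re (g (s +i* y)) - Re (g (s +i* (y + l')))) - (l' * Im q) * (x + l - x)|
   <= 2 * e * (l + l') * (x + l - x).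
  apply: seg_near_cst => //.
    have h1 : hcont g x (x + l) y by move=> s sx; apply: cg => //=; lra.
    have h2 : hcont g x (x + l) (y + l') by move=> s sx; apply: cg => //=; lra.
    by apply: cont_onB; [exact: (hcont_on h1).1|exact: (hcont_on h2).1].
  move=> s sx.
  have n1 := near (s +i* y) sx _; have n2 := near (s +i* (y + l')) sx _.
  have m1 := le_trans (normc_Re _) (n1 _).
  have m2 := le_trans (normc_Re _) (n2 _).
  have {}m1 := m1 ltac:(move=> /=; lra).
  have {}m2 := m2 ltac:(move=> /=; lra).
  move: m1 m2; rewrite !cReB !cReM !cReB !cImB /=.
  rewrite !ler_norml => /andP[p1 p2] /andP[p3 p4]; apply/andP; split; nra.
have H2 : `|\int[leb]_(s in `[y, y + l'])
   (Im (g ((x + l) +i* s)) - Im (g (x +i* s))) - (l * Im q) * (y + l' - y)|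
   <= 2 * e * (l + l') * (y + l' - y).
  apply: seg_near_cst => //.
    have h1 : vcont g y (y + l') x by move=> s sx; apply: cg => //=; lra.
    have h2 : vcont g y (y + l') (x + l) by move=> s sx; apply: cg => //=; lra.
    by apply: cont_onB; [exact: (vcont_on h2).2|exact: (vcont_on h1).2].
  move=> s sx.
  have n1 := near (x +i* s) _ sx; have n2 := near ((x + l) +i* s) _ sx.
  have m1 := le_trans (normc_Im _) (n1 _).
  have m2 := le_trans (normc_Im _) (n2 _).
  have {}m1 := m1 ltac:(move=> /=; lra).
  have {}m2 := m2 ltac:(move=> /=; lra).
  move: m1 m2; rewrite !cImB !cImM !cReB !cImB /=.
  rewrite !ler_norml => /andP[p1 p2] /andP[p3 p4]; apply/andP; split; nra.
rewrite /Phi; move: H1 H2.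
set I1 := (\int[leb]_(s in `[x, x + l]) _).
set I2 := (\int[leb]_(s in `[y, y + l']) _).
have -> : x + l - x = l by ring.
have -> : y + l' - y = l' by ring.
rewrite !ler_norml => /andP[p1 p2] /andP[p3 p4]; apply/andP; split; nra.
Qed.

(** The boundary integrals of the four quarters add up to that of the whole. *)
Lemma Phi_quarter g x y l l' m : 0 <= l -> 0 <= l' ->
  (forall z, x <= Re z <= x + 2 * l -> y <= Im z <= y + 2 * l' -> ccont g z) ->
  4 * m <= `|Phi g x (x + 2 * l) y (y + 2 * l')| ->
  exists x' y', [/\ x' = x \/ x' = x + l, y' = y \/ y' = y + l' &
    m <= `|Phi g x' (x' + l) y' (y' + l')|].
Proof.
move=> l0 l0' cg big.
have hc x1 x2 y0 : x <= x1 -> x2 <= x + 2 * l -> y <= y0 <= y + 2 * l' ->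
    hcont g x1 x2 y0.
  move=> h1 h2 h3 s /andP[s1 s2]; apply: cg => //=.
  by rewrite (le_trans h1 s1) (le_trans s2 h2).
have vc y1 y2 x0 : y <= y1 -> y2 <= y + 2 * l' -> x <= x0 <= x + 2 * l ->
    vcont g y1 y2 x0.
  move=> h1 h2 h3 s /andP[s1 s2]; apply: cg => //=.
  by rewrite (le_trans h1 s1) (le_trans s2 h2).
clear cg; move: big.
have x1 : x <= x + l by rewrite lerDl.
have x2 : x + l <= x + l + l by rewrite lerDl.
have x3 := le_trans x1 x2.
have y1 : y <= y + l' by rewrite lerDl.
have y2 : y + l' <= y + l' + l' by rewrite lerDl.
have y3 := le_trans y1 y2.
have Ex : x + 2 * l = x + l + l by ring.
have Ey : y + 2 * l' = y + l' + l' by ring.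
rewrite Ex Ey in hc vc *.
have E : Phi g x (x + l + l) y (y + l' + l') =
   Phi g x (x + l) y (y + l') + Phi g x (x + l) (y + l') (y + l' + l') +
   (Phi g (x + l) (x + l + l) y (y + l') +
    Phi g (x + l) (x + l + l) (y + l') (y + l' + l')).
  rewrite (@Phi_splitH g x (x + l))//;
    try by [apply: hc; rewrite ?lexx ?y3|apply: vc; rewrite ?lexx ?x1 ?x2 ?x3].
  congr (_ + _); apply: Phi_splitV => //;
    by [apply: hc; rewrite ?lexx ?y1 ?y2 ?y3|apply: vc; rewrite ?lexx ?x1 ?x2 ?x3].
rewrite E => big.
case: (lerP m `|Phi g x (x + l) y (y + l')|) => [h|s1].
  by exists x, y; split => //; left.
case: (lerP m `|Phi g x (x + l) (y + l') (y + l' + l')|) => [h|s2].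
  by exists x, (y + l'); split => //; [left|right].
case: (lerP m `|Phi g (x + l) (x + l + l) y (y + l')|) => [h|s3].
  by exists (x + l), y; split => //; [right|left].
case: (lerP m `|Phi g (x + l) (x + l + l) (y + l') (y + l' + l')|) => [h|s4].
  by exists (x + l), (y + l'); split => //; right.
exfalso; move: big; apply/negP; rewrite -ltNge.
apply: le_lt_trans (ler_normD _ _) _.
have := ler_normD (Phi g x (x + l) y (y + l'))
  (Phi g x (x + l) (y + l') (y + l' + l')).
have := ler_normD (Phi g (x + l) (x + l + l) y (y + l'))
  (Phi g (x + l) (x + l + l) (y + l') (y + l' + l')).
clear - s1 s2 s3 s4; lra.
Qed.

(** Goursat's bisection: if the integral were not zero, some quarter would carry
at least a quarter of it, and so on. The nested rectangles shrink to a point at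
which [Phi_local] makes the integrals too small. *)
Lemma goursat g a b c d : a <= b -> c <= d ->
  (forall z, a <= Re z <= b -> c <= Im z <= d -> chol g z) ->
  Phi g a b c d = 0.
Proof.
move=> ab cd Hg; apply: contrapT => /eqP Phi0.
have cg z : a <= Re z <= b -> c <= Im z <= d -> ccont g z.
  by move=> h1 h2; apply: chol_cont; exact: Hg.
pose kap := `|Phi g a b c d|; have kap0 : 0 < kap by rewrite normr_gt0.
pose L := b - a; pose L' := d - c.
have L0 : 0 <= L by rewrite /L; lra.
have L0' : 0 <= L' by rewrite /L'; lra.
pose len (l : R) (n : nat) := l / 2 ^+ n.
have len_ge0 l n : 0 <= l -> 0 <= len l n by move=> ?; rewrite divr_ge0 ?exprn_ge0.
have lenS l n : len l n = 2 * len l n.+1.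
  by rewrite /len exprS; field; rewrite expf_neq0.
pose Q (t : nat * (R * R)) := let: (n, (x, y)) := t in
  [/\ a <= x, x + len L n <= b, c <= y, y + len L' n <= d &
   kap / 4 ^+ n <= `|Phi g x (x + len L n) y (y + len L' n)|].
pose S (t t' : nat * (R * R)) := [/\ t'.1 = t.1.+1,
  t.2.1 <= t'.2.1, t'.2.1 + len L t'.1 <= t.2.1 + len L t.1,
  t.2.2 <= t'.2.2 & t'.2.2 + len L' t'.1 <= t.2.2 + len L' t.1].
have step t : exists t', Q t -> Q t' /\ S t t'.
  have [Qt|nQ] := pselect (Q t); last by exists t => /nQ.
  case: t Qt => n [x y] [ax xb cy yd big].
  have l0 := len_ge0 _ n.+1 L0; have l0' := len_ge0 _ n.+1 L0'.
  rewrite (lenS L) (lenS L') in xb yd big.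
  have e4 : kap / 4 ^+ n = 4 * (kap / 4 ^+ n.+1).
    by rewrite exprS; field; rewrite expf_neq0.
  rewrite e4 in big.
  have cgl z : x <= Re z <= x + 2 * len L n.+1 ->
      y <= Im z <= y + 2 * len L' n.+1 -> ccont g z.
    by move=> /andP[h1 h2] /andP[h3 h4]; apply: cg; apply/andP; split;
      [exact: le_trans h1|exact: le_trans xb|exact: le_trans h3|exact: le_trans yd].
  have [x' [y' [hx hy hm]]] := Phi_quarter l0 l0' cgl big.
  exists (n.+1, (x', y')) => _; rewrite /Q /S /= (lenS L n) (lenS L' n).
  move: (len L n.+1) (len L' n.+1) l0 l0' xb yd hx hy hm => l l' l0 l0' xb yd.
  clear - l0 l0' xb yd ax cy => hx hy hm.
  by case: hx => hx; case: hy => hy; subst x' y'; split; split => //; lra.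
have [f fP] := choice step.
pose t n := iter n f (0%N, (a, c)).
have len0 l : len l 0 = l by rewrite /len expr0 divr1.
have Q0 : Q (t 0%N).
  rewrite /t /Q /= !len0 expr0 divr1.
  have -> : a + L = b by rewrite /L; ring.
  by have -> : c + L' = d by rewrite /L'; ring.
have Qt n : Q (t n) by elim: n => //= n /fP [].
have St n : S (t n) (t n.+1) by have [] := fP _ (Qt n).
have t1 n : (t n).1 = n by elim: n => //= n IH; have [-> _] := St n; rewrite IH.
pose X n := (t n).2.1; pose Y n := (t n).2.2.
have QE n : [/\ a <= X n, X n + len L n <= b, c <= Y n, Y n + len L' n <= d &
   kap / 4 ^+ n <= `|Phi g (X n) (X n + len L n) (Y n) (Y n + len L' n)|].
  by have := Qt n; have := t1 n; rewrite /X /Y; case: (t n) => [_ [? ?]] /= ->.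
have mono n m : (n <= m)%N -> [/\ X n <= X m, X m + len L m <= X n + len L n,
   Y n <= Y m & Y m + len L' m <= Y n + len L' n].
  move=> /subnK <-; elim: (m - n)%N => [|k [i1 i2 i3 i4]].
    by rewrite add0n.
  have [_ j1 j2 j3 j4] := St (k + n)%N.
  rewrite -/(X (k + n)%N) -/(X (k + n).+1) -/(Y (k + n)%N) -/(Y (k + n).+1) !t1
    in j1 j2 j3 j4.
  by rewrite addSn; split; lra.
have sup_in (Z : nat -> R) (l : R) : 0 <= l ->
    (forall n m, (n <= m)%N -> Z n <= Z m /\ Z m + len l m <= Z n + len l n) ->
    exists p, forall n, Z n <= p <= Z n + len l n.
  move=> l0 Zm; exists (sup (range Z)) => n.
  have ubZ (k : nat) : ubound (range Z) (Z k + len l k).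
    move=> _ [m _ <-]; case: (leqP m k) => mk.
      by have [h _] := Zm _ _ mk; have := len_ge0 l k l0; lra.
    by have [_ h] := Zm _ _ (ltnW mk); have := len_ge0 l m l0; lra.
  apply/andP; split; last by apply: ge_sup; [by exists (Z 0%N), 0%N|exact: ubZ].
  by apply: ub_le_sup; [exists (Z n + len l n); exact: ubZ|exists n].
have [px pxP] : exists p, forall n, X n <= p <= X n + len L n.
  by apply: sup_in => // n m /mono[].
have [py pyP] : exists p, forall n, Y n <= p <= Y n + len L' n.
  by apply: sup_in => // n m /mono[].
have pin : chol g (px +i* py).
  have [q1 q2 q3 q4 _] := QE 0%N; have := pxP 0%N; have := pyP 0%N.
  by move=> r1 r2; apply: Hg => /=; lra.
have [q Hq] := (cholP _ _).1 pin.
have e0 : 0 < kap / (4 * ((L + L') ^+ 2 + 1)).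
  by rewrite divr_gt0// mulr_gt0//; have := sqr_ge0 (L + L'); lra.
have [r r0 rP] := Phi_local Hq e0.
set e := kap / _ in e0 rP.
have [n nP] : exists n, len L n + len L' n < r.
  have q0 : 0 <= (L + L') / r by apply: divr_ge0; [exact: addr_ge0|exact: ltW].
  have := archi_boundP q0.
  set N := Num.bound _ => hN; exists N.
  rewrite /len -mulrDl ltr_pdivrMr ?exprn_gt0//.
  move: hN; rewrite ltr_pdivrMr// mulrC => hN; apply: lt_le_trans hN _.
  rewrite ler_pM2l// -natrX ler_nat; exact/ltnW/ltn_expl.
have [q1 q2 q3 q4 q5] := QE n.
have := rP (X n) (Y n) _ _ (len_ge0 _ n L0) (len_ge0 _ n L0') nP (pxP n) (pyP n).
have cgn z : X n <= Re z <= X n + len L n -> Y n <= Im z <= Y n + len L' n ->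
    ccont g z by move=> h1 h2; apply: cg; lra.
move=> /(_ cgn) up; have := le_trans q5 up.
rewrite /len -mulrDl expr_div_n -exprM mulnC exprM.
have -> : (2 : R) ^+ 2 = 4 by ring.
rewrite mulrA ler_pM2r ?invr_gt0 ?exprn_gt0//.
rewrite leNgt => /negP; apply.
have den0 : 0 < (L + L') ^+ 2 + 1 by have := sqr_ge0 (L + L'); lra.
have -> : 2 * e * (L + L') ^+ 2 = kap * ((L + L') ^+ 2 / (2 * ((L + L') ^+ 2 + 1))).
  by rewrite /e; field; lra.
rewrite gtr_pMr// ltr_pdivrMr; last by lra.
lra.
Qed.

End goursat.

Section cauchy.
Context (R : realType).
Local Notation C := R[i].
Implicit Types (z w h : C) (g F G H : C -> C) (a b c d x y k : R).

(** Continuity on the boundary only: the integrands met below have a pole inside. *)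
Definition bcont g a b c d :=
  [/\ hcont g a b c, hcont g a b d, vcont g c d a & vcont g c d b].

Lemma PhiB F G a b c d : bcont F a b c d -> bcont G a b c d ->
  Phi (fun z => F z - G z) a b c d = Phi F a b c d - Phi G a b c d.
Proof.
move=> [/hcont_on[f1 _] /hcont_on[f2 _] /vcont_on[_ f3] /vcont_on[_ f4]].
move=> [/hcont_on[g1 _] /hcont_on[g2 _] /vcont_on[_ g3] /vcont_on[_ g4]].
rewrite /Phi.
rewrite (@seg_eq R a b _ (fun x => (Re (F (x +i* c)) - Re (F (x +i* d)))
  - (Re (G (x +i* c)) - Re (G (x +i* d))))); last first.
  by move=> x _; rewrite !cReB; ring.
rewrite (@seg_eq R c d _ (fun y => (Im (F (b +i* y)) - Im (F (a +i* y)))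
  - (Im (G (b +i* y)) - Im (G (a +i* y))))); last first.
  by move=> x _; rewrite !cImB; ring.
rewrite segB; [|exact: cont_onB..].
by rewrite [X in _ - X = _]segB; [ring|exact: cont_onB..].
Qed.

Lemma PhiZ G a b c d k : bcont G a b c d ->
  Phi (fun z => k%:C * G z) a b c d = k * Phi G a b c d.
Proof.
move=> [/hcont_on[g1 _] /hcont_on[g2 _] /vcont_on[_ g3] /vcont_on[_ g4]].
rewrite /Phi mulrBr -!segZ; [|exact: cont_onB..].
congr (_ - _); apply: seg_eq => x _.
  by rewrite !cReM /= !mul0r !subr0 mulrBr.
by rewrite !cImM /= !mul0r !addr0 mulrBr.
Qed.

(** Cutting off a small square around z0 leaves rectangles on which [goursat]
applies, and the integral over the small square is at most M times its
perimeter. *)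
Lemma goursat_exc g z0 a b c d : a < Re z0 < b -> c < Im z0 < d ->
  (forall z, a <= Re z <= b -> c <= Im z <= d -> z != z0 -> chol g z) ->
  (exists M r : R, 0 < r /\
    forall z, z != z0 -> normc (z - z0) < r -> normc (g z) <= M) ->
  Phi g a b c d = 0.
Proof.
move=> /andP[ax xb] /andP[cy yd] Hg [M [r [r0 rM]]].
have M0 : 0 <= M.
  have := rM (z0 + (r / 2)%:C); rewrite [z0 + _]addrC addrK normc_real.
  rewrite -subr_eq0 addrK => H; apply: le_trans (normc_ge0 _) (H _ _).
    by rewrite -normc_gt0 normc_real gtr0_norm; lra.
  by rewrite gtr0_norm; lra.
set x0 := Re z0 in ax xb; set y0 := Im z0 in cy yd.
have small dl : 0 < dl -> a <= x0 - dl -> x0 + dl <= b -> c <= y0 - dl ->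
    y0 + dl <= d -> 2 * dl < r -> `|Phi g a b c d| <= 2 * M * (4 * dl).
  move=> d0 ad db cd' d'd dr.
  have neH x y : y != y0 -> x +i* y != z0.
    by apply: contra_neq => E; rewrite /y0 -E.
  have neV x y : x != x0 -> x +i* y != z0.
    by apply: contra_neq => E; rewrite /x0 -E.
  have hc x1 x2 y : a <= x1 -> x2 <= b -> c <= y <= d -> y != y0 ->
      hcont g x1 x2 y.
    move=> h1 h2 h3 yy s /andP[s1 s2]; apply/chol_cont/Hg => //=.
      by rewrite (le_trans h1)// (le_trans s2).
    exact: neH.
  have vc y1 y2 x : c <= y1 -> y2 <= d -> a <= x <= b -> x != x0 ->
      vcont g y1 y2 x.
    move=> h1 h2 h3 yy s /andP[s1 s2]; apply/chol_cont/Hg => //=.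
      by rewrite (le_trans h1)// (le_trans s2).
    exact: neV.
  have gz x1 x2 y1 y2 : a <= x1 -> x1 <= x2 -> x2 <= b -> c <= y1 -> y1 <= y2 ->
      y2 <= d -> x2 < x0 \/ x0 < x1 \/ y2 < y0 \/ y0 < y1 ->
      Phi g x1 x2 y1 y2 = 0.
    move=> h1 h2 h3 h4 h5 h6 hh; apply: goursat => // z zx zy; apply: Hg.
    - by clear -zx h1 h3; lra.
    - by clear -zy h4 h6; lra.
    - apply/eqP => E; move: hh; rewrite /x0 /y0 -E; clear -zx zy; lra.
  have A1 : a <= b by clear -ax xb; lra.
  have A2 : c <= d by clear -cy yd; lra.
  have B1 : x0 - dl <= x0 + dl by clear -d0; lra.
  have B2 : y0 - dl <= y0 + dl by clear -d0; lra.
  have B3 : x0 - dl <= b by clear -d0 xb; lra.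
  have B4 : y0 - dl <= d by clear -d0 yd; lra.
  have B5 : a <= x0 + dl by clear -d0 ax; lra.
  have B6 : c <= y0 + dl by clear -d0 cy; lra.
  have ne1 : x0 - dl != x0 by rewrite lt_eqF//; clear -d0; lra.
  have ne2 : x0 + dl != x0 by rewrite gt_eqF//; clear -d0; lra.
  have ne3 : y0 - dl != y0 by rewrite lt_eqF//; clear -d0; lra.
  have ne4 : y0 + dl != y0 by rewrite gt_eqF//; clear -d0; lra.
  have ne5 : a != x0 by rewrite lt_eqF.
  have ne6 : b != x0 by rewrite gt_eqF.
  have ne7 : c != y0 by rewrite lt_eqF.
  have ne8 : d != y0 by rewrite gt_eqF.
  have G1 : Phi g a (x0 - dl) c d = 0.
    by apply: gz => //; left; clear -d0; lra.
  have G2 : Phi g (x0 + dl) b c d = 0.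
    by apply: gz => //; right; left; clear -d0; lra.
  have G3 : Phi g (x0 - dl) (x0 + dl) c (y0 - dl) = 0.
    by apply: gz => //; right; right; left; clear -d0; lra.
  have G4 : Phi g (x0 - dl) (x0 + dl) (y0 + dl) d = 0.
    by apply: gz => //; right; right; right; clear -d0; lra.
  have -> : Phi g a b c d = Phi g (x0 - dl) (x0 + dl) (y0 - dl) (y0 + dl).
    rewrite (@Phi_splitH _ g a (x0 - dl))//; [|apply: hc|apply: hc|apply: vc|apply: vc|apply: vc];
      rewrite ?lexx ?ad ?B3 ?A1 ?A2//.
    rewrite G1 add0r (@Phi_splitH _ g (x0 - dl) (x0 + dl))//;
      [|apply: hc|apply: hc|apply: vc|apply: vc|apply: vc];
      rewrite ?lexx ?ad ?B3 ?B5 ?A1 ?A2//.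
    rewrite G2 addr0 (@Phi_splitV _ g _ _ c (y0 - dl))//;
      [|apply: vc|apply: vc|apply: hc|apply: hc|apply: hc];
      rewrite ?lexx ?ad ?cd' ?B3 ?B5 ?B4 ?A1 ?A2//.
    rewrite G3 add0r (@Phi_splitV _ g _ _ (y0 - dl) (y0 + dl))//;
      [|apply: vc|apply: vc|apply: hc|apply: hc|apply: hc];
      rewrite ?lexx ?ad ?cd' ?d'd ?B3 ?B5 ?B4 ?B6 ?A1 ?A2//.
    by rewrite G4 addr0.
  apply: le_trans (@Phi_bound _ g _ _ _ _ M B1 B2 _ _ _ _ _ _) _.
  - by apply: hc; rewrite ?cd' ?B4.
  - by apply: hc; rewrite ?d'd ?B6.
  - by apply: vc; rewrite ?ad ?B3.
  - by apply: vc; rewrite ?db ?B5.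
  - move=> x xx; split; apply: rM; try exact: neH;
      apply: le_lt_trans (normc_le_ReIm _) _; rewrite cReB cImB /= -/x0 -/y0;
      (apply: le_lt_trans dr; have -> : 2 * dl = dl + dl by ring);
      apply: lerD; rewrite ler_norml; clear -xx d0; lra.
  - move=> x xx; split; apply: rM; try exact: neV;
      apply: le_lt_trans (normc_le_ReIm _) _; rewrite cReB cImB /= -/x0 -/y0;
      (apply: le_lt_trans dr; have -> : 2 * dl = dl + dl by ring);
      apply: lerD; rewrite ler_norml; clear -xx d0; lra.
  - by rewrite le_eqVlt; apply/orP; left; apply/eqP; ring.
apply/eqP; rewrite -normr_le0; apply/ler_addgt0Pr => e e0; rewrite add0r.
pose m := Num.min (Num.min (x0 - a) (b - x0)) (Num.min (y0 - c) (d - y0)).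
pose dl := Num.min m (Num.min (r / 4) (e / (8 * (M + 1)))).
have q0 : 0 < e / (8 * (M + 1)) by rewrite divr_gt0// mulr_gt0//; clear -M0; lra.
have m0 : 0 < m by rewrite !lt_min !subr_gt0 ax xb cy yd.
have d0 : 0 < dl by rewrite lt_min m0 lt_min q0 divr_gt0.
have dm : dl <= m by rewrite ge_min lexx.
have d4 : dl <= r / 4 by rewrite !ge_min lexx !orbT.
have de : dl <= e / (8 * (M + 1)) by rewrite !ge_min lexx !orbT.
have m1 : m <= x0 - a by rewrite !ge_min lexx.
have m2 : m <= b - x0 by rewrite !ge_min lexx !orbT.
have m3 : m <= y0 - c by rewrite !ge_min lexx !orbT.
have m4 : m <= d - y0 by rewrite !ge_min lexx !orbT.
apply: le_trans (small dl d0 _ _ _ _ _) _; try by [clear -m1 m2 m3 m4 dm; lra].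
  by clear -r0 d4; lra.
have : 8 * (M + 1) * dl <= e.
  by move: de; rewrite ler_pdivlMr; [rewrite mulrC|clear -M0; lra].
clear -M0 d0; nra.
Qed.

Lemma cont_on_bounded a b (f : R -> R) : cont_on a b f ->
  exists2 M, 0 <= M & forall x, a <= x <= b -> `|f x| <= M.
Proof.
move=> cf; have [ab|ba] := leP a b; last first.
  exists 0 => // x /andP[h1 h2]; have := le_trans h1 h2.
  by rewrite leNgt ba.
have cn : {within `[a, b], continuous (fun x => `|f x|)}.
  by apply: cont_on_within => x /cf cx; apply: cvg_norm.
have [c cab cP] := EVT_max ab cn.
by exists `|f c| => // x xab; apply: cP; rewrite in_itv /=.
Qed.

Lemma normc_cont_bounded g (p : R -> C) a b :
  cont_on a b (fun x => Re (g (p x))) -> cont_on a b (fun x => Im (g (p x))) ->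
  exists2 M, 0 <= M & forall x, a <= x <= b -> normc (g (p x)) <= M.
Proof.
move=> /cont_on_bounded[M1 M10 H1] /cont_on_bounded[M2 M20 H2].
exists (M1 + M2); first exact: addr_ge0.
move=> x xab; apply: le_trans (normc_le_ReIm _) _.
by apply: lerD; [exact: H1|exact: H2].
Qed.

Lemma bcont_bounded g a b c d : bcont g a b c d -> exists2 M, 0 <= M &
  (forall x, a <= x <= b -> normc (g (x +i* c)) <= M /\ normc (g (x +i* d)) <= M)
  /\ (forall y, c <= y <= d -> normc (g (a +i* y)) <= M /\ normc (g (b +i* y)) <= M).
Proof.
move=> [/hcont_on[p1 p2] /hcont_on[p3 p4] /vcont_on[p5 p6] /vcont_on[p7 p8]].
have [M1 M10 H1] := normc_cont_bounded p1 p2.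
have [M2 M20 H2] := normc_cont_bounded p3 p4.
have [M3 M30 H3] := normc_cont_bounded p5 p6.
have [M4 M40 H4] := normc_cont_bounded p7 p8.
exists (M1 + M2 + M3 + M4); first by rewrite !addr_ge0.
split=> x xx; split.
- by have := H1 x xx; lra.
- by have := H2 x xx; lra.
- by have := H3 x xx; lra.
- by have := H4 x xx; lra.
Qed.

End cauchy.

(** * The identity theorem off a discrete set *)

Section identity.
Context (R : realType).
Local Notation C := R[i].
Local Notation leb := (@lebesgue_measure R).
Implicit Types (z w h p q : C) (g F G H : C -> C) (a b c d x y k e t : R).

Lemma geo_small k t e : 0 <= t -> t < 1 -> 0 < e -> exists n, k * t ^+ n < e.
Proof.
move=> t0 t1 e0.
have t1' : `|t| < 1 by rewrite ger0_norm.
have k0 : 0 < e / (`|k| + 1) by rewrite divr_gt0// ltr_wpDl.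
have /cvgrPdist_lt/(_ _ k0)[N _ HN] := cvg_expr t1'.
exists N; have := HN N (leqnn N); rewrite /= sub0r normrN normrX (ger0_norm t0).
rewrite ltr_pdivlMr ?ltr_wpDl// => H; apply: le_lt_trans H.
rewrite mulrC ler_wpM2l ?exprn_ge0//.
by apply: le_trans (ler_norm k) _; rewrite lerDl.
Qed.

(** The set of t in [0, 1] with P t has a supremum, and the local propagation
around the supremum forces it to be 1. *)
Lemma real_induction (P : R -> Prop) : P 0 ->
  (forall t, 0 <= t <= 1 -> exists2 d : R, 0 < d & forall s s' : R, 0 <= s <= 1 ->
     0 <= s' <= 1 -> `|s - t| < d -> `|s' - t| < d -> P s -> P s') -> P 1.
Proof.
move=> P0 HP; pose S := [set t : R | 0 <= t <= 1 /\ P t].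
have S0 : S 0 by split => //; rewrite lexx ler01.
have ubS : ubound S 1 by move=> t [/andP[]].
have hS : has_sup S by split; [exists 0|exists 1].
have s01 : 0 <= sup S <= 1.
  apply/andP; split; first by apply: ub_le_sup => //; exists 1.
  by apply: ge_sup => //; exists 0.
have [d d0 dP] := HP _ s01.
have [t [t01 Pt] ts] := sup_adherent d0 hS.
have ts' : t <= sup S by apply: ub_le_sup => //; exists 1.
have near1 : `|t - sup S| < d by rewrite ler0_norm; lra.
pose u := Num.min 1 (sup S + d / 2).
have u1 : u <= 1 by rewrite ge_min lexx.
have u2 : u <= sup S + d / 2 by rewrite ge_min lexx orbT.
have su : sup S <= u by rewrite le_min; lra.
have u01 : 0 <= u <= 1 by move: s01; lra.
have Pu : P u by apply: (dP t u) => //; rewrite ger0_norm; lra.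
have us : u <= sup S by apply: ub_le_sup; [exists 1|split].
have [h|h] := lerP 1 (sup S + d / 2); first by move: Pu; rewrite /u min_l.
by move: us; rewrite /u min_r ?(ltW h)//; lra.
Qed.

(** The set of centres is open, which is what the propagation along segments
uses. *)
Definition zero_near H p := exists2 e : R, 0 < e & forall z, normc (z - p) < e -> H z = 0.

Lemma chol_kernel k z0 z : z != z0 -> chol (fun z => k%:C * ((- 'i%C) / (z - z0))) z.
Proof.
move=> zz; apply: cholM; first exact: chol_cst.
apply: cholM; first exact: chol_cst.
apply: cholV; first by rewrite subr_eq0.
by apply: cholB; [exact: chol_id|exact: chol_cst].
Qed.

Lemma bcont_chol g a b c d :  a <= b -> c <= d ->
  (forall z, a <= Re z <= b -> c <= Im z <= d ->
     [|| Re z == a, Re z == b, Im z == c | Im z == d] -> chol g z) ->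
  bcont g a b c d.
Proof.
move=> ab cd Hg; split=> s ss; apply/chol_cont/Hg => //=;
  by rewrite ?lexx ?ab ?cd ?eqxx ?orbT.
Qed.

(** The integral is 2 pi; positivity suffices for all uses below and follows from
the signs of the integrands alone. *)
Lemma kernel_pos z0 a b c d : a < Re z0 < b -> c < Im z0 < d ->
  0 < Phi (fun z => (- 'i%C) / (z - z0)) a b c d.
Proof.
move=> /andP[ax xb] /andP[cy yd].
have ab : a <= b := ltW (lt_trans ax xb).
have cd : c <= d := ltW (lt_trans cy yd).
have kE (z : C) : (- 'i%C) / (z - z0) =
   (- (Im z - Im z0) / ((Re z - Re z0) ^+ 2 + (Im z - Im z0) ^+ 2)) +i*
   (- (Re z - Re z0) / ((Re z - Re z0) ^+ 2 + (Im z - Im z0) ^+ 2)).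
  by apply: complex_eq; rewrite ?(cReM, cImM) cReV cImV cReB cImB /=; ring.
have bc : bcont (fun z => (- 'i%C) / (z - z0)) a b c d.
  apply: bcont_chol => // z _ _ hz.
  have zz : z != z0.
    by apply/eqP => E; move: hz; rewrite E (gt_eqF ax) (lt_eqF xb) (gt_eqF cy) (lt_eqF yd).
  have := chol_kernel (k := 1) zz; apply: (chol_near ltr01) => w _.
  by rewrite mul1r.
case: bc => /hcont_on[c1 _] /hcont_on[c2 _] /vcont_on[_ c3] /vcont_on[_ c4].
pose D := (b - a) ^+ 2 + (d - c) ^+ 2.
have D0 : 0 < D by rewrite /D ltr_pwDl ?sqr_ge0// exprn_gt0// subr_gt0 (lt_trans ax xb).
have P1 : (Im z0 - c) / D * (b - a) <= \int[leb]_(x in `[a, b])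
    (Re (- 'i%C / ((x +i* c) - z0)) - Re (- 'i%C / ((x +i* d) - z0))).
  apply: seg_ge_cst => //; first exact: cont_onB.
  move=> x xx; rewrite !kE /=.
  have A1 : 0 <= - (- (d - Im z0) / ((x - Re z0) ^+ 2 + (d - Im z0) ^+ 2)).
    rewrite mulNr opprK; apply: divr_ge0; [lra|].
    by apply: addr_ge0; exact: sqr_ge0.
  have A2 : (Im z0 - c) / D <= - (c - Im z0) / ((x - Re z0) ^+ 2 + (c - Im z0) ^+ 2).
    rewrite opprB ler_wpM2l ?subr_ge0 ?(ltW cy)// lef_pV2 ?posrE//.
      by rewrite /D; apply: lerD; nra.
    by rewrite ltr_wpDl ?sqr_ge0// exprn_even_gt0//= subr_eq0 lt_eqF.
  lra.
have P2 : \int[leb]_(y in `[c, d])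
    (Im (- 'i%C / ((b +i* y) - z0)) - Im (- 'i%C / ((a +i* y) - z0))) <= 0 * (d - c).
  apply: seg_le_cst => //; first exact: cont_onB.
  move=> y yy; rewrite !kE /=.
  have A1 : 0 <= (b - Re z0) / ((b - Re z0) ^+ 2 + (y - Im z0) ^+ 2).
    by apply: divr_ge0; [lra|apply: addr_ge0; exact: sqr_ge0].
  have A2 : 0 <= (Re z0 - a) / ((a - Re z0) ^+ 2 + (y - Im z0) ^+ 2).
    by apply: divr_ge0; [lra|apply: addr_ge0; exact: sqr_ge0].
  by rewrite opprB mulNr; lra.
have P3 : 0 < (Im z0 - c) / D * (b - a).
  by rewrite mulr_gt0 ?divr_gt0//; lra.
by rewrite mul0r in P2; rewrite /Phi; lra.
Qed.

(** Hence the quotient satisfies the boundedness condition of [goursat_exc]. *)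
Lemma bounded_quotient F z0 : chol F z0 -> exists M r, 0 < r /\
  forall z, z != z0 -> normc (z - z0) < r -> normc ((F z - F z0) / (z - z0)) <= M.
Proof.
move=> /cholP[d Hd]; have [r r0 rP] := Hd 1 ltr01.
exists (1 + normc d), r; split => // z zz zr.
have := rP _ zr; rewrite [z0 + _]addrC subrK mul1r => h.
rewrite normcM normcV.
rewrite ler_pdivrMr ?normc_gt0 ?subr_eq0//.
have -> : F z - F z0 = (F z - F z0 - d * (z - z0)) + d * (z - z0) by rewrite subrK.
apply: le_trans (le_normcD _ _) _; rewrite normcM.
by rewrite mulrDl mul1r; apply: lerD.
Qed.

Lemma square_ineq (a : C) r z z0 : normc (z0 - a) < r ->
  [|| Re z == Re a - r, Re z == Re a + r, Im z == Im a - r | Im z == Im a + r] ->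
  r <= normc (z - a) /\ r - normc (z0 - a) <= normc (z - z0).
Proof.
move=> zr hz.
have ra : r <= normc (z - a).
  have h1 := normc_Re (z - a); have h2 := normc_Im (z - a).
  rewrite cReB in h1; rewrite cImB in h2.
  move: h1 h2; rewrite !ler_norml => /andP[h1 h1'] /andP[h2 h2'].
  by case/or4P: hz => /eqP E; rewrite E in h1 h1' h2 h2'; lra.
split=> //; rewrite lerBlDr; apply: le_trans ra _.
have -> : z - a = (z - z0) + (z0 - a) by rewrite addrA subrK.
exact: le_normcD.
Qed.

(** As H vanishes near a, each H_n(z) = H(z) / (z - a)^n is analytic in the
square. Applying [goursat_exc] to (H_n(z) - H_n(z0)) / (z - z0) bounds
|H_n(z0)| by C / r^n with C independent of n, that is,
|H(z0)| <= C (|z0 - a| / r)^n, which tends to 0. *)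
Lemma vanish_square H (a : C) r e : 0 < r -> 0 < e ->
  (forall z, Re a - r <= Re z <= Re a + r -> Im a - r <= Im z <= Im a + r ->
     chol H z) ->
  (forall z, normc (z - a) < e -> H z = 0) ->
  forall z0, normc (z0 - a) < r -> H z0 = 0.
Proof.
move=> r0 e0 Hh Hz z0 z0r.
have [->|z0a] := eqVneq z0 a; first by apply: Hz; rewrite subrr (normc_real 0) normr0.
apply: contrapT => /eqP H0.
set A1 := Re a - r; set A2 := Re a + r; set B1 := Im a - r; set B2 := Im a + r.
have x1 : A1 <= A2 by rewrite /A1 /A2; clear -r0; lra.
have y1 : B1 <= B2 by rewrite /B1 /B2; clear -r0; lra.
have inx : A1 < Re z0 < A2.
  have := le_lt_trans (normc_Re _) z0r; rewrite cReB ltr_norml /A1 /A2; lra.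
have iny : B1 < Im z0 < B2.
  have := le_lt_trans (normc_Im _) z0r; rewrite cImB ltr_norml /B1 /B2; lra.
have [B B0 [Bh Bv]] : exists2 B, 0 <= B &
  (forall x, A1 <= x <= A2 -> normc (H (x +i* B1)) <= B /\ normc (H (x +i* B2)) <= B) /\
  (forall y, B1 <= y <= B2 -> normc (H (A1 +i* y)) <= B /\ normc (H (A2 +i* y)) <= B).
  by apply: bcont_bounded; apply: bcont_chol => // z zx zy _; exact: Hh.
set s := r - normc (z0 - a).
have s0 : 0 < s by rewrite subr_gt0.
have om0 := kernel_pos inx iny.
set om := Phi _ _ _ _ _ in om0.
pose Hn n z := H z / (z - a) ^+ n.
have HnC n z : A1 <= Re z <= A2 -> B1 <= Im z <= B2 -> chol (Hn n) z.
  move=> zx zy; have [za|za] := eqVneq z a.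
    rewrite za; apply: (@chol_near _ (fun=> 0) _ _ e) => //; last exact: chol_cst.
    by move=> w /Hz wz; rewrite /Hn wz mul0r.
  apply: cholM; first exact: Hh.
  apply: cholV; first by rewrite expf_neq0// subr_eq0.
  apply: cholX; apply: cholB; [exact: chol_id|exact: chol_cst].
have key n : normc (Hn n z0) * (s * om) <= 8 * r * B / r ^+ n.
  have [->|N0] := eqVneq (Hn n z0) 0.
    by rewrite (normc_real 0) normr0 mul0r divr_ge0 ?mulr_ge0 ?exprn_ge0 ?(ltW r0).
  pose kap := (- 'i%C) * conjc (Hn n z0).
  pose q1 z := kap * Hn n z / (z - z0).
  pose q2 z := ((normc (Hn n z0)) ^+ 2)%:C * ((- 'i%C) / (z - z0)).
  have bz z : [|| Re z == A1, Re z == A2, Im z == B1 | Im z == B2] -> z != z0.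
    move=> hz; apply/eqP => E; move: hz; rewrite E.
    case/andP: inx => i1 i2; case/andP: iny => i3 i4.
    by rewrite (gt_eqF i1) (lt_eqF i2) (gt_eqF i3) (lt_eqF i4).
  have q1c z : A1 <= Re z <= A2 -> B1 <= Im z <= B2 -> z != z0 -> chol q1 z.
    move=> zx zy zz; apply: cholM.
      by apply: cholM; [exact: chol_cst|exact: HnC].
    apply: cholV; first by rewrite subr_eq0.
    by apply: cholB; [exact: chol_id|exact: chol_cst].
  have b1 : bcont q1 A1 A2 B1 B2.
    by apply: bcont_chol => // z zx zy /bz; exact: q1c.
  have b2 : bcont q2 A1 A2 B1 B2.
    by apply: bcont_chol => // z zx zy /bz; exact: chol_kernel.
  have b3 : bcont (fun z => - 'i%C / (z - z0)) A1 A2 B1 B2.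
    apply: bcont_chol => // z zx zy /bz zz.
    have := chol_kernel (k := 1) zz; apply: (chol_near ltr01) => w _.
    by rewrite mul1r.
  have qE z : q1 z - q2 z = kap * ((Hn n z - Hn n z0) / (z - z0)).
    have NE : (normc (Hn n z0) ^+ 2)%:C = conjc (Hn n z0) * Hn n z0.
      by rewrite rmorphXn /= -complexnormE sqr_normc mulrC.
    by rewrite /q1 /q2 /kap NE; ring.
  have P0 : Phi (fun z => q1 z - q2 z) A1 A2 B1 B2 = 0.
    apply: (@goursat_exc _ _ z0 _ _ _ _ inx iny).
      move=> z zx zy zz; apply: cholB; first exact: q1c.
      exact: chol_kernel.
    have hz0 : chol (Hn n) z0.
      by apply: HnC; apply/andP; split; apply/ltW; case/andP: inx; case/andP: iny.
    have [M [d [d0 dM]]] := bounded_quotient hz0.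
    exists (normc kap * M), d; split => // z zz zd.
    rewrite qE normcM ler_wpM2l ?normc_ge0//.
    exact: dM.
  move: P0; rewrite PhiB// PhiZ// -/om => /eqP; rewrite subr_eq0 => /eqP P0.
  have bd z : normc (H z) <= B ->
      [|| Re z == A1, Re z == A2, Im z == B1 | Im z == B2] ->
      normc (q1 z) <= normc (Hn n z0) * (B / r ^+ n / s).
    move=> HB hz; have [ra sa] := square_ineq z0r hz.
    have NH : normc (Hn n z) = normc (H z) / normc (z - a) ^+ n.
      by rewrite /Hn normcM normcV normcX.
    rewrite /q1 normcM normcV.
    rewrite [normc (_ * Hn n z)]normcM.
    rewrite /kap [normc (_ * conjc _)]normcM.
    rewrite normcN normc_i mul1r normc_conj NH -[leLHS]mulrA.
    rewrite ler_wpM2l ?normc_ge0//.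
    apply: ler_pM; rewrite ?mulr_ge0 ?invr_ge0 ?exprn_ge0 ?normc_ge0//.
      apply: ler_pM => //; rewrite ?invr_ge0 ?exprn_ge0 ?normc_ge0//.
      rewrite lef_pV2 ?posrE ?exprn_gt0//; last exact: lt_le_trans ra.
      by rewrite lerXn2r ?nnegrE ?normc_ge0// ltW.
    by rewrite lef_pV2 ?posrE//; exact: lt_le_trans sa.
  have Pb : `|Phi q1 A1 A2 B1 B2| <=
      2 * (normc (Hn n z0) * (B / r ^+ n / s)) * (A2 - A1 + (B2 - B1)).
    case: b1 => b11 b12 b13 b14; apply: Phi_bound => //.
      move=> x xx; have [h1 h2] := Bh x xx.
      by split; apply: bd; rewrite //= eqxx ?orbT.
    move=> y yy; have [h1 h2] := Bv y yy.
    by split; apply: bd; rewrite //= eqxx ?orbT.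
  have Np : 0 < normc (Hn n z0) by rewrite normc_gt0.
  rewrite P0 in Pb; have {}Pb := le_trans (ler_norm _) Pb.
  have E : 2 * (normc (Hn n z0) * (B / r ^+ n / s)) * (A2 - A1 + (B2 - B1)) =
      normc (Hn n z0) * (8 * r * B / r ^+ n / s).
    by rewrite /A1 /A2 /B1 /B2; ring.
  rewrite E expr2 -[leLHS]mulrA ler_pM2l// ler_pdivlMr// in Pb.
  by rewrite mulrA mulrAC.
have H0p : 0 < normc (H z0) by rewrite normc_gt0.
have za0 : 0 < normc (z0 - a) by rewrite normc_gt0 subr_eq0.
have [n nP] : exists n, 8 * r * B * (normc (z0 - a) / r) ^+ n < normc (H z0) * (s * om).
  apply: geo_small; first by rewrite divr_ge0 ?ltW.
    by rewrite ltr_pdivrMr// mul1r.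
  by rewrite !mulr_gt0.
move: nP; apply/negP; rewrite -leNgt.
have := key n; rewrite /Hn normcM normcV normcX.
have zn : 0 < normc (z0 - a) ^+ n by rewrite exprn_gt0.
rewrite [normc (H z0) / _ * _]mulrAC ler_pdivrMr// expr_div_n.
by rewrite [X in _ <= X -> _]mulrAC -[X in _ <= X -> _]mulrA.
Qed.

End identity.

Section identity2.
Context (R : realType).
Local Notation C := R[i].
Implicit Types (z w h p q u v : C) (g F G H : C -> C) (a b c d x y k e t s : R).

Lemma Re_realM t z : Re (t%:C * z) = t * Re z.
Proof. by rewrite cReM /= mul0r subr0. Qed.
Lemma Im_realM t z : Im (t%:C * z) = t * Im z.
Proof. by rewrite cImM /= mul0r addr0. Qed.

(** [vanish_square] enlarges the zero neighbourhood of a point to a radius that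
is uniform along a small part of the segment. *)
Lemma vanish_segment H p q :
  (forall t, 0 <= t <= 1 -> exists2 r : R, 0 < r &
     forall z, normc (z - (p + t%:C * (q - p))) < r -> chol H z) ->
  zero_near H p -> zero_near H q.
Proof.
move=> Hh Hp.
suff : zero_near H (p + 1%:C * (q - p)) by rewrite mul1r addrC subrK.
apply: (@real_induction R (fun t => zero_near H (p + t%:C * (q - p)))).
  by rewrite mul0r addr0.
move=> t /Hh[r0 r00 hr].
pose r := r0 / 6; have rp : 0 < r by rewrite divr_gt0.
pose N := normc (q - p); have N0 : 0 <= N := normc_ge0 _.
have dist a b : normc (p + a%:C * (q - p) - (p + b%:C * (q - p))) = `|a - b| * N.
  rewrite -normc_real -normcM; congr normc.
  by rewrite rmorphB /=; ring.
exists (r / (N + 1)); first by rewrite divr_gt0// ltr_wpDl.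
move=> s s' _ _ st s't [e e0 He].
have lt1 a : `|a - t| < r / (N + 1) -> `|a - t| * N < r.
  rewrite ltr_pdivlMr ?ltr_wpDl// mulrDr mulr1; apply: le_lt_trans.
  by rewrite lerDl.
set a := p + s%:C * (q - p) in He.
have V := @vanish_square R H a (2 * r) e ltac:(clear -rp; lra) e0 _ He.
have {}V : forall z0, normc (z0 - a) < 2 * r -> H z0 = 0.
  apply: V => z /andP[x1 x2] /andP[y1 y2]; apply: hr.
  have -> : z - (p + t%:C * (q - p)) = (z - a) + (a - (p + t%:C * (q - p))).
    by rewrite addrA subrK.
  apply: le_lt_trans (le_normcD _ _) _.
  have h1 := lt1 _ st; rewrite -dist -/a in h1.
  have h2 : normc (z - a) <= 2 * r + 2 * r.
    apply: le_trans (normc_le_ReIm _) _; rewrite cReB cImB.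
    by apply: lerD; rewrite ler_norml; clear -x1 x2 y1 y2; lra.
  have -> : r0 = 6 * r by rewrite /r; field.
  by clear -h1 h2 rp; lra.
have ss' : `|s' - s| * N < 2 * r.
  have h1 := lt1 _ st; have h2 := lt1 _ s't.
  have : `|s' - s| <= `|s' - t| + `|s - t|.
    have -> : s' - s = (s' - t) - (s - t) by ring.
    exact: ler_normB.
  move=> /(ler_wpM2r N0); rewrite mulrDl; clear -h1 h2; lra.
exists (2 * r - `|s' - s| * N); first by rewrite subr_gt0.
move=> z zz; apply: V.
have -> : z - a = (z - (p + s'%:C * (q - p))) + (p + s'%:C * (q - p) - a).
  by rewrite addrA subrK.
apply: le_lt_trans (le_normcD _ _) _.
by rewrite /a dist -ltrBrDr.
Qed.

Lemma seg_norm u v t r : 0 <= t <= 1 -> normc u < r -> normc v < r ->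
  normc (u + t%:C * (v - u)) < r.
Proof.
move=> /andP[t0 t1] ur vr.
have -> : u + t%:C * (v - u) = (1 - t)%:C * u + t%:C * v.
  by rewrite rmorphB /= rmorph1; ring.
apply: le_lt_trans (le_normcD _ _) _.
rewrite !normcM !normc_real.
rewrite (ger0_norm t0) ger0_norm ?subr_ge0//.
have [->|tn] := eqVneq t 1; first by rewrite subrr mul0r mul1r add0r.
have : t < 1 by rewrite lt_neqAle tn.
clear -ur vr t0; nra.
Qed.

Lemma vanish_punctured_segment H w r u v :
  (forall z, z != w -> normc (z - w) < r -> chol H z) ->
  normc u < r -> normc v < r ->
  (forall t, 0 <= t <= 1 -> u + t%:C * (v - u) != 0) ->
  zero_near H (w + u) -> zero_near H (w + v).
Proof.
move=> Hh ur vr nz; apply: vanish_segment => t t01.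
set x := u + t%:C * (v - u).
have x0 : x != 0 by exact: nz.
have xr : normc x < r by exact: seg_norm.
have -> : w + u + t%:C * (w + v - (w + u)) = w + x by rewrite /x; ring.
exists (Num.min (normc x) (r - normc x)).
  by rewrite lt_min normc_gt0 x0 subr_gt0.
move=> z; rewrite lt_min => /andP[z1 z2]; apply: Hh.
  apply/eqP => E; move: z1; rewrite E opprD addrA subrr add0r normcN.
  by rewrite ltxx.
have -> : z - w = (z - (w + x)) + x by ring.
apply: le_lt_trans (le_normcD _ _) _.
by rewrite -ltrBrDr.
Qed.

(** If the segment from w + u to w + v passes through w, the path makes a detour
through w + iu. *)
Lemma vanish_punctured H w r u v :
  (forall z, z != w -> normc (z - w) < r -> chol H z) ->
  u != 0 -> v != 0 -> normc u < r -> normc v < r ->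
  zero_near H (w + u) -> zero_near H (w + v).
Proof.
move=> Hh u0 v0 ur vr.
have [nz|] := pselect (forall t, 0 <= t <= 1 -> u + t%:C * (v - u) != 0).
  exact: (vanish_punctured_segment Hh).
move=> /existsNP[t /not_implyP[/andP[t0 t1] /negP]]; rewrite negbK => /eqP E.
have tn0 : t != 0.
  by apply: contraNneq u0 => t_0; move: E; rewrite t_0 mul0r addr0 => ->.
have tn1 : 1 - t != 0.
  apply: contraNneq v0 => /eqP; rewrite subr_eq0 => /eqP t_1.
  by move: E; rewrite -t_1 mul1r addrC subrK => ->.
pose k := (1 - t) / t.
have k0 : 0 < k by rewrite divr_gt0// lt_neqAle eq_sym ?tn0 ?tn1 ?subr_ge0.
have vE : v = (- k)%:C * u.
  have tC : t%:C != 0 :> C by rewrite -(rmorph0 (real_complex R)) (inj_eq (@complexI R)).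
  apply: (mulfI tC); rewrite mulrA -rmorphM /= /k.
  have -> : t * - ((1 - t) / t) = t - 1 by field.
  move: E => /eqP; rewrite rmorphB /= rmorph1 => /eqP E.
  apply/eqP; rewrite -subr_eq0 -E; apply/eqP; ring.
have fac (s : R) (y : C) : Im y != 0 \/ Re y != 0 -> y * u != 0.
  move=> yy; rewrite mulf_neq0//; apply/eqP => y0; rewrite y0 /= in yy.
  by case: yy; rewrite eqxx.
pose m := 'i%C * u.
have mr : normc m < r by rewrite normcM normc_i mul1r.
move=> /(@vanish_punctured_segment H w r u m Hh ur mr) H1.
apply: (@vanish_punctured_segment H w r m v Hh mr vr).
  move=> s /andP[s0 s1].
  have -> : m + s%:C * (v - m) = ((1 - s)%:C * 'i%C - (s * k)%:C) * u.
    by rewrite /m vE rmorphB rmorph1 rmorphM rmorphN /=; ring.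
  apply: (fac s); rewrite cReB cImB Re_realM Im_realM /= mulr0 mulr1 subr0 sub0r.
  have [->|s1'] := eqVneq s 1.
    by right; rewrite mul1r oppr_eq0 gt_eqF.
  by left; rewrite subr_eq0 eq_sym.
apply: H1 => s /andP[s0 s1].
have -> : u + s%:C * (m - u) = ((1 - s)%:C + s%:C * 'i%C) * u.
  by rewrite /m rmorphB rmorph1 /=; ring.
apply: (fac s); rewrite cReD cImD Re_realM Im_realM /= mulr0 mulr1 addr0 add0r.
have [->|s0'] := eqVneq s 0; last by left.
by right; rewrite subr0 oner_eq0.
Qed.

Definition locally_finite (Z : set C) := forall w, exists2 r : R, 0 < r &
  forall z, z != w -> normc (z - w) < r -> ~ Z z.

(** Propagation along the segment from p to q. It may meet Z, so the property
that is propagated is vanishing near the point outside of Z; around a point of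
Z it is carried through the punctured disc. Values at points outside of Z are
recovered by continuity. *)
Lemma identity_theorem (Z : set C) H p : locally_finite Z ->
  (forall z, ~ Z z -> chol H z) -> zero_near H p ->
  forall q, ~ Z q -> H q = 0.
Proof.
move=> LZ Hh Hp q Zq.
pose W w := exists2 r : R, 0 < r & forall z, normc (z - w) < r -> ~ Z z -> H z = 0.
suff [r r0 rP] : W (p + 1%:C * (q - p)).
  by apply: rP => //; rewrite mul1r [p + _]addrC subrK subrr (normc_real 0) normr0.
apply: (@real_induction R (fun t => W (p + t%:C * (q - p)))).
  by rewrite mul0r addr0; case: Hp => e e0 eP; exists e => // z /eP.
move=> t _; set w := p + t%:C * (q - p).
have [r r0 rP] := LZ w.
pose N := normc (q - p); have N0 : 0 <= N := normc_ge0 _.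
have dist a : normc (p + a%:C * (q - p) - w) = `|a - t| * N.
  rewrite -normc_real -normcM; congr normc.
  by rewrite /w rmorphB /=; ring.
exists (r / (N + 1)); first by rewrite divr_gt0// ltr_wpDl.
move=> s s' _ _ st s't.
have lt1 a : `|a - t| < r / (N + 1) -> normc (p + a%:C * (q - p) - w) < r.
  rewrite dist ltr_pdivlMr ?ltr_wpDl// mulrDr mulr1; apply: le_lt_trans.
  by rewrite lerDl.
have {st} := lt1 _ st; have {s't} := lt1 _ s't.
move: (p + s%:C * (q - p)) (p + s'%:C * (q - p)) => x x' x'w xw [e e0 He].
have Hw z : z != w -> normc (z - w) < r -> chol H z.
  by move=> z1 z2; apply/Hh/rP.
have [u [u0 ur Hu]] : exists u, [/\ u != 0, normc u < r & zero_near H (w + u)].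
  have zn u : u != 0 -> normc u < r -> normc (w + u - x) < e -> zero_near H (w + u).
    move=> u0 ur ue.
    exists (Num.min (normc u) (Num.min (r - normc u) (e - normc (w + u - x)))).
      by rewrite !lt_min normc_gt0 u0 !subr_gt0 ur ue.
    move=> z; rewrite !lt_min => /and3P[z1 z2 z3]; apply: He.
      have -> : z - x = (z - (w + u)) + (w + u - x) by rewrite addrA subrK.
      by apply: le_lt_trans (le_normcD _ _) _; rewrite -ltrBrDr.
    apply: rP.
      apply/eqP => E; move: z1; rewrite E opprD addrA subrr add0r normcN.
      by rewrite ltxx.
    have -> : z - w = (z - (w + u)) + u by ring.
    by apply: le_lt_trans (le_normcD _ _) _; rewrite -ltrBrDr.
  have [xE|xn] := eqVneq x w; last first.
    exists (x - w); rewrite subr_eq0; split => //; apply: zn => //.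
      by rewrite subr_eq0.
    by rewrite [w + _]addrC subrK subrr (normc_real 0) normr0.
  pose m := Num.min (r / 2) (e / 2).
  have m0 : 0 < m by rewrite lt_min !divr_gt0.
  have nm : normc (m%:C) = m by rewrite normc_real gtr0_norm.
  have mr : m < r.
    have : m <= r / 2 by rewrite ge_min lexx.
    by clear -r0; lra.
  have me : m < e.
    have : m <= e / 2 by rewrite ge_min lexx orbT.
    by clear -e0; lra.
  have mC : m%:C != 0 :> C by rewrite -normc_gt0 nm.
  exists m%:C; split; rewrite ?nm//.
  by apply: zn; rewrite ?nm// xE [w + _]addrC addrK nm.
have all z : z != w -> normc (z - w) < r -> H z = 0.
  move=> zw zr; have zu : z - w != 0 by rewrite subr_eq0.
  have [d d0 dP] := vanish_punctured Hw u0 zu ur zr Hu.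
  by apply: dP; rewrite [w + _]addrC subrK subrr (normc_real 0) normr0.
exists (r - normc (x' - w)); first by rewrite subr_gt0.
move=> z zx' Zz.
have zr : normc (z - w) < r.
  have -> : z - w = (z - x') + (x' - w) by rewrite addrA subrK.
  by apply: le_lt_trans (le_normcD _ _) _; rewrite -ltrBrDr.
have [zw|] := eqVneq z w; last by move=> /all; exact.
apply: contrapT => /eqP Hz0.
have cH : ccont H z by apply/chol_cont/Hh.
have [d d0 dP] := cH (normc (H z)) ltac:(by rewrite normc_gt0).
pose m := Num.min (r / 2) (d / 2).
have m0 : 0 < m by rewrite lt_min !divr_gt0.
have nm : normc (m%:C) = m by rewrite normc_real gtr0_norm.
have mr : m < r.
  have : m <= r / 2 by rewrite ge_min lexx.
  by clear -r0; lra.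
have md : m < d.
  have : m <= d / 2 by rewrite ge_min lexx orbT.
  by clear -d0; lra.
have := dP m%:C; rewrite nm => /(_ md).
rewrite (all (z + m%:C)) ?sub0r ?normcN ?ltxx//.
  by rewrite -zw -subr_eq0 addrC addrA addNr add0r -normc_gt0 nm.
by rewrite -zw addrC addrA addNr add0r nm.
Qed.

End identity2.

(** * Inner functions are bounded by one *)

Section dct.
Context (R : realType).
Local Notation leb := (@lebesgue_measure R).

Lemma ae_mono (P Q : R -> Prop) : (forall x, P x -> Q x) ->
  {ae leb, forall x, P x} -> {ae leb, forall x, Q x}.
Proof.
move=> PQ [N [mN N0 sN]]; exists N; split => // x nQ; apply: sN => Px.
exact/nQ/PQ.
Qed.

Lemma Rdominated (D : set R) (f_ : nat -> R -> R) (f g : R -> R) :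
  measurable D -> (forall n, measurable_fun D (f_ n)) -> measurable_fun D f ->
  {ae leb, forall x, D x -> f_ ^~ x @ \oo --> f x} ->
  leb.-integrable D (EFin \o g) ->
  (forall n x, D x -> `|f_ n x| <= g x) ->
  leb.-integrable D (EFin \o f) /\
  \int[leb]_(x in D) f_ n x @[n --> \oo] --> \int[leb]_(x in D) f x.
Proof.
move=> mD mf_ mf ff ig fg.
have [] := @dominated_convergence _ _ R leb D mD (fun n => EFin \o f_ n)
    (EFin \o f) (EFin \o g) _ _ _ ig _.
- by move=> n; apply/measurable_EFinP; exact: mf_.
- by apply/measurable_EFinP.
- by apply: ae_mono ff => x H /H cx; apply: cvg_EFin; first exact: nearW.
- by apply/aeW => x n Dx; rewrite /= lee_fin fg.
move=> i_f _ cv; split=> //.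
rewrite /Rintegral; apply: fine_cvg.
by rewrite fineK//; exact: integrable_fin_num.
Qed.

Lemma cvg_harm : (n.+1%:R^-1 : R) @[n --> \oo] --> 0.
Proof. exact: cvg_harmonic. Qed.

Lemma at_right_seq (f : R -> R) (l : R) : f y @[y --> 0^'+] --> l ->
  f n.+1%:R^-1 @[n --> \oo] --> l.
Proof.
move=> /cvg_at_rightP H; apply: (H (fun n => n.+1%:R^-1)).
by split; [move=> n; rewrite invr_gt0|exact: cvg_harm].
Qed.

End dct.

Section inner.
Context (R : realType).
Local Notation C := R[i].
Local Notation leb := (@lebesgue_measure R).
Implicit Types (z w h : C) (F G H : C -> C) (a b c d x y k e t A M : R).

Lemma normc_dist z w : `|normc z - normc w| <= normc (z - w).
Proof.
rewrite ler_norml le_normc_sub andbT.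
by have := le_normc_sub w z; rewrite normcB; lra.
Qed.

(** The Poisson kernel of the upper half-plane, without its normalization. *)
Definition poisson (z0 : C) x : R := ((x - Re z0) ^+ 2 + Im z0 ^+ 2)^-1.

Lemma poisson_den z0 x : 0 < Im z0 -> 0 < (x - Re z0) ^+ 2 + Im z0 ^+ 2.
Proof. by move=> y0; rewrite ltr_wpDl ?sqr_ge0// exprn_gt0. Qed.

Lemma poisson_gt0 z0 x : 0 < Im z0 -> 0 < poisson z0 x.
Proof. by move=> y0; rewrite invr_gt0 poisson_den. Qed.

Lemma poisson_cont z0 a b : 0 < Im z0 -> cont_on a b (poisson z0).
Proof.
move=> y0 x _; apply: cvgV; first by rewrite gt_eqF// poisson_den.
apply: cvgD; last exact: cvg_cst.
by apply: cvgM; apply: cvgB; (exact: cvg_id || exact: cvg_cst).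
Qed.

(** The Poisson estimate for the function T(z) = theta(z + ie), which is analytic
up to the real axis. Put m = T(z0). The function
conj m (T(z) - m) / ((z - z0) (z - conj z0)) has integral zero along the
boundary of [-A, A] x [0, A]; on the real axis its denominator is the inverse of
the Poisson kernel, and on each of the other sides it is at most 8 M^2 / A^2. *)
Lemma mean_bound theta M z0 e A :
  (forall z, 0 < Im z -> chol theta z) ->
  (forall z, 0 < Im z -> normc (theta z) <= M) ->
  0 < Im z0 -> 0 < e -> 2 * `|Re z0| < A -> 2 * Im z0 < A ->
  normc (theta (z0 + 0 +i* e)) ^+ 2 * \int[leb]_(x in `[- A, A]) poisson z0 x <=
  normc (theta (z0 + 0 +i* e)) *
    \int[leb]_(x in `[- A, A]) (poisson z0 x * normc (theta (x +i* e)))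
  + 32 * M ^+ 2 / A.
Proof.
move=> Ht tM y00 e0 Ax Ay.
pose T z := theta (z + 0 +i* e); pose m := T z0; rewrite -/(T z0) -/m.
have A0 : 0 < A by apply: lt_trans Ay; rewrite mulr_gt0.
have Tch z : 0 <= Im z -> chol T z.
  move=> z_0; apply: (chol_comp (G := fun z => z + 0 +i* e)).
    by apply: cholD; [exact: chol_id|exact: chol_cst].
  by apply: Ht; rewrite cImD /= ltr_wpDl.
have TM z : 0 <= Im z -> normc (T z) <= M.
  by move=> z_0; apply: tM; rewrite cImD /= ltr_wpDl.
have M0 : 0 <= M by apply: le_trans (normc_ge0 _) (TM z0 (ltW y00)).
pose q z := conjc m * ((T z - T z0) / (z - z0)) / (z - conjc z0).
have zc z : 0 <= Im z -> z != conjc z0.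
  move=> h; apply/eqP => E; move: h; rewrite E; case: (z0) y00 => u v /= v0.
  by rewrite oppr_ge0 leNgt v0.
have qch z : 0 <= Im z -> z != z0 -> chol q z.
  move=> hz zz; apply: cholM.
    apply: cholM; first exact: chol_cst.
    apply: cholM; first by apply: cholB; [exact: Tch|exact: chol_cst].
    apply: cholV; first by rewrite subr_eq0.
    by apply: cholB; [exact: chol_id|exact: chol_cst].
  apply: cholV; first by rewrite subr_eq0 zc.
  by apply: cholB; [exact: chol_id|exact: chol_cst].
have inx : - A < Re z0 < A.
  by have := ler_norm (Re z0); have := ler_norm (- Re z0); rewrite normrN; lra.
have iny : 0 < Im z0 < A by rewrite y00; lra.
have P0 : Phi q (- A) A 0 A = 0.
  apply: (@goursat_exc _ _ z0 _ _ _ _ inx iny).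
    by move=> z _ /andP[h _]; exact: qch.
  have [B [r [r0 rB]]] := bounded_quotient (Tch z0 (ltW y00)).
  exists (normc (conjc m) * B / Im z0), (Num.min r (Im z0)).
  split; first by rewrite lt_min r0.
  move=> z zz; rewrite lt_min => /andP[z1 z2].
  rewrite /q normcM normcV.
  rewrite [normc (conjc m * _)]normcM.
  have imz : 0 < Im z.
    by have := le_lt_trans (normc_Im _) z2; rewrite cImB ltr_norml; lra.
  apply: ler_pM; rewrite ?mulr_ge0 ?invr_ge0 ?normc_ge0//.
    by rewrite ler_wpM2l ?normc_ge0// rB.
  rewrite lef_pV2 ?posrE// ?normc_gt0 ?subr_eq0 ?zc ?(ltW imz)//.
  apply: le_trans (normc_Im _); rewrite cImB.
  have -> : Im (conjc z0) = - Im z0 by case: (z0).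
  by apply: le_trans (ler_norm _); lra.
(* 8 = 2 * 2^2: the difference of values is at most 2M, and each of the two
distances is at least A/2. *)
have qbound z : 0 <= Im z -> A / 2 <= normc (z - z0) ->
    A / 2 <= normc (z - conjc z0) -> normc (q z) <= 8 * M ^+ 2 / A ^+ 2.
  move=> hz h1 h2.
  rewrite /q normcM normcV.
  rewrite [normc (conjc m * _)]normcM.
  rewrite [normc ((T z - _) / _)]normcM.
  rewrite normcV normc_conj.
  have A2 : 0 < A / 2 by rewrite divr_gt0.
  have -> : 8 * M ^+ 2 / A ^+ 2 = M * ((2 * M) * (A / 2)^-1) * (A / 2)^-1.
    by field; rewrite gt_eqF.
  have i1 : (normc (z - z0))^-1 <= (A / 2)^-1.
    by rewrite lef_pV2 ?posrE//; exact: lt_le_trans h1.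
  have i2 : (normc (z - conjc z0))^-1 <= (A / 2)^-1.
    by rewrite lef_pV2 ?posrE//; exact: lt_le_trans h2.
  apply: ler_pM i2; rewrite ?mulr_ge0 ?invr_ge0 ?normc_ge0//.
  apply: ler_pM; rewrite ?mulr_ge0 ?invr_ge0 ?normc_ge0//.
    exact: TM (ltW y00).
  apply: ler_pM i1; rewrite ?invr_ge0 ?normc_ge0//.
  apply: le_trans (le_normcB _ _) _.
  by have := TM z hz; have := TM z0 (ltW y00); lra.
have z0c : Re (conjc z0) = Re z0 /\ Im (conjc z0) = - Im z0 by case: (z0).
have ch b : 0 <= b -> b != Im z0 -> hcont q (- A) A b.
  move=> b0 bz x _; apply/chol_cont/qch => //=.
  by apply: contra_neq bz => <-.
have cv a : a != Re z0 -> vcont q 0 A a.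
  move=> az y /andP[h _]; apply/chol_cont/qch => //=.
  by apply: contra_neq az => <-.
have c1 : hcont q (- A) A 0 by apply: ch => //; rewrite lt_eqF.
have c2 : hcont q (- A) A A by apply: ch; [exact: ltW|rewrite gt_eqF//; lra].
have c3 : vcont q 0 A (- A) by apply: cv; rewrite lt_eqF//; lra.
have c4 : vcont q 0 A A by apply: cv; rewrite gt_eqF//; lra.
(* 32 = 16 + 8 + 8, from the upper side of length 2A and two sides of length A. *)
have Ir : - (32 * M ^+ 2 / A) <= \int[leb]_(x in `[- A, A]) Re (q (x +i* 0)).
  move: P0; rewrite /Phi.
  rewrite segB; [|exact: (hcont_on c1).1|exact: (hcont_on c2).1].
  rewrite segB; [|exact: (vcont_on c4).2|exact: (vcont_on c3).2].
  have B1 : `|\int[leb]_(x in `[- A, A]) Re (q (x +i* A))| <=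
      8 * M ^+ 2 / A ^+ 2 * (A - - A).
    apply: seg_norm_le; [lra|exact: (hcont_on c2).1|].
    move=> x _; apply: le_trans (normc_Re _) _; apply: qbound; rewrite /= ?(ltW A0)//.
      by apply: le_trans (normc_Im _); rewrite cImB /= ger0_norm; lra.
    apply: le_trans (normc_Im _); rewrite cImB z0c.2 /= ger0_norm; lra.
  have bv a : a = A \/ a = - A -> vcont q 0 A a ->
      `|\int[leb]_(y in `[0, A]) Im (q (a +i* y))| <= 8 * M ^+ 2 / A ^+ 2 * (A - 0).
    move=> aA ca; apply: seg_norm_le; [lra|exact: (vcont_on ca).2|].
    have n1 := ler_norm (Re z0); have n2 := ler_norm (- Re z0).
    rewrite normrN in n2.
    have ha : A / 2 <= `|a - Re z0|.
      by case: aA => ->; [rewrite ger0_norm|rewrite ler0_norm]; lra.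
    move=> y /andP[y_0 _]; apply: le_trans (normc_Im _) _.
    apply: qbound => //=.
      by apply: le_trans (normc_Re _); rewrite cReB.
    by apply: le_trans (normc_Re _); rewrite cReB z0c.1.
  have B2 := bv A (or_introl erefl) c4; have B3 := bv (- A) (or_intror erefl) c3.
  have E1 : 8 * M ^+ 2 / A ^+ 2 * (A - - A) = 16 * M ^+ 2 / A.
    by field; rewrite gt_eqF.
  have E2 : 8 * M ^+ 2 / A ^+ 2 * (A - 0) = 8 * M ^+ 2 / A.
    by field; rewrite gt_eqF.
  rewrite E1 in B1; rewrite E2 in B2 B3.
  move: B1 B2 B3; rewrite !ler_norml -!mulrA.
  set X := M ^+ 2 / A; lra.
have cTh : cont_on (- A) A (fun x => normc (theta (x +i* e))).
  move=> x _; apply/cont_epsP => d d0.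
  have [r r0 rP] := chol_cont (Ht (x +i* e) e0) d0.
  exists r => // y yx.
  have := rP ((y +i* e) - (x +i* e)) (le_lt_trans (hline_lip e x y) yx).
  rewrite [(x +i* e) + _]addrC subrK; apply: le_lt_trans.
  exact: normc_dist.
have cP := @poisson_cont z0 (- A) A y00.
have qle x : Re (q (x +i* 0)) <=
    normc m * (poisson z0 x * normc (theta (x +i* e))) - normc m ^+ 2 * poisson z0 x.
  have qE : q (x +i* 0) = (poisson z0 x)%:C * (conjc m * (T (x +i* 0) - m)).
    have dE : ((x +i* 0) - z0) * ((x +i* 0) - conjc z0) =
        ((x - Re z0) ^+ 2 + Im z0 ^+ 2)%:C.
      by case: (z0) => u v /=; apply: complex_eq; rewrite ?(cReM, cImM, cReB, cImB) /=; ring.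
    have -> : (poisson z0 x)%:C = (((x +i* 0) - z0) * ((x +i* 0) - conjc z0))^-1.
      by rewrite dE -fmorphV.
    by rewrite invfM /q -/m; ring.
  have TE : T (x +i* 0) = theta (x +i* e).
    rewrite /T; congr theta; apply: complex_eq; rewrite ?cReD ?cImD /=; ring.
  rewrite qE cReM /= mul0r subr0 mulrBr cReB TE.
  have mm : Re (conjc m * m) = normc m ^+ 2.
    by rewrite normcE2 cReM; case: (m) => u v /=; ring.
  rewrite mm.
  have : Re (conjc m * theta (x +i* e)) <= normc m * normc (theta (x +i* e)).
    apply: le_trans (ler_norm _) _; apply: le_trans (normc_Re _) _.
    by rewrite normcM normc_conj.
  by have := poisson_gt0 x y00; nra.
have cPT : cont_on (- A) A (fun x => poisson z0 x * normc (theta (x +i* e))).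
  exact: cont_onM.
rewrite -!segZ//.
have ccst k : cont_on (- A) A (fun=> k) by move=> x _; exact: cvg_cst.
have Le : \int[leb]_(x in `[- A, A]) Re (q (x +i* 0)) <=
   \int[leb]_(x in `[- A, A]) (normc m * (poisson z0 x * normc (theta (x +i* e)))
     - normc m ^+ 2 * poisson z0 x).
  apply: seg_le; [exact: (hcont_on c1).1| |by move=> x _].
  by apply: cont_onB; apply: cont_onM.
rewrite segB in Le; [|exact: cont_onM..].
lra.
Qed.

(** Letting e tend to 0 in [mean_bound], with |theta| tending to 1 on the real
axis, gives m^2 I(A) <= m I(A) + 32 M^2 / A for m = |theta(z0)| and the
integral I(A) of the Poisson kernel over [-A, A]. As I(A) is bounded below,
m > 1 is impossible for large A. *)
Lemma inner_le1 theta : inner_function theta ->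
  forall z, 0 < Im z -> normc (theta z) <= 1.
Proof.
move=> [Ht [M tM] tl] z0 y0; rewrite leNgt; apply/negP => m1.
have Hc z : 0 < Im z -> chol theta z by exact: Ht.
have M0 : 0 <= M by apply: le_trans (normc_ge0 _) (tM z0 y0).
pose m := normc (theta z0).
have key A : 2 * `|Re z0| < A -> 2 * Im z0 < A ->
    m ^+ 2 * \int[leb]_(x in `[- A, A]) poisson z0 x <=
    m * \int[leb]_(x in `[- A, A]) poisson z0 x + 32 * M ^+ 2 / A.
  move=> A1 A2; pose e n : R := n.+1%:R^-1.
  have e0 n : 0 < e n by rewrite invr_gt0.
  have H n := mean_bound Hc tM y0 (e0 n) A1 A2.
  have cm : normc (theta (z0 + 0 +i* e n)) @[n --> \oo] --> m.
    apply/cvgrPdist_lt => d d0.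
    have [r r0 rP] := chol_cont (Hc z0 y0) d0.
    have /cvgrPdist_lt/(_ _ r0) := @cvg_harm R; apply: filterS => n.
    rewrite sub0r normrN => hn; have := rP (0 +i* e n).
    have -> : normc (0 +i* e n) = `|e n|.
      by rewrite /= expr0n /= add0r sqrtr_sqr.
    move=> /(_ hn); rewrite distrC; apply: le_lt_trans.
    exact: normc_dist.
  have cP := @poisson_cont z0 (- A) A y0.
  have cI : \int[leb]_(x in `[- A, A]) (poisson z0 x * normc (theta (x +i* e n)))
      @[n --> \oo] --> \int[leb]_(x in `[- A, A]) poisson z0 x.
    have mc f : cont_on (- A) A f -> measurable_fun `[- A, A] f.
      by move=> /integrable_seg/integrableP[/measurable_EFinP].
    apply: (@Rdominated R _ _ _ (fun x => M * poisson z0 x) _ _ (mc _ cP) _ _ _).2.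
    - exact: measurable_itv.
    - move=> n; apply: mc; apply: cont_onM => // x _; apply/cont_epsP => d d0.
      have [r r0 rP] := chol_cont (Hc (x +i* e n) (e0 n)) d0.
      exists r => // y yx.
      have := rP ((y +i* e n) - (x +i* e n)) (le_lt_trans (hline_lip (e n) x y) yx).
      rewrite [(x +i* e n) + _]addrC subrK; apply: le_lt_trans.
      exact: normc_dist.
    - apply: ae_mono tl => x /at_right_seq hx _.
      rewrite -[X in _ --> X]mulr1; apply: cvgM; [exact: cvg_cst|exact: hx].
    - apply: integrable_seg; apply: cont_onM => //; by move=> x _; exact: cvg_cst.
    - move=> n x _; rewrite normrM (ger0_norm (ltW (poisson_gt0 x y0))) mulrC.
      rewrite ger0_norm ?normc_ge0// ler_wpM2r ?(ltW (poisson_gt0 x y0))//.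
      by apply: tM => /=.
  have c1 : normc (theta (z0 + 0 +i* e n)) ^+ 2 *
     \int[leb]_(x in `[- A, A]) poisson z0 x @[n --> \oo] -->
     m ^+ 2 * \int[leb]_(x in `[- A, A]) poisson z0 x.
    by apply: cvgM; [rewrite expr2; apply: cvgM|exact: cvg_cst].
  have c2 : normc (theta (z0 + 0 +i* e n)) *
     \int[leb]_(x in `[- A, A]) (poisson z0 x * normc (theta (x +i* e n)))
     + 32 * M ^+ 2 / A @[n --> \oo] -->
     m * \int[leb]_(x in `[- A, A]) poisson z0 x + 32 * M ^+ 2 / A.
    by apply: cvgD; [apply: cvgM|exact: cvg_cst].
  by apply: ler_cvg_to c1 c2 _; exact: nearW.
pose A0 := 2 * `|Re z0| + 2 * Im z0 + 1.
have nR : 0 <= `|Re z0| by [].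
have A0p : 0 < A0 by rewrite /A0; lra.
pose I A := \int[leb]_(x in `[- A, A]) poisson z0 x.
have I0 : 0 < I A0.
  pose D := (A0 + `|Re z0|) ^+ 2 + Im z0 ^+ 2.
  have D0 : 0 < D by rewrite /D ltr_wpDl ?sqr_ge0// exprn_gt0.
  apply: lt_le_trans (_ : D^-1 * (A0 - - A0) <= _).
    by rewrite mulr_gt0 ?invr_gt0//; lra.
  apply: seg_ge_cst; [lra|exact: poisson_cont|].
  move=> x /andP[x1 x2]; rewrite lef_pV2 ?posrE ?poisson_den//.
  rewrite lerD2r -[leLHS]real_normK ?num_real//.
  apply: lerXn2r; rewrite ?nnegrE ?normr_ge0//.
    by rewrite addr_ge0 ?(ltW A0p).
  by apply: le_trans (ler_normB _ _) _; rewrite lerD2r ler_norml x1.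
have Imono A : A0 <= A -> I A0 <= I A.
  move=> AA; rewrite /I.
  have cP a b := @poisson_cont z0 a b y0.
  rewrite (@seg_split R (- A) (- A0) A)//; try lra.
  rewrite (@seg_split R (- A0) A0 A)//; try lra.
  have p1 : 0 * (- A0 - - A) <= \int[leb]_(x in `[- A, - A0]) poisson z0 x.
    by apply: seg_ge_cst => //; [lra|move=> x _; exact/ltW/poisson_gt0].
  have p2 : 0 * (A - A0) <= \int[leb]_(x in `[A0, A]) poisson z0 x.
    by apply: seg_ge_cst => //; move=> x _; exact/ltW/poisson_gt0.
  lra.
pose k := (m ^+ 2 - m) * I A0.
have mm : 0 < m ^+ 2 - m.
  by rewrite subr_gt0 expr2 ltr_pMr//; apply: lt_trans m1.
have k0 : 0 < k by rewrite mulr_gt0.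
(* A is chosen so that k A > 32 M^2, where k = (m^2 - m) I(A0). *)
pose A := A0 + 32 * M ^+ 2 / k + 1.
have q0 : 0 <= 32 * M ^+ 2 / k by apply: divr_ge0; [rewrite mulr_ge0 ?sqr_ge0|exact: ltW].
have AA : A0 <= A by rewrite /A; lra.
have := key A ltac:(rewrite /A /A0; lra) ltac:(rewrite /A /A0; lra).
rewrite -/(I A) => H1.
have Ap : 0 < A by rewrite /A; lra.
have H2 : (m ^+ 2 - m) * I A <= 32 * M ^+ 2 / A by rewrite mulrBl; lra.
have H3 : k <= (m ^+ 2 - m) * I A.
  by rewrite ler_wpM2l ?Imono// ltW.
have := le_trans H3 H2; rewrite ler_pdivlMr// leNgt => /negP; apply.
have kA : k * A = k * A0 + 32 * M ^+ 2 + k.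
  by rewrite /A; clearbody k A0; field; rewrite gt_eqF.
rewrite kA.
have : 0 < k * A0 by rewrite mulr_gt0.
lra.
Qed.

End inner.

(** * The complex exponential and its Taylor remainders *)

Section cexp.
Context (R : realType).
Local Notation C := R[i].
Implicit Types (z w h k : C) (a b t x : R).

Lemma cexpD z w : cexp (z + w) = cexp z * cexp w.
Proof.
rewrite /cexp cReD cImD expRD cosD sinD; apply: complex_eq;
by rewrite ?(cReM, cImM) /=; ring.
Qed.

Lemma cexp0 : cexp 0 = 1 :> C.
Proof. by rewrite /cexp /= expR0 cos0 sin0 mul1r. Qed.

Lemma normc_cexp z : normc (cexp z) = expR (Re z).
Proof.
rewrite /cexp normcM normc_real ger0_norm ?expR_ge0//.
by rewrite /= cos2Dsin2 sqrtr1 mulr1.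
Qed.

Lemma cexp_real x : cexp x%:C = (expR x)%:C.
Proof. by rewrite /cexp /= cos0 sin0; apply: complex_eq; rewrite ?(cReM, cImM) /=; ring. Qed.

(** The exponential minus its Taylor polynomial of degree n - 1. The recursive
form makes the telescoping in the expansion of the Laplace transform immediate. *)
Fixpoint cexp_rem n z := if n is m.+1 then cexp_rem m z - z ^+ m / m`!%:R else cexp z.

Lemma cexp_remE n z : cexp_rem n z = cexp z - \sum_(j < n) z ^+ j / j`!%:R.
Proof.
elim: n => [|n IH]; first by rewrite big_ord0 subr0.
by rewrite big_ord_recr /= IH opprD addrA.
Qed.

Lemma cexp_rem0 n : cexp_rem n.+1 0 = 0.
Proof.
rewrite cexp_remE big_ord_recl expr0 fact0 invr1 mulr1 cexp0.
by rewrite big1 ?addr0 ?subrr// => i _; rewrite exprS mul0r mul0r.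
Qed.

Lemma real_expr t n : (t%:C : C) ^+ n = (t ^+ n)%:C.
Proof. by rewrite rmorphXn. Qed.

Lemma is_derive_cexp k z t :
  is_derive t 1 (fun s : R => Re (k * cexp (s%:C * z)))
    (Re (k * z * cexp (t%:C * z))).
Proof.
have E s : Re (k * cexp (s%:C * z)) = expR (s * Re z) *
    (Re k * cos (s * Im z) - Im k * sin (s * Im z)).
  by rewrite /cexp !(cReM, cImM) /= !mul0r !subr0 !addr0; ring.
rewrite (_ : (fun s => _) = (fun s => expR (s * Re z) *
    (Re k * cos (s * Im z) - Im k * sin (s * Im z)))); last exact/funext.
have dl (a : R) : is_derive t 1 (fun s : R => s * a) a.
  by apply: is_derive_eq; rewrite /GRing.scale /= mulr1 mulr0 add0r.
have de : is_derive t 1 (fun s : R => expR (s * Re z)) (expR (t * Re z) * Re z).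
  exact: (is_derive1_comp (f := expR)).
have dc : is_derive t 1 (fun s : R => cos (s * Im z)) (- sin (t * Im z) * Im z).
  exact: (is_derive1_comp (f := cos)).
have ds : is_derive t 1 (fun s : R => sin (s * Im z)) (cos (t * Im z) * Im z).
  exact: (is_derive1_comp (f := sin)).
apply: is_derive_eq; rewrite /GRing.scale /= /cexp !(cReM, cImM) /=.
by rewrite !mul0r !subr0 !addr0; ring.
Qed.

(** Along a ray, the derivative of a remainder is the previous remainder. Taking
the real part after multiplying by an arbitrary k keeps to real functions and
still gives the imaginary part, for k = -i. *)
Lemma is_derive_cexp_rem n k z t :
  is_derive t 1 (fun s : R => Re (k * cexp_rem n (s%:C * z)))
    (Re (k * z * cexp_rem n.-1 (t%:C * z))).
Proof.
elim: n => [|n IH]; first exact: is_derive_cexp.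
rewrite (_ : (fun s => _) = (fun s : R => Re (k * cexp_rem n (s%:C * z)) -
    s ^+ n * Re (k * z ^+ n / n`!%:R))); last first.
  apply/funext => s /=; rewrite mulrBr cReB; congr (_ - _).
  rewrite exprMn real_expr -[s ^+ n * _]/(s ^+ n * _) -[LHS]/(Re _).
  have -> : k * ((s ^+ n)%:C * z ^+ n / n`!%:R) = (s ^+ n)%:C * (k * z ^+ n / n`!%:R).
    by ring.
  by rewrite cReM /= mul0r subr0.
set c := Re (k * z ^+ n / n`!%:R).
have dX : is_derive t (1 : R) (fun s : R => s ^+ n * c) (n%:R * t ^+ n.-1 * c).
  have dXn : is_derive t (1 : R) (fun s : R => s ^+ n) (n%:R * t ^+ n.-1).
    apply: DeriveDef; first exact: exprn_derivable.
    by rewrite exp_derive /GRing.scale /= mulr1.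
  apply: (is_derive_eq (is_deriveM dXn (is_derive_cst c t 1))).
  by rewrite /GRing.scale /= mulr0 add0r mulrC.
apply: (is_derive_eq (is_deriveB IH dX)).
case: n IH @c dX => [|n] IH c dX /=; first by rewrite !mul0r subr0.
rewrite mulrBr cReB; congr (_ - _).
rewrite exprMn real_expr.
have -> : k * z * ((t ^+ n)%:C * z ^+ n / n`!%:R) =
    (n.+1%:R * t ^+ n)%:C * (k * z ^+ n.+1 / n.+1`!%:R).
  rewrite factS natrM rmorphM rmorph_nat exprS.
  have n0 : n`!%:R != 0 :> C by rewrite pnatr_eq0 -lt0n fact_gt0.
  have n1 : n.+1%:R != 0 :> C by rewrite pnatr_eq0.
  move: (n.+1%:R : C) (n`!%:R : C) n0 n1 => a b a0 b0.
  by field; rewrite a0 b0.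
by rewrite cReM /= mul0r subr0; ring.
Qed.

(** The mean value theorem for the real part of conj D times the remainder, where
D is its end value, replaces the integration of the previous bound. *)
Lemma cexp_rem_bound n z : normc (cexp_rem n z) <= normc z ^+ n * expR (normc z).
Proof.
suff H : forall t : R, 0 <= t <= 1 ->
    normc (cexp_rem n (t%:C * z)) <= normc z ^+ n * expR (normc z).
  by have := H 1; rewrite mul1r; apply; rewrite ler01 lexx.
elim: n => [t /andP[t0 t1]|n IH t /andP[t0 t1]].
  rewrite expr0 mul1r normc_cexp ler_expR; apply: le_trans (ler_norm _) _.
  apply: le_trans (normc_Re _) _; rewrite normcM normc_real.
  by rewrite ger0_norm// ler_piMl// normc_ge0.
have [->|D0] := eqVneq (normc (cexp_rem n.+1 (t%:C * z))) 0.
  by rewrite mulr_ge0 ?expR_ge0// exprn_ge0// normc_ge0.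
set D := cexp_rem n.+1 (t%:C * z) in D0 *.
pose f s := Re (conjc D * cexp_rem n.+1 (s%:C * z)).
pose df s := Re (conjc D * z * cexp_rem n (s%:C * z)).
have fd (s : R) : is_derive s (1 : R) f (df s) by exact: is_derive_cexp_rem.
have [c] := @MVT_segment R f df 0 t t0 (fun x _ => fd x)
  (derivable_within_continuous (fun x _ => @ex_derive _ _ _ _ _ _ _ (fd x))).
rewrite in_itv /= => /andP[c0 ct].
rewrite {2}/f mul0r cexp_rem0 mulr0 [Re 0]/= !subr0.
have fD : f t = normc D ^+ 2.
  by rewrite /f -/D normcE2 cReM; case: (D) => u v /=; ring.
rewrite fD => E.
have Dp : 0 < normc D by rewrite lt_neqAle eq_sym D0 normc_ge0.
have B : `|df c| <= normc D * (normc z ^+ n.+1 * expR (normc z)).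
  apply: le_trans (normc_Re _) _.
  rewrite !normcM normc_conj exprS -!mulrA.
  rewrite ler_wpM2l ?normc_ge0// ler_wpM2l ?normc_ge0//.
  by apply: IH; rewrite c0 (le_trans ct t1).
rewrite -(ler_pM2l Dp); apply: le_trans B.
rewrite -expr2 E; apply: le_trans (ler_norm _) _; rewrite normrM (ger0_norm t0).
by rewrite ler_piMr.
Qed.

Lemma cderiv_cexp z : cderiv (@cexp R) z (cexp z).
Proof.
move=> e e0.
have q0 : 0 < e / (normc (cexp z) * expR 1).
  by rewrite divr_gt0// mulr_gt0 ?expR_gt0// normc_cexp expR_gt0.
exists (Num.min 1 (e / (normc (cexp z) * expR 1))); first by rewrite lt_min ltr01.
move=> h; rewrite lt_min => /andP[h1 he].
have -> : cexp (z + h) - cexp z - cexp z * h = cexp z * cexp_rem 2 h.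
  by rewrite cexpD /= expr0 expr1 !invr1 !mulr1; ring.
rewrite normcM.
have := cexp_rem_bound 2 h => B.
have h0 := normc_ge0 h; have E1 : expR (normc h) <= expR 1 by rewrite ler_expR ltW.
have z0 : 0 < normc (cexp z) by rewrite normc_cexp expR_gt0.
move: he; rewrite ltr_pdivlMr ?mulr_gt0 ?expR_gt0// => he.
apply: le_trans (ler_wpM2l (ltW z0) B) _.
have -> : normc (cexp z) * (normc h ^+ 2 * expR (normc h)) =
  (normc h * (normc (cexp z) * expR (normc h))) * normc h by ring.
rewrite ler_wpM2r//; apply: le_trans (ltW he).
by rewrite ler_wpM2l// ler_wpM2l// ltW.
Qed.

Lemma chol_cexp z : chol (@cexp R) z.
Proof. by apply/cholP; exists (cexp z); exact: cderiv_cexp. Qed.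

End cexp.

(** * Toeplitz matrices of functions bounded by one in the disc *)

Section toeplitz.
Context (R : realType).
Local Notation C := R[i].
Local Notation leb := (@lebesgue_measure R).
Implicit Types (z w : C) (phi : C -> C) (x y : R) (k n N : nat) (b u v : nat -> R).
Local Notation pi2 := (2 * pi : R).

Lemma cexp_2pi k n : cexp ((k%:R - n%:R)%:C * (0 +i* pi2)) = 1 :> C.
Proof.
have H m : cexp (m%:R%:C * (0 +i* pi2)) = 1 :> C.
  elim: m => [|m IH]; first by rewrite mul0r cexp0.
  rewrite -natr1 rmorphD /= mulrDl cexpD IH mul1r mul1r.
  rewrite /cexp /= expR0 mul1r mulr_natl -[pi *+ 2]add0r.
  by rewrite cosD2pi sinD2pi cos0 sin0.
have := H k; rewrite -{1}(subrK (n%:R : R) k%:R).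
by rewrite rmorphD mulrDl cexpD H mulr1.
Qed.

Lemma cexpX z n : cexp z ^+ n = cexp (n%:R%:C * z).
Proof.
elim: n => [|n IH]; first by rewrite expr0 mul0r cexp0.
by rewrite exprS IH -natr1 rmorphD /= mulrDl mul1r addrC cexpD.
Qed.

Lemma conj_cexp x y : conjc (cexp (x +i* y)) = cexp ((2 * x)%:C) * cexp (- (x +i* y)).
Proof.
rewrite -cexpD.
have -> : (2 * x)%:C + - (x +i* y) = x +i* (- y).
  by apply: complex_eq; rewrite ?cReD ?cImD /=; ring.
by rewrite /cexp /= cosN sinN; apply: complex_eq => /=; ring.
Qed.

Lemma monomial_cexp x y k n : cexp (x +i* y) ^+ k * conjc (cexp (x +i* y)) ^+ n =
  (expR (2 * n%:R * x))%:C * cexp ((k%:R - n%:R)%:C * (x +i* y)).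
Proof.
rewrite cexpX conj_cexp exprMn !cexpX -cexp_real -!cexpD; congr cexp.
by rewrite !rmorphM rmorphB /= !rmorph_nat; ring.
Qed.

(** Orthogonality of the characters of the circle |w| = e^x, in the coordinate
x + iy = log w. *)
Lemma int_cos k n x : \int[leb]_(y in `[0, pi2])
    Re (cexp ((k%:R - n%:R)%:C * (x +i* y))) = if k == n then pi2 else 0.
Proof.
have p0 : 0 < pi2 by rewrite mulr_gt0// pi_gt0.
case: eqVneq => [->|kn].
  under seg_eq => y _ do rewrite subrr mul0r cexp0 /=.
  by rewrite seg_cst ?ltW// mul1r subr0.
pose m : R := k%:R - n%:R.
have m0 : m != 0 by rewrite subr_eq0 eqr_nat.
pose F y := expR (m * x) / m * sin (m * y).
have fE y : Re (cexp (m%:C * (x +i* y))) = expR (m * x) * cos (m * y).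
  have -> : m%:C * (x +i* y) = (m * x) +i* (m * y).
    by apply: complex_eq; rewrite ?(cReM, cImM) /=; ring.
  by rewrite /cexp cReM /=; ring.
have dF (y : R) : is_derive y (1 : R) F (expR (m * x) * cos (m * y)).
  have dl : is_derive y 1 (fun s : R => m * s) m.
    by apply: is_derive_eq; rewrite /GRing.scale /= mulr1.
  have ds : is_derive y 1 (fun s : R => sin (m * s)) (cos (m * y) * m).
    exact: (is_derive1_comp (f := sin)).
  apply: is_derive_eq; rewrite /GRing.scale /=.
  by field.
under seg_eq => y _ do rewrite fE.
have cF : cont_on 0 pi2 (fun y => expR (m * x) * cos (m * y)).
  move=> y _; apply: cvgM; first exact: cvg_cst.
  apply: continuous_comp; last exact: continuous_cos.
  by apply: cvgM; [exact: cvg_cst|exact: cvg_id].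
have := @continuous_FTC2 R (fun y => expR (m * x) * cos (m * y)) F 0 pi2 p0
   (cont_on_within cF).
rewrite /Rintegral => -> //.
- rewrite /F mulr0 sin0 mulr0 /= subr0.
  have -> : sin (m * pi2) = Im (cexp (m%:C * (0 +i* pi2))).
    have -> : m%:C * (0 +i* pi2) = 0 +i* (m * pi2).
      by apply: complex_eq; rewrite ?(cReM, cImM) /=; ring.
    by rewrite /cexp cImM /= expR0; ring.
  by rewrite cexp_2pi /= mulr0.
- have cFF : {within `[0, pi2], continuous F}.
    apply: derivable_within_continuous => y _; exact: ex_derive.
  split; first by move=> y _; exact: ex_derive.
    by apply: cvg_at_right_filter; have /differentiable_continuous := (@derivable1_diffP _ _ F 0).1 (@ex_derive _ _ _ _ _ _ _ (dF 0)).
  by apply: cvg_at_left_filter; have /differentiable_continuous := (@derivable1_diffP _ _ F pi2).1 (@ex_derive _ _ _ _ _ _ _ (dF pi2)).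
- by move=> y _; rewrite derive1E; apply: derive_val.
Qed.

(** Asymptotic expansions in place of convergent power series: they are what an
integral representation gives directly, and they determine the coefficients. *)
Definition taylor_at0 phi b := forall N, exists B r : R, 0 < r /\
  forall w, normc w < r ->
    normc (phi w - \sum_(j < N) (b j)%:C * w ^+ j) <= B * normc w ^+ N.

Lemma seg_sum (I : Type) (s : seq I) (f : I -> R -> R) a c :
  (forall i, cont_on a c (f i)) ->
  cont_on a c (fun y => \sum_(i <- s) f i y) /\
  \int[leb]_(y in `[a, c]) (\sum_(i <- s) f i y) =
  \sum_(i <- s) \int[leb]_(y in `[a, c]) f i y.
Proof.
move=> cf; elim: s => [|i s [IH1 IH2]].
  split.
    by under eq_fun do rewrite big_nil; move=> y _; exact: cvg_cst.
  under seg_eq => y _ do rewrite big_nil.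
  by rewrite big_nil Rintegral_cst// mul0r.
split.
  by under eq_fun do rewrite big_cons; exact: cont_onD.
under seg_eq => y _ do rewrite big_cons.
by rewrite segD// IH2 big_cons.
Qed.

Lemma Re_sum (I : Type) (s : seq I) (f : I -> C) :
  Re (\sum_(i <- s) f i) = \sum_(i <- s) Re (f i).
Proof.
elim: s => [|i s IH]; first by rewrite !big_nil.
by rewrite !big_cons cReD IH.
Qed.

Lemma conj_sum (I : Type) (s : seq I) (f : I -> C) :
  conjc (\sum_(i <- s) f i) = \sum_(i <- s) conjc (f i).
Proof. exact: rmorph_sum. Qed.

Section coef.
Variables (phi : C -> C) (b : nat -> R).
Hypothesis phol : forall w, normc w < 1 -> chol phi w.
Hypothesis ptay : taylor_at0 phi b.

(** The integrand phi(w) w^k w^-n in the coordinate z = log w. Circles around 0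
become vertical segments of length 2 pi, and annuli become rectangles whose
horizontal sides cancel by periodicity. *)
Let polar k n z := phi (cexp z) * cexp ((k%:R - n%:R)%:C * z).

Let polar_chol k n z : Re z < 0 -> chol (polar k n) z.
Proof.
move=> z0; apply: cholM.
  apply: (chol_comp (G := @cexp R)); first exact: chol_cexp.
  by apply: phol; rewrite normc_cexp -expR0 ltr_expR.
apply: (chol_comp (F := @cexp R) (G := fun z => (k%:R - n%:R)%:C * z)).
  by apply: cholM; [exact: chol_cst|exact: chol_id].
exact: chol_cexp.
Qed.

Let G k n x := \int[leb]_(y in `[0, pi2]) Re (polar k n (x +i* y)).

Let pi2_gt0 : 0 < pi2. Proof. by rewrite mulr_gt0// pi_gt0. Qed.

Let polar_cont k n x : x < 0 -> cont_on 0 pi2 (fun y => Re (polar k n (x +i* y))).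
Proof.
move=> x0; have : vcont (polar k n) 0 pi2 x.
  by move=> y _; apply/chol_cont/polar_chol.
by move=> /vcont_on[].
Qed.

(** Goursat's theorem on a period rectangle. *)
Let G_const k n x1 x2 : x1 <= x2 -> x2 < 0 -> G k n x1 = G k n x2.
Proof.
move=> x12 x20; have := @goursat R (fun z => 'i%C * polar k n z) x1 x2 0 pi2 x12
  (ltW pi2_gt0).
have per x : polar k n (x +i* pi2) = polar k n (x +i* 0).
  rewrite /polar.
  have -> : x +i* pi2 = (x +i* 0) + (0 +i* pi2) by apply: complex_eq => /=; ring.
  have e2 : cexp (0 +i* pi2) = 1 :> C.
    by have := cexp_2pi 1 0; rewrite subr0 mul1r.
  rewrite (cexpD (x +i* 0)) e2 mulr1 mulrDr (cexpD (_ * (x +i* 0))).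
  by rewrite cexp_2pi mulr1.
move=> /(_ _)/eqP; rewrite /Phi.
under [X in X - _]seg_eq => x _ do rewrite per subrr.
rewrite Rintegral_cst// mul0r sub0r oppr_eq0.
have Ei z : Im ('i%C * z) = Re z by case: z => ? ? /=; ring.
under seg_eq => y _ do rewrite !Ei.
rewrite segB; [|exact: polar_cont|apply: polar_cont; exact: le_lt_trans x20].
rewrite subr_eq0 => H; apply/esym/eqP/H => z /andP[_ zx] _.
by apply: cholM; [exact: chol_cst|apply: polar_chol; exact: le_lt_trans x20].
Qed.

(** The integral does not depend on x, and as x tends to -oo the Taylor expansion
of phi to order n leaves an error of order e^((k + 1) x). *)
Let G_val k n x : x < 0 -> G k n x = if (k <= n)%N then pi2 * b (n - k) else 0.
Proof.
move=> x0; set V := (RHS).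
have [B [r [r0 HB]]] := ptay n.+1.
have B0 : 0 <= `|B| by [].
apply/eqP; rewrite -subr_eq0 -normr_le0; apply/ler_addgt0Pr => e e0; rewrite add0r.
pose d := Num.min r (e / (pi2 * (`|B| + 1))).
have d0 : 0 < d.
  by rewrite lt_min r0 divr_gt0// mulr_gt0//; lra.
(* far enough to the left for e^x1 < d *)
pose x1 := Num.min x (ln d - 1).
have x1x : x1 <= x by rewrite ge_min lexx.
have x10 : x1 < 0 := le_lt_trans x1x x0.
have ex1 : expR x1 < d.
  rewrite -[ltRHS]lnK ?posrE// ltr_expR.
  have : x1 <= ln d - 1 by rewrite ge_min lexx orbT.
  lra.
rewrite -(G_const k n x1x x0).
pose s y := \sum_(j < n.+1) (b j * Re (cexp ((((j + k)%:R) - n%:R)%:C * (x1 +i* y)))).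
have cs j : cont_on 0 pi2 (fun y => b j * Re (cexp ((((j + k)%:R) - n%:R)%:C * (x1 +i* y)))).
  apply: cont_onM; first by move=> y _; exact: cvg_cst.
  have : vcont (fun z => cexp ((((j + k)%:R) - n%:R)%:C * z)) 0 pi2 x1.
    move=> y _; apply: chol_cont.
    apply: (chol_comp (F := @cexp R) (G := fun z => ((j + k)%:R - n%:R)%:C * z)).
      by apply: cholM; [exact: chol_cst|exact: chol_id].
    exact: chol_cexp.
  by move=> /vcont_on[].
have cE j : cont_on 0 pi2 (fun y => Re (cexp ((((j + k)%:R) - n%:R)%:C * (x1 +i* y)))).
  have : vcont (fun z => cexp ((((j + k)%:R) - n%:R)%:C * z)) 0 pi2 x1.
    move=> y _; apply: chol_cont.
    apply: (chol_comp (F := @cexp R) (G := fun z => ((j + k)%:R - n%:R)%:C * z)).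
      by apply: cholM; [exact: chol_cst|exact: chol_id].
    exact: chol_cexp.
  by move=> /vcont_on[].
have [cS IS] := seg_sum (index_enum 'I_n.+1) (fun j : 'I_n.+1 => cs j).
have VE : \int[leb]_(y in `[0, pi2]) s y = V.
  rewrite /s IS.
  have E (j : 'I_n.+1) : \int[leb]_(y in `[0, pi2])
      (b j * Re (cexp ((((j + k)%:R) - n%:R)%:C * (x1 +i* y)))) =
      if (j + k == n)%N then pi2 * b j else 0.
    rewrite segZ ?int_cos; last exact: cE.
    by case: eqP => _; rewrite ?mulr0 // mulrC.
  rewrite (eq_bigr _ (fun j _ => E j)) -big_mkcond /=.
  rewrite /V; case: leqP => kn.
    have jn : (n - k < n.+1)%N by rewrite ltnS leq_subr.
    rewrite (big_pred1 (Ordinal jn))//= => j.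
    by rewrite /= -[RHS](inj_eq (@ord_inj n.+1)) /= -[RHS](eqn_add2r k) subnK.
  rewrite big1// => j /eqP jk; exfalso; move: kn.
  by apply/negP; rewrite -leqNgt -[leqRHS]jk leq_addl.
rewrite -VE -segB//; last exact: polar_cont.
have bnd y : `|Re (polar k n (x1 +i* y)) - s y| <= (`|B| + 1) * expR x1.
  pose w := cexp (x1 +i* y).
  have nw : normc w = expR x1 by rewrite normc_cexp.
  have E : Re (polar k n (x1 +i* y)) - s y =
      Re ((phi w - \sum_(j < n.+1) (b j)%:C * w ^+ j) *
          cexp ((k%:R - n%:R)%:C * (x1 +i* y))).
    rewrite mulrBl cReB /polar -/w; congr (_ - _).
    rewrite mulr_suml Re_sum; apply: eq_bigr => j _.
    rewrite -mulrA [RHS]Re_realM; congr (_ * Re _).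
    rewrite /w cexpX -cexpD; congr cexp; move: (x1 +i* y) => zz.
    by rewrite natrD !rmorphB rmorphD /=; ring.
  rewrite E; apply: le_trans (normc_Re _) _.
  rewrite normcM.
  have wr : normc w < r by rewrite nw; apply: lt_le_trans ex1 _; rewrite ge_min lexx.
  have := HB w wr; rewrite nw => Hw.
  have -> : normc (cexp ((k%:R - n%:R)%:C * (x1 +i* y))) = expR ((k%:R - n%:R) * x1).
    by rewrite normc_cexp cReM /= mul0r subr0.
  apply: le_trans (ler_wpM2r (expR_ge0 _) Hw) _.
  have -> : B * expR x1 ^+ n.+1 * expR ((k%:R - n%:R) * x1) = B * expR (k.+1%:R * x1).
    rewrite -mulrA; congr (_ * _).
    by rewrite -expRM_natl -expRD; congr expR; rewrite -!natr1; ring.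
  have BB : B <= `|B| + 1 by apply: le_trans (ler_norm _) _; lra.
  apply: le_trans (ler_wpM2r (expR_ge0 _) BB) _.
  apply: ler_wpM2l; first by lra.
  rewrite ler_expR -natr1 mulrDl mul1r gerDr.
  by rewrite mulr_ge0_le0 // ltW.
apply: le_trans (seg_norm_le (ltW pi2_gt0) _ (fun y _ => bnd y)) _.
  by apply: cont_onB => //; exact: polar_cont.
rewrite subr0.
have : expR x1 <= e / (pi2 * (`|B| + 1)).
  by apply: le_trans (ltW ex1) _; rewrite ge_min lexx orbT.
have den0 : 0 < pi2 * (`|B| + 1) by rewrite mulr_gt0//; lra.
rewrite ler_pdivlMr// => H; apply: le_trans H.
by rewrite le_eqVlt; apply/orP; left; apply/eqP; ring.
Qed.

(** Its mean over the circle |w| = e^x is the pairing of phi p with q, for the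
polynomials p and q with coefficients u and v. *)
Definition pairing u v N x y : C := let w := cexp (x +i* y) in
  phi w * ((\sum_(k < N) (u k)%:C * w ^+ k) * conjc (\sum_(n < N) (v n)%:C * w ^+ n)).

(** The exponential weights come from w conj w = e^(2x) on the circle. *)
Lemma pairing_cont u v N x : x < 0 ->
  cont_on 0 pi2 (fun y => Re (pairing u v N x y)) /\
  \int[leb]_(y in `[0, pi2]) Re (pairing u v N x y) =
  pi2 * \sum_(n < N) \sum_(k < N | (k <= n)%N) u k * v n * b (n - k) * expR (2 * n%:R * x).
Proof.
move=> x0.
have E y : Re (pairing u v N x y) = \sum_(n < N) \sum_(k < N)
    (u k * v n * expR (2 * n%:R * x)) * Re (polar k n (x +i* y)).
  rewrite /pairing conj_sum mulr_sumr mulr_sumr Re_sum; apply: eq_bigr => n _.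
  rewrite mulr_suml mulr_sumr Re_sum; apply: eq_bigr => k _.
  rewrite /polar -[RHS]Re_realM; congr Re.
  move: (cexp (x +i* y)) (monomial_cexp x y k n) => w M.
  have -> : conjc ((v n)%:C * w ^+ n) = (v n)%:C * conjc w ^+ n.
    by rewrite [LHS]rmorphM [X in _ * X]rmorphXn; congr (_ * _); exact: conjc_real.
  transitivity (phi w * ((u k)%:C * (v n)%:C) * (w ^+ k * conjc w ^+ n)); first by ring.
  by rewrite M !rmorphM; ring.
have cc (n k : nat) : cont_on 0 pi2 (fun y => (u k * v n * expR (2 * n%:R * x)) * Re (polar k n (x +i* y))).
  by apply: cont_onM; [move=> ? _; exact: cvg_cst|exact: polar_cont].
have cn (n : nat) := seg_sum (index_enum 'I_N) (fun k : 'I_N => cc n k).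
have [c1 c2] := seg_sum (index_enum 'I_N) (fun n : 'I_N => (cn n).1).
rewrite (_ : (fun y => _) = (fun y => \sum_(n < N) \sum_(k < N)
    (u k * v n * expR (2 * n%:R * x)) * Re (polar k n (x +i* y)))); last exact/funext.
split=> //.
rewrite c2 mulr_sumr; apply: eq_bigr => n _; rewrite (cn n).2 mulr_sumr.
rewrite [RHS]big_mkcond; apply: eq_bigr => k _.
rewrite segZ; last exact: polar_cont.
rewrite -/(G k n x) G_val//; case: ifP => _; last by rewrite mulr0.
by ring.
Qed.

End coef.

Lemma pairing_one u N x : x < 0 ->
  cont_on 0 pi2 (fun y => Re (pairing (fun=> 1) u u N x y)) /\
  \int[leb]_(y in `[0, pi2]) Re (pairing (fun=> 1) u u N x y) =
  pi2 * \sum_(n < N) u n ^+ 2 * expR (2 * n%:R * x).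
Proof.
move=> x0; pose b1 (j : nat) : R := (j == 0)%:R.
have t1 : taylor_at0 (fun=> 1) b1.
  move=> N'; exists 1, 1; split => // w _; case: N' => [|N'].
    by rewrite big_ord0 subr0 normc1' expr0 mulr1.
  rewrite big_ord_recl big1 ?addr0 => [|i _].
    rewrite (_ : (b1 ord0)%:C * w ^+ ord0 = 1); last by rewrite expr0 mulr1.
    by rewrite subrr (normc_real 0) normr0 mul1r exprn_ge0// normc_ge0.
  by rewrite /b1 /= mul0r.
have [c1 c2] := @pairing_cont (fun=> 1) b1 (fun w _ => @chol_cst R 1 w) t1 u u N x x0.
split=> //; rewrite c2; congr (_ * _); apply: eq_bigr => n _.
rewrite (bigD1 n)//= subnn {1}/b1 eqxx mulr1 big1 ?addr0 => [|k /andP[kn kn']].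
  by rewrite expr2.
have nk : (n - k == 0)%N = false.
  apply/negbTE; rewrite subn_eq0 -ltnNge ltn_neqAle kn andbT.
  by move: kn'; rewrite -(inj_eq (@ord_inj N)).
by rewrite /b1 nk mulr0 mul0r.
Qed.

(** Let d be the image of h under the matrix, p and q the polynomials with
coefficients h and d. Integrating 2 Re(phi p conj q) <= |p|^2 + |q|^2 over the
circle |w| = e^x gives 2 sum d^2 <= sum h^2 + sum d^2, up to weights that tend
to 1 as x tends to 0. *)
Theorem toeplitz_contraction phi b (h : nat -> R) N :
  (forall w, normc w < 1 -> chol phi w) ->
  (forall w, normc w < 1 -> normc (phi w) <= 1) ->
  taylor_at0 phi b ->
  \sum_(n < N) (\sum_(k < N | (k <= n)%N) h k * b (n - k)%N) ^+ 2 <=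
  \sum_(k < N) h k ^+ 2.
Proof.
move=> phol ph1 ptay.
pose d n := \sum_(k < N | (k <= n)%N) h k * b (n - k)%N.
have p0 : 0 < pi2 by rewrite mulr_gt0// pi_gt0.
have key x : x < 0 -> \sum_(n < N) d n ^+ 2 * expR (2 * n%:R * x) <=
    \sum_(n < N) h n ^+ 2 * expR (2 * n%:R * x).
  move=> x0.
  have [c1 I1] := pairing_cont phol ptay h d N x0.
  have [c2 I2] := pairing_one h N x0.
  have [c3 I3] := pairing_one d N x0.
  have I1' : \int[leb]_(y in `[0, pi2]) Re (pairing phi h d N x y) =
      pi2 * \sum_(n < N) d n ^+ 2 * expR (2 * n%:R * x).
    rewrite I1; congr (_ * _); apply: eq_bigr => n _.
    rewrite -mulr_suml; congr (_ * _); rewrite expr2 [X in _ = X * _]/d mulr_suml.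
    by apply: eq_bigr => k _; ring.
  have L : \int[leb]_(y in `[0, pi2]) (2 * Re (pairing phi h d N x y)) <=
     \int[leb]_(y in `[0, pi2])
       (Re (pairing (fun=> 1) h h N x y) + Re (pairing (fun=> 1) d d N x y)).
    apply: seg_le; [|exact: cont_onD|move=> y _].
      by apply: cont_onM => // y _; exact: cvg_cst.
    rewrite /pairing; set w := cexp (x +i* y).
    set p := \sum_(k < N) _; set q := \sum_(n < N) (d n)%:C * _.
    have sq z : Re (1 * (z * conjc z)) = normc z ^+ 2.
      by rewrite mul1r normcE2 cReM; case: z => a e /=; ring.
    rewrite !sq.
    have : Re (phi w * (p * conjc q)) <= normc p * normc q.
      apply: le_trans (ler_norm _) _; apply: le_trans (normc_Re _) _.
      rewrite !normcM normc_conj ler_piMl//.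
        by rewrite mulr_ge0// normc_ge0.
      by apply: ph1; rewrite normc_cexp -expR0 ltr_expR.
    by have := sqr_ge0 (normc p - normc q); nra.
  move: L; rewrite segZ// segD// I1' I2 I3 -mulrDr mulrCA ler_pM2l//.
  lra.
apply/ler_addgt0Pr => e e0.
set S := \sum_(n < N) _; have S0 : 0 <= S by apply: sumr_ge0 => n _; exact: sqr_ge0.
(* With this x the weights, at least 1 + 2Nx, change S by at most e. *)
pose x : R := - (e / (2 * N%:R * S + 1)).
have den : 0 < 2 * N%:R * S + 1 by rewrite ltr_wpDl// !mulr_ge0.
have x0 : x < 0 by rewrite oppr_lt0 divr_gt0.
have L1 : S * expR (2 * N%:R * x) <= \sum_(n < N) d n ^+ 2 * expR (2 * n%:R * x).
  rewrite mulr_suml; apply: ler_sum => n _; rewrite ler_wpM2l ?sqr_ge0//.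
  rewrite ler_expR ler_wnM2r ?(ltW x0)// ler_pM2l// ler_nat; exact: ltnW.
have L2 : \sum_(n < N) h n ^+ 2 * expR (2 * n%:R * x) <= \sum_(k < N) h k ^+ 2.
  apply: ler_sum => n _; rewrite ler_piMr ?sqr_ge0// -expR0 ler_expR.
  by rewrite mulr_ge0_le0 ?(ltW x0)// mulr_ge0.
have L3 : S * (1 + 2 * N%:R * x) <= S * expR (2 * N%:R * x).
  by rewrite ler_wpM2l// expR_ge1Dx.
have L4 : S - e <= S * (1 + 2 * N%:R * x).
  rewrite mulrDr mulr1 lerD2l /x mulrN mulrN lerN2 !mulrA ler_pdivrMr//.
  by move: (N%:R : R) => m; lra.
by have := key x x0; lra.
Qed.

End toeplitz.

(** * Laplace transforms *)

Section cint.
Context (R : realType).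
Local Notation C := R[i].
Local Notation leb := (@lebesgue_measure R).
Implicit Types (z w h k : C) (A : set R) (f g : R -> C) (x y : R).

Definition cintegrable A f := leb.-integrable A (EFin \o (fun x => Re (f x))) /\
  leb.-integrable A (EFin \o (fun x => Im (f x))).

Lemma integrableZ_R A (f : R -> R) (r : R) : measurable A ->
  leb.-integrable A (EFin \o f) -> leb.-integrable A (EFin \o (fun x => r * f x)).
Proof. by move=> mA fi; exact: (@integrableZl _ _ R leb A mA r _ fi). Qed.

Lemma integrableD_R A (f g : R -> R) : measurable A ->
  leb.-integrable A (EFin \o f) -> leb.-integrable A (EFin \o g) ->
  leb.-integrable A (EFin \o (fun x => f x + g x)).
Proof. by move=> mA fi gi; exact: (@integrableD _ _ R leb A mA _ _ fi gi). Qed.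

Lemma integrableB_R A (f g : R -> R) : measurable A ->
  leb.-integrable A (EFin \o f) -> leb.-integrable A (EFin \o g) ->
  leb.-integrable A (EFin \o (fun x => f x - g x)).
Proof. by move=> mA fi gi; exact: (@integrableB _ _ R leb A mA _ _ fi gi). Qed.

Lemma cintegrableZ A k f : measurable A -> cintegrable A f ->
  cintegrable A (fun x => k * f x).
Proof.
move=> mA [f1 f2]; split.
  rewrite (_ : (fun x => _) = (fun x => Re k * Re (f x) - Im k * Im (f x))).
    by apply: integrableB_R => //; exact: integrableZ_R.
  by apply/funext => x; rewrite cReM.
rewrite (_ : (fun x => _) = (fun x => Re k * Im (f x) + Im k * Re (f x))).
  by apply: integrableD_R => //; exact: integrableZ_R.
by apply/funext => x; rewrite cImM.
Qed.

Lemma Cintegral_Zl A k f : measurable A -> cintegrable A f ->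
  k * Cintegral A f = Cintegral A (fun x => k * f x).
Proof.
move=> mA [f1 f2]; apply: complex_eq; rewrite /Cintegral ?(cReM, cImM) /=.
  rewrite -!RintegralZl// -RintegralB//; try exact: integrableZ_R.
  by apply: eq_Rintegral => x _; rewrite cReM.
rewrite -!RintegralZl// -RintegralD//; try exact: integrableZ_R.
by apply: eq_Rintegral => x _; rewrite cImM.
Qed.

Lemma Cintegral_B A f g : measurable A -> cintegrable A f -> cintegrable A g ->
  Cintegral A f - Cintegral A g = Cintegral A (fun x => f x - g x).
Proof.
move=> mA [f1 f2] [g1 g2]; apply: complex_eq; rewrite ?cReB ?cImB /Cintegral /=.
  rewrite -RintegralB//; by apply: eq_Rintegral => x _; rewrite cReB.
by rewrite -RintegralB//; apply: eq_Rintegral => x _; rewrite cImB.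
Qed.

Lemma eq_Cintegral A f g : (forall x, A x -> f x = g x) ->
  Cintegral A f = Cintegral A g.
Proof.
move=> fg; congr (_ +i* _); apply: eq_Rintegral => x /set_mem/fg ->//.
Qed.

(** Rotating f by the conjugate of its integral reduces the inequality to real
integrals. *)
Lemma normc_Cintegral_le A f (g : R -> R) : measurable A -> cintegrable A f ->
  leb.-integrable A (EFin \o g) -> (forall x, A x -> normc (f x) <= g x) ->
  normc (Cintegral A f) <= \int[leb]_(x in A) g x.
Proof.
move=> mA cf ig fg.
set u := Cintegral A f.
have g0 : 0 <= \int[leb]_(x in A) g x.
  by apply: Rintegral_ge0 => x Ax; apply: le_trans (fg x Ax); exact: normc_ge0.
have [->|u0] := eqVneq (normc u) 0 => //.
have up : 0 < normc u by rewrite lt_neqAle eq_sym u0 normc_ge0.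
have E : normc u ^+ 2 = Re (conjc u * u).
  by rewrite normcE2 cReM; case: (u) => a b /=; ring.
have Eu : Re (conjc u * u) = \int[leb]_(x in A) Re (conjc u * f x).
  by rewrite {2}/u Cintegral_Zl.
rewrite -(ler_pM2l up) -expr2 E Eu -RintegralZl//.
apply: le_Rintegral => //; [exact: (cintegrableZ _ mA cf).1|exact: integrableZ_R|].
move=> x Ax; apply: le_trans (ler_norm _) _; apply: le_trans (normc_Re _) _.
by rewrite normcM normc_conj ler_wpM2l ?normc_ge0// fg.
Qed.

Lemma cintegrable_dom A f (g : R -> R) : measurable A ->
  measurable_fun A (fun x => Re (f x)) -> measurable_fun A (fun x => Im (f x)) ->
  leb.-integrable A (EFin \o g) -> (forall x, A x -> normc (f x) <= g x) ->
  cintegrable A f.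
Proof.
move=> mA m1 m2 ig fg; split; apply: (@le_integrable _ _ R leb A mA _ _ _ _ ig).
- exact/measurable_EFinP.
- move=> x Ax; rewrite /= lee_fin; apply: le_trans (ler_norm _).
  exact: le_trans (normc_Re _) (fg x Ax).
- exact/measurable_EFinP.
- move=> x Ax; rewrite /= lee_fin; apply: le_trans (ler_norm _).
  exact: le_trans (normc_Im _) (fg x Ax).
Qed.

Lemma integrable_dom A (f g : R -> R) : measurable A -> measurable_fun A f ->
  leb.-integrable A (EFin \o g) -> (forall x, A x -> `|f x| <= g x) ->
  leb.-integrable A (EFin \o f).
Proof.
move=> mA m1 ig fg; apply: (@le_integrable _ _ R leb A mA _ _ _ _ ig).
  exact/measurable_EFinP.
by move=> x Ax; rewrite /= lee_fin; apply: le_trans (ler_norm _); exact: fg.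
Qed.

Lemma integrable_expR (d : R) : 0 < d ->
  leb.-integrable `[0, +oo[ (EFin \o (fun x => expR (- d * x))).
Proof.
move=> d0.
have H := integrable_exponential_pdf d0.
have H1 : leb.-integrable `[0, +oo[ (EFin \o exponential_pdf d).
  exact: (@integrableS _ _ R leb setT).
apply: (@integrable_dom _ _ (fun x => d^-1 * exponential_pdf d x)) => //.
- apply: measurable_funTS; apply: continuous_measurable_fun => x.
  apply: continuous_comp; last exact: continuous_expR.
  by apply: cvgM; [exact: cvg_cst|exact: cvg_id].
- exact: integrableZ_R.
- move=> x; rewrite /= in_itv /= andbT => x0.
  rewrite exponential_pdfE// /= mulrA mulVf ?gt_eqF// mul1r.
  by rewrite ger0_norm ?expR_ge0.
Qed.

Definition ccontinuous f := continuous (fun x => Re (f x)) /\ continuous (fun x => Im (f x)).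

Lemma ccontinuousM f g : ccontinuous f -> ccontinuous g -> ccontinuous (fun x => f x * g x).
Proof.
move=> [f1 f2] [g1 g2]; split=> x.
  rewrite (_ : (fun x => _) = (fun x => Re (f x) * Re (g x) - Im (f x) * Im (g x))).
    by apply: cvgB; apply: cvgM; [exact: f1|exact: g1|exact: f2|exact: g2].
  by apply/funext => y; rewrite cReM.
rewrite (_ : (fun x => _) = (fun x => Re (f x) * Im (g x) + Im (f x) * Re (g x))).
  by apply: cvgD; apply: cvgM; [exact: f1|exact: g2|exact: f2|exact: g1].
by apply/funext => y; rewrite cImM.
Qed.

Lemma ccontinuous_real (f : R -> R) : continuous f -> ccontinuous (fun x => (f x)%:C).
Proof. by move=> cf; split => x /=; [exact: cf|exact: cvg_cst]. Qed.

Lemma ccontinuous_cexp_rem n z : ccontinuous (fun x => cexp_rem n (x%:C * z)).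
Proof.
have H k : continuous (fun x => Re (k * cexp_rem n (x%:C * z))).
  move=> x; apply: differentiable_continuous; apply/derivable1_diffP.
  exact: (@ex_derive _ _ _ _ _ _ _ (is_derive_cexp_rem n k z x)).
split.
  by have := H 1; under eq_fun do rewrite mul1r.
have := H (- 'i%C); rewrite (_ : (fun x => _) = (fun x => Im (cexp_rem n (x%:C * z))))//.
by apply/funext => x; rewrite cReM /=; ring.
Qed.

Lemma ccontinuous_cexp z : ccontinuous (fun x => cexp (x%:C * z)).
Proof. exact: (ccontinuous_cexp_rem 0). Qed.

Lemma ccontinuous_measurable A f : measurable A -> ccontinuous f ->
  measurable_fun A (fun x => Re (f x)) /\ measurable_fun A (fun x => Im (f x)).
Proof.
by move=> mA [f1 f2]; split; apply: measurable_funTS; exact: continuous_measurable_fun.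
Qed.

End cint.

Section lap.
Context (R : realType).
Local Notation C := R[i].
Local Notation leb := (@lebesgue_measure R).
Implicit Types (z w h k : C) (A : set R) (x y c B : R) (K : R -> R).

Local Notation halfline := (`[0, +oo[%classic : set R).

(** Written over the half-line, on which kernels vanishing on (-oo, 0) live. *)
Definition lap K z : C := Cintegral halfline (fun x => (K x)%:C * cexp (x%:C * ('i%C * z))).

Definition exp_growth K c B := continuous K /\ forall x, 0 <= x -> `|K x| <= B * expR (c * x).

Lemma pow_le_exp n y : 0 <= y -> y ^+ n <= n`!%:R * expR y.
Proof.
move=> y0; case: n => [|n].
  by rewrite expr0 mul1r -expR0 ler_expR.
have := @expR_ge1Dxn R y n y0 => H.
rewrite mulrC -ler_pdivrMr ?ltr0n ?fact_gt0//.
by apply: le_trans H; rewrite lerDr.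
Qed.

Lemma fourier_lap K z : (forall x, x < 0 -> K x = 0) ->
  fourier (fun x => (K x)%:C) z = lap K z.
Proof.
move=> K0; rewrite /fourier /lap /Cintegral.
have E x : 'i%C * z * x%:C = x%:C * ('i%C * z) by rewrite mulrC.
congr (_ +i* _); rewrite Rintegral_mkcond; rewrite [RHS]Rintegral_mkcond;
  apply: eq_Rintegral => x _; rewrite !patchE in_setT /= E;
  case: ifPn => //; rewrite notin_setE /= in_itv /= andbT => /negP;
  by rewrite -ltNge => /K0 ->; rewrite ![0 * (_ + _)]mul0r ?[0 * (_ * _ - _)]mul0r ?subr0 ?addr0.
Qed.

Lemma expi_norm x z : normc (cexp (x%:C * ('i%C * z))) = expR (- Im z * x).
Proof.
by rewrite normc_cexp Re_realM cReM /= mul0r mul1r sub0r mulrC.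
Qed.

Section bounds.
Variables (K : R -> R) (c B : R) (z : C).
Hypothesis KB : exp_growth K c B.
Hypothesis cz : c < Im z.

(* The margin between the decay of the exponential and the growth of K is 4d:
one d absorbs the power of x, one d the remainder of e^(xh), and e^(-2dx) is
left to integrate. *)
Let d := (Im z - c) / 4.
Let d0 : 0 < d. Proof. by rewrite divr_gt0// subr_gt0. Qed.

Let B0 : 0 <= B.
Proof.
have := KB.2 0 (lexx 0); rewrite mulr0 expR0 mulr1.
exact: le_trans.
Qed.

Let f n h x : C := (K x)%:C * cexp (x%:C * ('i%C * z)) * cexp_rem n (x%:C * h).
Let m n x : C := (K x)%:C * cexp (x%:C * ('i%C * z)) * (x ^+ n / n`!%:R)%:C.

Let mhalf : measurable (halfline : set (measurableTypeR R)).
Proof. exact: measurable_itv. Qed.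

Let base_le x : 0 <= x ->
  normc ((K x)%:C * cexp (x%:C * ('i%C * z))) <= B * expR (- (4 * d) * x).
Proof.
move=> x0; rewrite normcM normc_real expi_norm.
apply: le_trans (ler_wpM2r (expR_ge0 _) (KB.2 x x0)) _.
rewrite -mulrA -expRD ler_wpM2l// ler_expR /d.
by rewrite le_eqVlt; apply/orP; left; apply/eqP; field.
Qed.

Let f_le n h x : 0 <= x -> normc h < d ->
  normc (f n h x) <= B * n`!%:R / d ^+ n * normc h ^+ n * expR (- (2 * d) * x).
Proof.
move=> x0 hd; rewrite /f normcM.
have h0 := normc_ge0 h.
apply: le_trans (ler_pM (normc_ge0 _) (normc_ge0 _) (base_le x0) (cexp_rem_bound _ _)) _.
rewrite normcM normc_real (ger0_norm x0).
have P : (x * normc h) ^+ n <= (normc h / d) ^+ n * (n`!%:R * expR (d * x)).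
  have -> : x * normc h = (normc h / d) * (d * x) by field; rewrite gt_eqF.
  rewrite exprMn; apply: ler_wpM2l.
    by apply: exprn_ge0; apply: divr_ge0 => //; exact: ltW.
  by apply: pow_le_exp; apply: mulr_ge0 => //; exact: ltW.
have Q : expR (x * normc h) <= expR (d * x).
  by rewrite ler_expR mulrC ler_wpM2r// ltW.
have x1 : 0 <= (x * normc h) ^+ n by rewrite exprn_ge0// mulr_ge0.
have PQ := ler_pM x1 (expR_ge0 _) P Q.
apply: le_trans (ler_wpM2l _ PQ) _; first by rewrite mulr_ge0 ?expR_ge0.
have E : expR (- (2 * d) * x) = expR (- (4 * d) * x) * (expR (d * x) * expR (d * x)).
  by rewrite -!expRD; congr expR; ring.
rewrite E expr_div_n le_eqVlt; apply/orP; left; apply/eqP.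
by field; rewrite expf_neq0// gt_eqF.
Qed.

Let m_le n x : 0 <= x -> normc (m n x) <= B / d ^+ n * expR (- (2 * d) * x).
Proof.
move=> x0; rewrite /m normcM normc_real.
apply: le_trans (ler_wpM2r (normr_ge0 _) (base_le x0)) _.
have dn : 0 < d ^+ n by rewrite exprn_gt0.
have nf : 0 < n`!%:R :> R by rewrite ltr0n fact_gt0.
have P : `|x ^+ n / n`!%:R| <= (d ^+ n)^-1 * expR (d * x).
  rewrite ger0_norm ?divr_ge0 ?exprn_ge0// ?ler0n// ler_pdivrMr//.
  rewrite -(ler_pM2l dn) -exprMn mulrA mulrA divff ?mul1r ?gt_eqF// mulrC.
  rewrite [leRHS]mulrC; apply: pow_le_exp; apply: mulr_ge0 => //; exact: ltW.
apply: le_trans (ler_wpM2l _ P) _; first by rewrite mulr_ge0 ?expR_ge0.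
have -> : B * expR (- (4 * d) * x) * ((d ^+ n)^-1 * expR (d * x)) =
    B / d ^+ n * expR (- (3 * d) * x).
  have -> : - (3 * d) * x = - (4 * d) * x + d * x by ring.
  by rewrite expRD; ring.
rewrite ler_wpM2l ?divr_ge0 ?(ltW dn)// ler_expR ler_wpM2r// lerN2.
by rewrite ler_wpM2r ?(ltW d0)// ler_nat.
Qed.

Let ig (k : R) : leb.-integrable halfline (EFin \o (fun x => k * expR (- (2 * d) * x))).
Proof. by apply: integrableZ_R => //; apply: integrable_expR; rewrite mulr_gt0. Qed.

Let fint n h : normc h < d -> cintegrable halfline (f n h).
Proof.
move=> hd.
have [m1 m2] : measurable_fun halfline (fun x => Re (f n h x)) /\
    measurable_fun halfline (fun x => Im (f n h x)).
  apply: ccontinuous_measurable; first exact: mhalf.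
  apply: ccontinuousM; last exact: ccontinuous_cexp_rem.
  by apply: ccontinuousM; [exact/ccontinuous_real/KB.1|exact: ccontinuous_cexp].
apply: cintegrable_dom m1 m2 (ig _) _; first exact: mhalf.
by move=> x; rewrite /= in_itv /= andbT => x0; exact: f_le.
Qed.

Let mint n : cintegrable halfline (m n).
Proof.
have [m1 m2] : measurable_fun halfline (fun x => Re (m n x)) /\
    measurable_fun halfline (fun x => Im (m n x)).
  apply: ccontinuous_measurable; first exact: mhalf.
  apply: ccontinuousM.
    by apply: ccontinuousM; [exact/ccontinuous_real/KB.1|exact: ccontinuous_cexp].
  apply: ccontinuous_real => x; apply: cvgM; last exact: cvg_cst.
  exact: exprn_continuous.
apply: cintegrable_dom m1 m2 (ig _) _; first exact: mhalf.
by move=> x; rewrite /= in_itv /= andbT => x0; exact: m_le.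
Qed.

(** The coefficient of h^n in the expansion of the transform at z - ih. *)
Definition lap_moment n : C := Cintegral halfline (m n).

(** Each step removes one term of the Taylor polynomial under the integral. *)
Let lap_rem n h : normc h < d ->
  lap K (z - 'i%C * h) - \sum_(j < n) h ^+ j * lap_moment j = Cintegral halfline (f n h).
Proof.
move=> hd; elim: n => [|n IH].
  rewrite big_ord0 subr0; apply: eq_Cintegral => x _.
  rewrite /f /= -mulrA -cexpD; congr (_ * cexp _).
  by rewrite -mulrDr; congr (_ * _); rewrite mulrBr mulrA -expr2 sqr_i; ring.
rewrite big_ord_recr /= opprD addrA IH.
rewrite /lap_moment (Cintegral_Zl _ mhalf (mint n)).
rewrite (Cintegral_B mhalf (fint n hd) (cintegrableZ _ mhalf (mint n))).
apply: eq_Cintegral => x _; rewrite /f /m /= mulrBr; congr (_ - _).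
by rewrite exprMn real_expr rmorphM /= fmorphV /= rmorph_nat; ring.
Qed.

(** For n = 2 this is complex differentiability; for all n it is the expansion
used at the centre of the disc. *)
Lemma lap_taylor n : exists k r : R, 0 < r /\ forall h, normc h < r ->
  normc (lap K (z - 'i%C * h) - \sum_(j < n) h ^+ j * lap_moment j) <= k * normc h ^+ n.
Proof.
pose k0 := B * n`!%:R / d ^+ n.
exists (k0 * \int[leb]_(x in halfline) expR (- (2 * d) * x)), d; split => // h hd.
rewrite lap_rem//.
have H : normc (Cintegral halfline (f n h)) <=
    \int[leb]_(x in halfline) (k0 * normc h ^+ n * expR (- (2 * d) * x)).
  apply: normc_Cintegral_le => //; [exact: fint|].
  by move=> x; rewrite /= in_itv /= andbT => x0; exact: f_le.
apply: le_trans H _; rewrite RintegralZl//; last by apply: integrable_expR; rewrite mulr_gt0.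
by rewrite mulrAC.
Qed.

Lemma lap_cintegrable : cintegrable halfline (fun x => (K x)%:C * cexp (x%:C * ('i%C * z))).
Proof.
have := fint 0 (h := 0); rewrite (normc_real 0) normr0 => /(_ d0).
rewrite (_ : f 0 0 = fun x => (K x)%:C * cexp (x%:C * ('i%C * z)))//.
by apply/funext => x; rewrite /f /= mulr0 cexp0 mulr1.
Qed.

Lemma lap_moment_cintegrable n : cintegrable halfline
  (fun x => (K x)%:C * cexp (x%:C * ('i%C * z)) * (x ^+ n / n`!%:R)%:C).
Proof. exact: mint. Qed.

Lemma lap_moment0 : lap_moment 0 = lap K z.
Proof.
by apply: eq_Cintegral => x _; rewrite /m expr0 fact0 divr1 mulr1.
Qed.

Lemma chol_lap : chol (lap K) z.
Proof.
apply/cholP; exists ('i%C * lap_moment 1) => e e0.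
have [k [r [r0 H]]] := lap_taylor 2.
exists (Num.min r (e / (`|k| + 1))); first by rewrite lt_min r0 divr_gt0// ltr_wpDl.
move=> h; rewrite lt_min => /andP[hr he].
have nih : normc ('i%C * h) = normc h by rewrite normcM normc_i mul1r.
have := H ('i%C * h); rewrite nih => /(_ hr).
have -> : z - 'i%C * ('i%C * h) = z + h by rewrite mulrA -expr2 sqr_i; ring.
rewrite !big_ord_recl big_ord0 addr0 /= expr0 expr1 mul1r lap_moment0 opprD addrA.
have -> : 'i%C * lap_moment 1 * h = 'i%C * h * lap_moment 1 by ring.
move=> {}H; apply: le_trans H _.
rewrite expr2 mulrA ler_wpM2r ?normc_ge0//.
move: he; rewrite ltr_pdivlMr ?ltr_wpDl// => /ltW; apply: le_trans.
rewrite mulrC ler_wpM2l ?normc_ge0//.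
by apply: le_trans (ler_norm _) _; rewrite lerDl.
Qed.

End bounds.

(** The weight is the Poisson probability of n for the parameter Yx. *)
Definition poisson_moment K (Y : R) n : R :=
  \int[leb]_(x in halfline) (K x * (expR (- Y * x) * ((Y * x) ^+ n / n`!%:R))).

Section moments.
Variables (K : R -> R) (c B Y : R).
Hypotheses (KB : exp_growth K c B) (cY : c < Y) (Y0 : 0 < Y).

Let kernel_real j x :
  (K x)%:C * cexp (x%:C * ('i%C * (0 +i* Y))) * (x ^+ j / j`!%:R)%:C =
  ((Y ^+ j)^-1 * (K x * (expR (- Y * x) * ((Y * x) ^+ j / j`!%:R))))%:C.
Proof.
have e1 : cexp (x%:C * ('i%C * (0 +i* Y))) = (expR (- Y * x))%:C.
  rewrite -cexp_real; congr cexp.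
  by apply: complex_eq; rewrite ?(cReM, cImM) /=; ring.
rewrite e1 -!rmorphM /=; congr (_%:C).
have Yj : Y ^+ j != 0 by rewrite expf_neq0// gt_eqF.
have fj : j`!%:R != 0 :> R by rewrite pnatr_eq0 -lt0n fact_gt0.
by rewrite exprMn; field; rewrite Yj fj.
Qed.

Lemma poisson_moment_integrable j : leb.-integrable halfline
  (EFin \o (fun x => K x * (expR (- Y * x) * ((Y * x) ^+ j / j`!%:R)))).
Proof.
have mh : measurable (halfline : set (measurableTypeR R)) by exact: measurable_itv.
have [H _] := lap_moment_cintegrable KB (z := 0 +i* Y) cY j.
have := integrableZ_R (Y ^+ j) mh H.
rewrite (_ : (fun x => Y ^+ j * _) =
  (fun x => K x * (expR (- Y * x) * ((Y * x) ^+ j / j`!%:R))))//.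
apply/funext => x; rewrite kernel_real /=.
by rewrite mulVKf// expf_neq0// gt_eqF.
Qed.

(** The expansion of the transform at iY, in the coordinate w of the disc. *)
Lemma lap_taylor_at0 :
  taylor_at0 (fun w => lap K ((0 +i* Y) * (1 - w))) (poisson_moment K Y).
Proof.
move=> N; have [k [r [r0 H]]] := lap_taylor KB (z := 0 +i* Y) cY N.
exists (k * Y ^+ N), (r / Y); split; first by rewrite divr_gt0.
move=> w; rewrite ltr_pdivlMr// => wr.
have nYw : normc (Y%:C * w) = Y * normc w.
  by rewrite normcM normc_real gtr0_norm.
have := H (Y%:C * w); rewrite nYw mulrC => /(_ wr).
have -> : (0 +i* Y) - 'i%C * (Y%:C * w) = (0 +i* Y) * (1 - w).
  have -> : 0 +i* Y = 'i%C * Y%:C by apply: complex_eq; rewrite ?(cReM, cImM) /=; ring.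
  ring.
rewrite [normc w * Y]mulrC exprMn mulrA.
have -> : \sum_(j < N) (Y%:C * w) ^+ j * lap_moment K (0 +i* Y) j =
    \sum_(j < N) (poisson_moment K Y j)%:C * w ^+ j.
  apply: eq_bigr => j _.
  have Yj : Y ^+ j != 0 by rewrite expf_neq0// gt_eqF.
  have mE : (Y ^+ j)%:C * lap_moment K (0 +i* Y) j = (poisson_moment K Y j)%:C.
    rewrite /lap_moment /poisson_moment.
    have -> : Cintegral halfline (fun x => (K x)%:C * cexp (x%:C * ('i%C * (0 +i* Y)))
        * (x ^+ j / j`!%:R)%:C) = ((Y ^+ j)^-1 * poisson_moment K Y j)%:C.
      rewrite (eq_Cintegral (fun x _ => kernel_real j x)).
      apply: complex_eq => /=.
        by rewrite -RintegralZl//; exact: poisson_moment_integrable.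
      by rewrite Rintegral_cst ?mul0r//; exact: measurable_itv.
    by rewrite -rmorphM /= mulVKf.
  by rewrite exprMn real_expr mulrAC mE.
by [].
Qed.

End moments.

End lap.

(** * Poisson averages *)

Section poisson_lln.
Context (R : realType).
Implicit Types (x y e k t : R) (n m N M : nat).

Definition pois y m : R := expR (- y) * (y ^+ m / m`!%:R).

Lemma pois_ge0 y m : 0 <= y -> 0 <= pois y m.
Proof.
move=> y0; rewrite mulr_ge0 ?expR_ge0// divr_ge0 ?exprn_ge0// ler0n.
Qed.

Definition pexp y M : R := \sum_(m < M) y ^+ m / m`!%:R.

Lemma pexpE y M : pexp y M = series (exp_coeff y) M.
Proof. by rewrite /series /= big_mkord. Qed.

Lemma pexp_cvg y : pexp y M @[M --> \oo] --> expR y.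
Proof.
rewrite (_ : pexp y = series (exp_coeff y)); last by apply/funext => M; exact: pexpE.
exact: is_cvg_series_exp_coeff.
Qed.

Lemma pexp_le y M : 0 <= y -> pexp y M <= expR y.
Proof.
move=> y0; have nd : nondecreasing_seq (pexp y).
  apply/nondecreasing_seqP => m; rewrite /pexp big_ord_recr /= lerDl.
  by rewrite divr_ge0 ?exprn_ge0// ler0n.
have cv := @pexp_cvg y.
have <- : limn (pexp y) = expR y by exact/cvg_lim.
apply: nondecreasing_cvgn_le => //; exact: (cvgP _ cv).
Qed.

Lemma pois_sum y M : \sum_(m < M) pois y m = expR (- y) * pexp y M.
Proof. by rewrite /pexp mulr_sumr. Qed.

Lemma pois_sum_cvg y : \sum_(m < M) pois y m @[M --> \oo] --> (1 : R).
Proof.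
rewrite (_ : (fun M => _) = (fun M => expR (- y) * pexp y M)); last first.
  by apply/funext => M; exact: pois_sum.
rewrite -[X in _ --> X](expRxMexpNx_1 y) mulrC.
by apply: cvgM; [exact: cvg_cst|exact: pexp_cvg].
Qed.

Lemma pois_cvg0 y : pois y M @[M --> \oo] --> (0 : R).
Proof.
rewrite (_ : pois y = (fun M => \sum_(m < M.+1) pois y m - \sum_(m < M) pois y m)).
  rewrite -[X in _ --> X](subrr (1 : R)); apply: cvgB; last exact: pois_sum_cvg.
  by have := @pois_sum_cvg y; rewrite -cvg_shiftS.
by apply/funext => M; rewrite big_ord_recr /= addrAC subrr add0r.
Qed.

(** The second centred moment of the Poisson law, truncated: the corrections are
boundary terms of the telescoping sum and disappear in the limit. *)
Lemma pexp_moments y M : \sum_(m < M.+2) (m%:R - y) ^+ 2 * (y ^+ m / m`!%:R) =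
  y * pexp y M.+1 + y ^+ 2 * (y ^+ M.+1 / M.+1`!%:R - y ^+ M / M`!%:R).
Proof.
elim: M => [|M IH].
  rewrite /pexp !big_ord_recr !big_ord0 /= fact0 (_ : 1`! = 1)%N// !divr1.
  by rewrite expr0 expr1; ring.
have pS : pexp y M.+2 = pexp y M.+1 + y ^+ M.+1 / M.+1`!%:R.
  by rewrite /pexp big_ord_recr.
rewrite pS big_ord_recr /= IH.
have fS n : n.+1`!%:R = n.+1%:R * n`!%:R :> R by rewrite factS natrM.
have f0 : M`!%:R != 0 :> R by rewrite pnatr_eq0 -lt0n fact_gt0.
have s1 : M.+1%:R != 0 :> R by rewrite pnatr_eq0.
have s2 : M.+2%:R != 0 :> R by rewrite pnatr_eq0.
rewrite !fS !exprS.
move: (pexp y M.+1) (y ^+ M) => P Q.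
have -> : M.+2%:R = M.+1%:R + 1 :> R by rewrite natr1.
move: s1 s2 f0; have -> : M.+2%:R = M.+1%:R + 1 :> R by rewrite natr1.
move: (M.+1%:R : R) (M`!%:R : R) => a f a0 a1 f0.
by field; rewrite a0 f0 a1.
Qed.

Lemma pois_variance y M : 0 <= y ->
  \sum_(m < M.+2) (m%:R - y) ^+ 2 * pois y m <= y + y ^+ 2 * pois y M.+1.
Proof.
move=> y0.
have -> : \sum_(m < M.+2) (m%:R - y) ^+ 2 * pois y m =
    expR (- y) * \sum_(m < M.+2) (m%:R - y) ^+ 2 * (y ^+ m / m`!%:R).
  by rewrite mulr_sumr; apply: eq_bigr => m _; rewrite /pois; ring.
rewrite pexp_moments mulrDr; apply: lerD.
  rewrite mulrCA ler_piMr// -(expRxMexpNx_1 y) mulrC ler_wpM2r ?expR_ge0//.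
  exact: pexp_le.
rewrite mulrCA ler_wpM2l ?sqr_ge0// /pois ler_wpM2l ?expR_ge0// gerBl.
by rewrite divr_ge0 ?exprn_ge0// ler0n.
Qed.

(** Chebyshev's argument: a deviation growing quadratically away from the mean is
averaged to the variance, which equals y. *)
Lemma poisson_average (f : nat -> R) n y L e k D : 0 <= y -> 0 < D -> 0 <= k -> 0 <= e ->
  (forall m, (n < m)%N -> f m = 0) ->
  (forall m, `|f m - L| <= e + k * ((m%:R - y) ^+ 2 / D ^+ 2)) ->
  `|\sum_(m < n.+1) f m * pois y m - L| <= e + k * (y / D ^+ 2).
Proof.
move=> y0 D0 k0 e0 fn fL.
set A := \sum_(m < n.+1) _.
have bound M : (n <= M)%N -> `|A - L| <=
    e + k * ((y + y ^+ 2 * pois y M.+1) / D ^+ 2) + `|L| * (1 - \sum_(m < M.+2) pois y m).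
  move=> nM.
  have AE : A = \sum_(m < M.+2) f m * pois y m.
    have nM2 : (n.+1 <= M.+2)%N by rewrite ltnS (leq_trans nM).
    rewrite /A (big_ord_widen _ (fun m => f m * pois y m) nM2) big_mkcond.
    apply: eq_bigr => m _; case: ifP => // /negbT; rewrite -leqNgt => /fn ->.
    by rewrite mul0r.
  have S1 : \sum_(m < M.+2) pois y m <= 1.
    rewrite pois_sum -(expRxMexpNx_1 y) mulrC ler_wpM2r ?expR_ge0//.
    exact: pexp_le.
  have -> : A - L = \sum_(m < M.+2) (f m - L) * pois y m - L * (1 - \sum_(m < M.+2) pois y m).
    under eq_bigr do rewrite mulrBl.
    by rewrite sumrB -AE -mulr_sumr; ring.
  apply: le_trans (ler_normB _ _) _; rewrite normrM [X in _ + _ * X]ger0_norm ?subr_ge0//.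
  rewrite lerD2r; apply: le_trans (ler_norm_sum _ _ _) _.
  apply: le_trans (_ : \sum_(m < M.+2) (e * pois y m +
     k / D ^+ 2 * ((m%:R - y) ^+ 2 * pois y m)) <= _).
    apply: ler_sum => m _; rewrite normrM (ger0_norm (pois_ge0 m y0)).
    apply: le_trans (ler_wpM2r (pois_ge0 m y0) (fL m)) _.
    by rewrite le_eqVlt; apply/orP; left; apply/eqP; ring.
  rewrite big_split /= -mulr_sumr -[X in _ + X <= _]mulr_sumr.
  apply: lerD; first by rewrite ler_piMr.
  rewrite -mulrA [X in k * X]mulrC; apply: ler_wpM2l => //.
  by rewrite ler_wpM2r ?invr_ge0 ?sqr_ge0// pois_variance.
have c1 : e + k * ((y + y ^+ 2 * pois y M.+1) / D ^+ 2) +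
    `|L| * (1 - \sum_(m < M.+2) pois y m) @[M --> \oo] -->
    e + k * ((y + y ^+ 2 * 0) / D ^+ 2) + `|L| * (1 - 1).
  apply: cvgD.
    apply: cvgD; first exact: cvg_cst.
    apply: cvgM; first exact: cvg_cst.
    apply: cvgM; last exact: cvg_cst.
    apply: cvgD; first exact: cvg_cst.
    apply: cvgM; first exact: cvg_cst.
    by have := @pois_cvg0 y; rewrite -cvg_shiftS.
  apply: cvgM; first exact: cvg_cst.
  apply: cvgB; first exact: cvg_cst.
  by have := @pois_sum_cvg y; rewrite -cvg_shiftS -cvg_shiftS.
rewrite subrr !mulr0 !addr0 in c1.
apply: (ler_cvg_to (cvg_cst `|A - L|) c1).
by exists n => // M /= /bound.
Qed.

(** Chernoff's bound for the lower tail: 1 <= s^(m - n) for m <= n. *)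
Lemma pois_tail y n s : 0 <= y -> 0 < s -> s <= 1 ->
  \sum_(m < n.+1) pois y m <= s ^- n * expR (- ((1 - s) * y)).
Proof.
move=> y0 s0 s1.
have sn : 0 < s ^+ n by rewrite exprn_gt0.
apply: le_trans (_ : expR (- y) * (s ^- n * pexp (s * y) n.+1) <= _).
  rewrite pois_sum ler_wpM2l ?expR_ge0// /pexp mulr_sumr; apply: ler_sum => m _.
  have -> : s ^- n * ((s * y) ^+ m / m`!%:R) = (s ^+ m / s ^+ n) * (y ^+ m / m`!%:R).
    by rewrite exprMn; ring.
  apply: ler_peMl; first by rewrite divr_ge0 ?exprn_ge0// ler0n.
  have mn : (m <= n)%N by rewrite -ltnS.
  rewrite ler_pdivlMr// mul1r; by rewrite ler_wiXn2l ?(ltW s0).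
rewrite mulrCA ler_wpM2l ?invr_ge0 ?(ltW sn)//.
have -> : expR (- ((1 - s) * y)) = expR (- y) * expR (s * y).
  by rewrite -expRD; congr expR; ring.
by rewrite ler_wpM2l ?expR_ge0// pexp_le// mulr_ge0// ltW.
Qed.

Lemma power_exp_bound t n : 0 <= t -> t <= 2^-1 -> (1 - t) ^- n <= expR (2 * n%:R * t).
Proof.
move=> t0 t1.
have p0 : 0 < 1 - t by lra.
rewrite -exprVn (_ : 2 * n%:R * t = n%:R * (2 * t)); last by ring.
rewrite expRM_natl; apply: lerXn2r; rewrite ?nnegrE ?expR_ge0 ?invr_ge0 ?(ltW p0)//.
rewrite -[leLHS]mul1r ler_pdivrMr//.
have := @expR_ge1Dx R (2 * t); nra.
Qed.

End poisson_lln.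

(** * From Taylor coefficients to convolutions *)

Section postwidder.
Context (R : realType).
Local Notation leb := (@lebesgue_measure R).
Implicit Types (x y r e : R) (n m N : nat).
Local Notation halfline := (`[0, +oo[%classic : set R).

(** The convolution of K and h on the half-line, at r. The cut-off x < r makes
only the values of h on (0, oo) count, so that h may be any continuous
extension. *)
Definition volterra (K h : R -> R) r : R :=
  \int[leb]_(x in halfline) (K x * (if x < r then h (r - x) else 0)).

(** The mean of h((n - m)/Y) for m Poisson distributed with parameter Yx, where h
is cut off to nonnegative arguments. *)
Definition szasz (h : R -> R) (Y : R) n x : R :=
  \sum_(m < n.+1) h ((n - m)%:R / Y) * pois (Y * x) m.

(** Row n of the Toeplitz matrix of the Poisson moments applied to the samples
of h with mesh 1/Y. *)
Definition dconv (K h : R -> R) (Y : R) n : R :=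
  \sum_(m < n.+1) h ((n - m)%:R / Y) * poisson_moment K Y m.

Lemma truncn_near r Y : 0 <= r -> 0 < Y ->
  (Num.truncn (r * Y))%:R / Y <= r /\ r - Y^-1 < (Num.truncn (r * Y))%:R / Y.
Proof.
move=> r0 Y0; have := truncn_itv (mulr_ge0 r0 (ltW Y0)) => /andP[h1 h2].
split; first by rewrite ler_pdivrMr.
rewrite ltrBlDr -{2}[Y^-1]mul1r -mulrDl natr1.
by rewrite ltr_pdivlMr.
Qed.

(** As Y grows, m/Y concentrates at x, so (n - m)/Y tends to r - x when
n = floor(rY); if x > r the cut-off leaves nothing. *)
Lemma szasz_cvg (h : R -> R) X Bh r x : continuous h ->
  (forall s : R, 0 <= s <= X -> `|h s| <= Bh) -> 0 <= r -> r < X -> 0 <= x -> x != r ->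
  forall e, 0 < e -> exists Y0 : R, forall Y, Y0 <= Y ->
    `|szasz h Y (Num.truncn (r * Y)) x - (if x < r then h (r - x) else 0)| < e.
Proof.
move=> ch hB r0 rX x0 xr e e0.
set L := (if x < r then h (r - x) else 0).
have Bh0 : 0 <= Bh by apply: le_trans (normr_ge0 _) (hB 0 _); rewrite lexx (le_trans r0 (ltW rX)).
have LB : `|L| <= Bh.
  rewrite /L; case: ltP => [lt|_]; last by rewrite normr0.
  by apply: hB; lra.
have [d d0 [d1 d2]] : exists2 d, 0 < d &
    (x < r -> 2 * d <= r - x /\ forall s, `|s - (r - x)| < 2 * d -> `|h s - h (r - x)| < e / 2)
    /\ (r < x -> d <= x - r).
  case: (ltgtP x r) xr => // [lt|gt] _.
    have [d0 d00 dP] := (cont_epsP h (r - x)).1 (ch _) (e / 2) ltac:(lra).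
    exists (Num.min (d0 / 2) ((r - x) / 2)).
      by rewrite lt_min !divr_gt0// subr_gt0.
    have h1 : Num.min (d0 / 2) ((r - x) / 2) <= d0 / 2 by rewrite ge_min lexx.
    have h2 : Num.min (d0 / 2) ((r - x) / 2) <= (r - x) / 2 by rewrite ge_min lexx orbT.
    split => // _; split; first by lra.
    by move=> s hs; apply: dP; lra.
  by exists (x - r); [rewrite subr_gt0|split].
pose k := 2 * Bh; have k0 : 0 <= k by rewrite mulr_ge0.
exists (d^-1 + 2 * k * x / (e * d ^+ 2) + 1) => Y YY.
have q1 : 0 < d^-1 by rewrite invr_gt0.
have q2 : 0 <= 2 * k * x / (e * d ^+ 2).
  by apply: divr_ge0; rewrite !mulr_ge0// ?ltW// exprn_gt0.
have Y0 : 0 < Y by lra.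
have Yd : Y^-1 < d by rewrite invf_plt ?posrE//; lra.
have [n1 n2] := truncn_near r0 Y0.
set n := Num.truncn (r * Y) in n1 n2 *.
pose f m := if (m <= n)%N then h ((n - m)%:R / Y) else 0.
have -> : szasz h Y n x = \sum_(m < n.+1) f m * pois (Y * x) m.
  by apply: eq_bigr => m _; rewrite /f -ltnS ltn_ord.
have nm m : (m <= n)%N -> (n - m)%:R / Y = n%:R / Y - m%:R / Y :> R.
  by move=> mn; rewrite natrB// mulrBl.
have fB m : `|f m| <= Bh.
  rewrite /f; case: ifP => [mn|_]; last by rewrite normr0.
  apply: hB; rewrite divr_ge0 ?(ltW Y0)//= nm//.
  have : 0 <= m%:R / Y by rewrite divr_ge0 ?(ltW Y0).
  by lra.
have dY : 0 < Y * d by rewrite mulr_gt0.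
have yx0 : 0 <= Y * x by rewrite mulr_ge0 ?(ltW Y0).
apply: le_lt_trans (@poisson_average R f n (Y * x) L (e / 2) k (Y * d) yx0 dY k0 _ _ _) _.
- by lra.
- by move=> m nm'; rewrite /f leqNgt nm'.
- move=> m; have [far|near] := leP d `|m%:R / Y - x|.
    apply: le_trans (_ : k * 1 <= _).
      rewrite mulr1 /k; apply: le_trans (ler_normB _ _) _.
      by have := fB m; lra.
    apply: le_trans (_ : k * ((m%:R - Y * x) ^+ 2 / (Y * d) ^+ 2) <= _); last by lra.
    apply: ler_wpM2l => //; rewrite ler_pdivlMr ?exprn_gt0// mul1r.
    rewrite -[leRHS]real_normK ?num_real//; apply: lerXn2r; rewrite ?nnegrE ?(ltW dY)//.
    have -> : m%:R - Y * x = Y * (m%:R / Y - x) by field; rewrite gt_eqF.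
    by rewrite normrM (gtr0_norm Y0) ler_pM2l.
  have kk : 0 <= k * ((m%:R - Y * x) ^+ 2 / (Y * d) ^+ 2).
    by rewrite mulr_ge0// divr_ge0 ?sqr_ge0.
  suff : `|f m - L| <= e / 2 by lra.
  move: near; rewrite ltr_norml => /andP[nr1 nr2].
  rewrite /f /L; case: (ltgtP x r) xr => // [lt|gt] _.
    have [d3 d4] := d1 lt.
    have mn : (m <= n)%N.
      rewrite -(ler_nat R) -(ler_pM2r (_ : 0 < Y^-1)) ?invr_gt0//; lra.
    rewrite mn nm//; apply/ltW/d4; rewrite ltr_norml; lra.
  have d5 := d2 gt.
  have -> : (m <= n)%N = false.
    apply/negbTE; rewrite -ltnNge -(ltr_nat R) -(ltr_pM2r (_ : 0 < Y^-1)) ?invr_gt0//; lra.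
  by rewrite subrr normr0; lra.
have -> : k * (Y * x / (Y * d) ^+ 2) = k * x / d ^+ 2 / Y.
  by field; rewrite !gt_eqF.
have : k * x / d ^+ 2 / Y < e / 2.
  rewrite ltr_pdivrMr//.
  have -> : k * x / d ^+ 2 = e / 2 * (2 * k * x / (e * d ^+ 2)).
    by field; rewrite !gt_eqF.
  by rewrite ltr_pM2l; lra.
lra.
Qed.

(** The sum runs over m <= n <= XY, which for large x is far below the mean Yx:
the lower tail gives an exponential decay in x at any rate a, uniformly in Y.
This dominates the exponential growth of K. *)
Lemma szasz_bound (h : R -> R) X Bh a Y n x :
  (forall s : R, 0 <= s <= X -> `|h s| <= Bh) -> 0 <= X -> 0 < a -> 2 * a <= Y ->
  n%:R <= X * Y -> 0 <= x ->
  `|szasz h Y n x| <= Bh * (expR (2 * a * X) * expR (- a * x)).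
Proof.
move=> hB X0 a0 aY nX x0.
have Y0 : 0 < Y by lra.
have Bh0 : 0 <= Bh by apply: le_trans (normr_ge0 _) (hB 0 _); rewrite lexx.
have yx0 : 0 <= Y * x by rewrite mulr_ge0 ?(ltW Y0).
pose s := 1 - a / Y.
have t0 : 0 <= a / Y by rewrite divr_ge0 ?ltW.
have t1 : a / Y <= 2^-1 by rewrite ler_pdivrMr//; lra.
have s0 : 0 < s by rewrite /s; lra.
have s1 : s <= 1 by rewrite /s; lra.
apply: le_trans (ler_norm_sum _ _ _) _.
apply: le_trans (_ : \sum_(m < n.+1) Bh * pois (Y * x) m <= _).
  apply: ler_sum => m _; rewrite normrM (ger0_norm (pois_ge0 m yx0)).
  apply: ler_wpM2r; first exact: pois_ge0.
  apply: hB; rewrite divr_ge0 ?(ltW Y0)//= ler_pdivrMr//.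
  by apply: le_trans nX; rewrite ler_nat leq_subr.
rewrite -mulr_sumr ler_wpM2l//.
apply: le_trans (pois_tail n yx0 s0 s1) _.
have -> : - ((1 - s) * (Y * x)) = - a * x by rewrite /s; field; rewrite gt_eqF.
rewrite ler_wpM2r ?expR_ge0//; apply: le_trans (power_exp_bound n t0 t1) _.
rewrite ler_expR.
have nY : n%:R / Y <= X by rewrite ler_pdivrMr.
have -> : 2 * n%:R * (a / Y) = 2 * a * (n%:R / Y) by ring.
by rewrite ler_pM2l// mulr_gt0.
Qed.

Lemma rate_gt (c Y : R) : 0 < c -> 2 * (c + 1) <= Y -> c < Y /\ 0 < Y.
Proof. by move=> c0 cY; split; lra. Qed.

Section limit.
Variables (K : R -> R) (c B : R) (h : R -> R) (X Bh : R).
Hypotheses (KB : exp_growth K c B) (c0 : 0 < c) (ch : continuous h).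
Hypotheses (X0 : 0 < X) (hB : forall s : R, 0 <= s <= X -> `|h s| <= Bh).

(* The decay rate c + 1 beats the growth rate c of K and leaves e^(-x). *)
Let a := c + 1.
Let a0 : 0 < a. Proof. by rewrite addr_gt0. Qed.
Let mhalf : measurable (halfline : set (measurableTypeR R)).
Proof. exact: measurable_itv. Qed.

Let dom x := B * Bh * expR (2 * a * X) * expR (- 1 * x).

Let dom_int : leb.-integrable halfline (EFin \o dom).
Proof. by apply: integrableZ_R => //; exact: integrable_expR. Qed.

Let B0 : 0 <= B.
Proof.
have := KB.2 0 (lexx 0); rewrite mulr0 expR0 mulr1.
exact: le_trans.
Qed.

Let Bh0 : 0 <= Bh.
Proof. by apply: le_trans (normr_ge0 _) (@hB 0 _); rewrite lexx ltW. Qed.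

Let dom_le Y n x : 2 * a <= Y -> n%:R <= X * Y -> 0 <= x ->
  `|K x * szasz h Y n x| <= dom x.
Proof.
move=> aY nX x0; rewrite normrM.
apply: le_trans (ler_pM (normr_ge0 _) (normr_ge0 _) (KB.2 x x0)
  (szasz_bound hB (ltW X0) a0 aY nX x0)) _.
have -> : dom x = B * expR (c * x) * (Bh * (expR (2 * a * X) * expR (- a * x))).
  have -> : - a * x = - 1 * x - c * x by rewrite /a; ring.
  have E : expR (- 1 * x) = expR (c * x) * expR (- 1 * x - c * x).
    by rewrite -expRD; congr expR; ring.
  by rewrite /dom E; ring.
by [].
Qed.

Let pois_cont Y m : continuous (fun x => pois (Y * x) m).
Proof.
move=> x; apply: cvgM.
  apply: continuous_comp; last exact: continuous_expR.
  by apply: cvgN; apply: cvgM; [exact: cvg_cst|exact: cvg_id].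
apply: cvgM; last exact: cvg_cst.
apply: (@continuous_comp _ _ _ (fun x => Y * x) (fun y => y ^+ m)).
  by apply: cvgM; [exact: cvg_cst|exact: cvg_id].
exact: exprn_continuous.
Qed.

Let szasz_cont Y n : continuous (szasz h Y n).
Proof.
have H N : continuous (fun x => \sum_(m < N) h ((n - m)%:R / Y) * pois (Y * x) m).
  elim: N => [|N IH] x.
    by under eq_fun do rewrite big_ord0; exact: cvg_cst.
  under eq_fun do rewrite big_ord_recr /=.
  apply: cvgD; first exact: IH.
  by apply: cvgM; [exact: cvg_cst|exact: pois_cont].
exact: H.
Qed.

Let meas Y n : measurable_fun halfline (fun x => K x * szasz h Y n x).
Proof.
apply: measurable_funTS; apply: continuous_measurable_fun => x.
by apply: cvgM; [exact: KB.1|exact: szasz_cont].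
Qed.

Let poisE Y x m : expR (- Y * x) * ((Y * x) ^+ m / m`!%:R) = pois (Y * x) m.
Proof. by rewrite /pois mulNr. Qed.

Lemma dconvE Y n : 2 * a <= Y -> n%:R <= X * Y ->
  dconv K h Y n = \int[leb]_(x in halfline) (K x * szasz h Y n x).
Proof.
move=> aY nX; have [cY Y0] := rate_gt c0 aY.
have pint m := poisson_moment_integrable KB cY Y0 m.
have E : forall N (k : nat), leb.-integrable halfline
   (EFin \o (fun x => K x * \sum_(m < N) h ((k - m)%:R / Y) * pois (Y * x) m)) /\
   \sum_(m < N) h ((k - m)%:R / Y) * poisson_moment K Y m =
   \int[leb]_(x in halfline) (K x * \sum_(m < N) h ((k - m)%:R / Y) * pois (Y * x) m).
  elim=> [|N IH] k.
    rewrite big_ord0 (_ : (fun x => _) = fun=> 0); last first.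
      by apply/funext => x; rewrite big_ord0 mulr0.
    split; first exact: integrable0.
    by rewrite Rintegral_cst ?mul0r.
  have [I1 I2] := IH k.
  have J : leb.-integrable halfline (EFin \o (fun x => h ((k - N)%:R / Y) *
      (K x * (expR (- Y * x) * ((Y * x) ^+ N / N`!%:R))))).
    exact: integrableZ_R.
  have -> : (fun x => K x * \sum_(m < N.+1) h ((k - m)%:R / Y) * pois (Y * x) m) =
     (fun x => K x * \sum_(m < N) h ((k - m)%:R / Y) * pois (Y * x) m +
       h ((k - N)%:R / Y) * (K x * (expR (- Y * x) * ((Y * x) ^+ N / N`!%:R)))).
    by apply/funext => x; rewrite big_ord_recr /= poisE; ring.
  split; first exact: integrableD_R.
  by rewrite big_ord_recr /= I2 RintegralD// RintegralZl.
exact: (E n.+1 n).2.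
Qed.

Lemma dconv_bound : exists2 M, 0 <= M &
  forall Y n, 2 * a <= Y -> n%:R <= X * Y -> `|dconv K h Y n| <= M.
Proof.
exists (\int[leb]_(x in halfline) dom x).
  apply: Rintegral_ge0 => x _.
  by rewrite /dom !mulr_ge0 ?expR_ge0.
move=> Y n aY nX; rewrite dconvE//.
have fi : leb.-integrable halfline (EFin \o (fun x => K x * szasz h Y n x)).
  apply: integrable_dom (meas Y n) dom_int _ => //.
  by move=> x; rewrite /= in_itv /= andbT => x0; exact: dom_le.
apply: le_trans (le_normr_Rintegral _ fi) _ => //.
apply: le_Rintegral => //.
  by have := integrable_norm fi.
by move=> x; rewrite /= in_itv /= andbT => x0; exact: dom_le.
Qed.

(** Dominated convergence in the integral over x of K(x) times the Poisson mean;
the null set excluded is the jump of the cut-off at x = r. *)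
Lemma dconv_cvg (Y : nat -> R) r : (forall j, 2 * a <= Y j) ->
  (forall y, exists J, forall j, (J <= j)%N -> y <= Y j) -> 0 <= r -> r < X ->
  dconv K h (Y j) (Num.truncn (r * Y j)) @[j --> \oo] --> volterra K h r.
Proof.
move=> aY Yoo r0 rX.
have Y0 j : 0 < Y j by have [] := rate_gt c0 (aY j).
have nX j : (Num.truncn (r * Y j))%:R <= X * Y j.
  have /andP[h1 _] := truncn_itv (mulr_ge0 r0 (ltW (Y0 j))).
  by apply: le_trans h1 _; rewrite ler_pM2r// ltW.
rewrite (_ : (fun j => _) = (fun j => \int[leb]_(x in halfline)
   (K x * szasz h (Y j) (Num.truncn (r * Y j)) x))); last first.
  by apply/funext => j; rewrite dconvE.
apply: (@Rdominated R halfline _ _ dom mhalf _ _ _ dom_int _).2.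
- by move=> j; exact: meas.
- apply: measurable_funM.
    by apply: measurable_funTS; apply: continuous_measurable_fun; exact: KB.1.
  rewrite (_ : (fun x => _) = (fun x => \1_(`]-oo, r[%classic : set R) x * h (r - x))).
    apply: measurable_funM; first exact: measurable_indic.
    apply: measurable_funTS; apply: continuous_measurable_fun => x.
    apply: (@continuous_comp _ _ _ (fun x => r - x) h); last exact: ch.
    by apply: cvgB; [exact: cvg_cst|exact: cvg_id].
  apply/funext => x; rewrite indicE /=; case: ltP => xr.
    by rewrite mem_set ?mul1r//= in_itv.
  by rewrite memNset ?mul0r//= in_itv /=; apply/negP; rewrite -leNgt.
- exists [set r]; split.
  + exact: measurable_set1.
  + exact: lebesgue_measure_set1.
  + move=> x /= nP; apply: contrapT => /eqP xr; apply: nP.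
    rewrite in_itv /= andbT => x0.
    apply: cvgM; first exact: cvg_cst.
    apply/cvgrPdist_lt => e e0.
    have [y1 H] := szasz_cvg ch hB r0 rX x0 xr e0.
    have [J HJ] := Yoo y1.
    by exists J => // j /= /HJ /H; rewrite distrC.
- by move=> j x; rewrite /= in_itv /= andbT => x0; exact: dom_le.
Qed.

End limit.

End postwidder.

(** * Convolution as a contraction *)

Section contraction.
Context (R : realType).
Local Notation leb := (@lebesgue_measure R).
Implicit Types (x y r e X Y c : R) (n m N : nat) (F : nat -> R).
Local Notation halfline := (`[0, +oo[%classic : set R).

Definition cell Y n : set R := [set r | n%:R / Y <= r < n.+1%:R / Y].

Lemma cellE Y n : cell Y n = `[n%:R / Y, n.+1%:R / Y[%classic.
Proof. by apply/seteqP; split => r /=; rewrite in_itv. Qed.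

Definition step F Y N r : R := \sum_(n < N) F n * \1_(cell Y n) r.

Lemma cell_truncn Y n r : 0 < Y -> 0 <= r -> cell Y n r <-> n = Num.truncn (r * Y).
Proof.
move=> Y0 r0; have rY : 0 <= r * Y by rewrite mulr_ge0// ltW.
rewrite /cell /= ler_pdivrMr// ltr_pdivlMr//; split=> [h|->].
  by apply/esym/truncn_def.
exact: truncn_itv.
Qed.

Lemma stepE F Y N r : 0 < Y -> 0 <= r -> r * Y < N%:R ->
  step F Y N r = F (Num.truncn (r * Y)).
Proof.
move=> Y0 r0 rN.
have tN : (Num.truncn (r * Y) < N)%N.
  rewrite -(ltr_nat R); apply: le_lt_trans rN.
  by have /andP[] := truncn_itv (mulr_ge0 r0 (ltW Y0)).
rewrite /step (bigD1 (Ordinal tN))//= indicE mem_set ?mulr1; last first.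
  exact/(cell_truncn _ Y0 r0).
rewrite big1 ?addr0// => n nt; rewrite indicE memNset ?mulr0//.
move=> /(cell_truncn _ Y0 r0) E; move: nt; apply/negP; rewrite negbK.
by apply/eqP/val_inj.
Qed.

Let mX X : measurable (`[0, X[%classic : set (measurableTypeR R)).
Proof. exact: measurable_itv. Qed.

Lemma cell_integrable X Y n k : leb.-integrable `[0, X[ (EFin \o (fun r => k * \1_(cell Y n) r)).
Proof.
apply: integrableZ_R => //.
apply: (@integrable_dom R _ _ (fun=> 1)) => //.
- by rewrite cellE; apply: measurable_indic; exact: measurable_itv.
- have H := @integrable_cst_seg R 0 X 1.
  apply: (@integrableS _ _ R leb `[0, X]) => //.
  by move=> x /=; rewrite !in_itv /= => /andP[-> /ltW ->].
- by move=> x _; rewrite indicE; case: (_ \in _); rewrite ?normr1 ?normr0.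
Qed.

Lemma int_cell X Y n : 0 < Y -> n.+1%:R / Y <= X ->
  \int[leb]_(r in `[0, X[) \1_(cell Y n) r = Y^-1.
Proof.
move=> Y0 nX; rewrite /Rintegral.
have -> : (\int[leb]_(r in `[0%R, X[) (\1_(cell Y n) r)%:E = leb (cell Y n `&` `[0%R, X[))%E.
  by apply: integral_indic => //; rewrite cellE; exact: measurable_itv.
have -> : cell Y n `&` `[0, X[ = `[n%:R / Y, n.+1%:R / Y[%classic.
  rewrite cellE; apply/seteqP; split=> [r []//|r /=]; rewrite !in_itv /= => /andP[r1 r2].
  split; first by rewrite r1 r2.
  by rewrite (lt_le_trans r2 nX) andbT (le_trans _ r1)// divr_ge0// ltW.
have := congr1 fine (lebesgue_measure_itv `[n%:R / Y, n.+1%:R / Y[) => /= ->.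
rewrite lte_fin ltr_pM2r ?invr_gt0// ltr_nat ltnSn /=.
by rewrite -mulrBl -natr1 addrAC subrr add0r mul1r.
Qed.

Lemma int_step F X Y N : 0 < Y -> N%:R / Y <= X ->
  leb.-integrable `[0, X[ (EFin \o step F Y N) /\
  \int[leb]_(r in `[0, X[) step F Y N r = (\sum_(n < N) F n) / Y.
Proof.
move=> Y0; elim: N => [|N IH] NX.
  rewrite big_ord0 mul0r (_ : step F Y 0 = fun=> 0); last first.
    by apply/funext => r; rewrite /step big_ord0.
  by split; [exact: integrable0|rewrite Rintegral_cst ?mul0r].
have NX' : N%:R / Y <= X.
  by apply: le_trans NX; rewrite ler_pM2r ?invr_gt0// ler_nat.
have [I1 I2] := IH NX'.
have -> : step F Y N.+1 = (fun r => step F Y N r + F N * \1_(cell Y N) r).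
  by apply/funext => r; rewrite /step big_ord_recr.
have J := @cell_integrable X Y N (F N).
split; first exact: integrableD_R.
rewrite RintegralD// I2 big_ord_recr /= mulrDl; congr (_ + _).
rewrite RintegralZl ?int_cell//.
have := @cell_integrable X Y N 1.
by rewrite (_ : (fun r => 1 * _) = \1_(cell Y N))//; apply/funext => r; rewrite mul1r.
Qed.

Lemma step_meas F X Y N : 0 < Y -> N%:R / Y <= X -> measurable_fun `[0, X[ (step F Y N).
Proof.
by move=> Y0 NX; have [/integrableP[/measurable_EFinP]] := int_step F Y0 NX.
Qed.

Lemma step_bound F X Y N k : 0 < Y -> N%:R / Y = X -> (forall n, (n < N)%N -> `|F n| <= k) ->
  forall r, `[0, X[%classic r -> `|step F Y N r| <= k.
Proof.
move=> Y0 NX Fk r; rewrite /= in_itv /= => /andP[r0 rX].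
have rN : r * Y < N%:R by rewrite -ltr_pdivlMr// NX.
rewrite stepE//; apply: Fk; rewrite -(ltr_nat R); apply: le_lt_trans rN.
by have /andP[] := truncn_itv (mulr_ge0 r0 (ltW Y0)).
Qed.

Lemma conv_reindex (T : nat -> nat -> R) n N : (n < N)%N ->
  \sum_(k < N | (k <= n)%N) T k (n - k)%N = \sum_(m < n.+1) T (n - m)%N m.
Proof.
move=> nN.
rewrite -(big_ord_widen N (fun k => T k (n - k)%N) nN).
rewrite (reindex_inj rev_ord_inj) /=; apply: eq_bigr => m _.
by rewrite subSS subKn// -ltnS.
Qed.

(** The mesh 1/Y_j = X/N_j divides [0, X) into N_j cells. The matrix inequality
for the samples of h, divided by Y_j, is an inequality between integrals of step
functions; by [dconv_cvg] and the continuity of h these tend to the integrals of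
v^2 and h^2, boundedly. *)
Theorem volterra_contraction (K : R -> R) c B (h v : R -> R) X :
  exp_growth K c B -> 0 < c -> continuous h -> 0 < X -> continuous v ->
  (forall Y, c < Y -> forall (g : nat -> R) N,
    \sum_(n < N) (\sum_(k < N | (k <= n)%N) g k * poisson_moment K Y (n - k)%N) ^+ 2 <=
    \sum_(k < N) g k ^+ 2) ->
  (forall r, 0 <= r < X -> v r = volterra K h r) ->
  \int[leb]_(r in `[0, X[) v r ^+ 2 <= \int[leb]_(r in `[0, X[) h r ^+ 2.
Proof.
move=> KB c0 ch X0 cv ctr vE.
have [Bh Bh0 hB] : exists2 M : R, 0 <= M & forall x, 0 <= x <= X -> `|h x| <= M.
  by apply: cont_on_bounded => x _; exact: ch.
have [M M0 MB] := dconv_bound KB c0 X0 hB.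
(* The offset m makes already the first mesh fine enough for the uniform bounds. *)
pose m := (Num.truncn (2 * (c + 1) * X)).+1.
pose N j := (j + m)%N.
pose Y j : R := (N j)%:R / X.
have N0 j : 0 < (N j)%:R :> R by rewrite ltr0n /N /m addnS.
have Y0 j : 0 < Y j by rewrite divr_gt0.
have NX j : (N j)%:R / Y j = X.
  by rewrite /Y; have := N0 j; move: (_%:R) => n n0; field; rewrite !gt_eqF.
have XY j : X * Y j = (N j)%:R by rewrite /Y mulrC divfK// gt_eqF.
have aY j : 2 * (c + 1) <= Y j.
  rewrite ler_pdivlMr//; apply: ltW.
  have q0 : 0 <= 2 * (c + 1) * X by rewrite !mulr_ge0 ?ltW// addr_gt0.
  have /andP[_ h2] := truncn_itv q0; apply: lt_le_trans h2 _.
  by rewrite ler_nat /N leq_addl.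
have Yoo y : exists J, forall j, (J <= j)%N -> y <= Y j.
  have q0 : 0 <= `|y| * X by rewrite mulr_ge0// ltW.
  exists (Num.truncn (`|y| * X)).+1 => j Jj; apply: le_trans (ler_norm y) _.
  rewrite ler_pdivlMr//; have /andP[_ h2] := truncn_itv q0.
  apply: le_trans (ltW h2) _; rewrite ler_nat /N; apply: leq_trans Jj _.
  exact: leq_addr.
have NXle j : (N j)%:R / Y j <= X by rewrite NX.
pose d j n := dconv K h (Y j) n.
have nXY j n : (n < N j)%N -> n%:R <= X * Y j by move=> nN; rewrite XY ler_nat ltnW.
have key j : \sum_(n < N j) d j n ^+ 2 <= \sum_(k < N j) h (k%:R / Y j) ^+ 2.
  have [cY _] := rate_gt c0 (aY j).
  apply: le_trans (ctr _ cY (fun k => h (k%:R / Y j)) (N j)).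
  apply: ler_sum => n _.
  by rewrite (conv_reindex (fun k l => h (k%:R / Y j) * poisson_moment K (Y j) l)).
have cst_int k : leb.-integrable `[0, X[ (EFin \o (fun=> k : R)).
  have H := @integrable_cst_seg R 0 X k.
  apply: (@integrableS _ _ R leb `[0, X]) => //.
  by move=> x /=; rewrite !in_itv /= => /andP[-> /ltW ->].
have sq_meas (f : R -> R) : continuous f -> measurable_fun `[0, X[ (fun r => f r ^+ 2).
  move=> cf; apply: measurable_funTS; apply: continuous_measurable_fun => x.
  apply: (@continuous_comp _ _ _ f (fun y => y ^+ 2)); first exact: cf.
  exact: exprn_continuous.
have conv (F : nat -> nat -> R) (f : R -> R) k :
    (forall j n, (n < N j)%N -> `|F j n| <= k) -> continuous f ->
    (forall r, 0 <= r -> r < X -> F j (Num.truncn (r * Y j)) @[j --> \oo] --> f r) ->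
    (\sum_(n < N j) F j n ^+ 2) / Y j @[j --> \oo] --> \int[leb]_(r in `[0, X[) f r ^+ 2.
  move=> Fk cf Ff.
  rewrite (_ : (fun j => _) = (fun j => \int[leb]_(r in `[0, X[)
     step (fun n => F j n ^+ 2) (Y j) (N j) r)); last first.
    by apply/funext => j; rewrite (@int_step (fun n => F j n ^+ 2) X (Y j) (N j) (Y0 j) (NXle j)).2.
  apply: (@Rdominated R _ _ _ (fun=> k ^+ 2) (mX X) _ (sq_meas _ cf) _ (cst_int _) _).2.
  - by move=> j; apply: step_meas => //; rewrite NX.
  - apply: aeW => r; rewrite /= in_itv /= => /andP[r0 rX].
    rewrite (_ : (fun j => _) = (fun j => F j (Num.truncn (r * Y j)) *
        F j (Num.truncn (r * Y j)))).
      by rewrite expr2; apply: cvgM; exact: Ff.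
    apply/funext => j; rewrite stepE//.
    by rewrite -XY ltr_pM2r.
  - move=> j; apply: step_bound (Y0 j) (NX j) _ => n nN.
    have Fkn := Fk j n nN; have k0 := le_trans (normr_ge0 _) Fkn.
    by rewrite normrX lerXn2r ?nnegrE.
have cd : (\sum_(n < N j) d j n ^+ 2) / Y j @[j --> \oo] --> \int[leb]_(r in `[0, X[) v r ^+ 2.
  apply: (conv d v M) => //.
    by move=> j n nN; apply: MB => //; exact: nXY.
  move=> r r0 rX; rewrite vE ?r0//; exact: (dconv_cvg KB c0 ch X0 hB aY Yoo r0 rX).
have chh : (\sum_(k < N j) h (k%:R / Y j) ^+ 2) / Y j @[j --> \oo] -->
    \int[leb]_(r in `[0, X[) h r ^+ 2.
  apply: (conv (fun j k => h (k%:R / Y j)) h Bh) => //.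
    move=> j n nN; apply: hB; rewrite divr_ge0 ?(ltW (Y0 j))//=.
    by rewrite ler_pdivrMr// nXY.
  move=> r r0 rX; apply/cvgrPdist_lt => e e0.
  have [dd d0 dP] := (cont_epsP h r).1 (ch r) e e0.
  have [J HJ] := Yoo (dd^-1 + 1).
  exists J => // j /= /HJ Yj; have [n1 n2] := truncn_near r0 (Y0 j).
  have : (Y j)^-1 < dd.
    by rewrite invf_plt ?posrE//; apply: lt_le_trans Yj; rewrite ltrDl.
  move=> h1; rewrite distrC; apply: dP; rewrite ler0_norm ?subr_le0//.
  by apply: lt_trans h1; rewrite opprB ltrBlDr addrC -ltrBlDr.
apply: ler_cvg_to cd chh _; apply: nearW => j.
by rewrite ler_pM2r ?invr_gt0.
Qed.

End contraction.

(** * Laplace transforms of convolutions *)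

Section fubini.
Context (R : realType).
Local Notation C := R[i].
Local Notation leb := (@lebesgue_measure R).
Implicit Types (x y r s k : R) (f g h K v : R -> R) (z : C).
Local Notation halfline := (`[0, +oo[%classic : set R).

Lemma seg_shift g a b k : a <= b -> continuous g ->
  \int[leb]_(x in `[a + k, b + k]) g x = \int[leb]_(x in `[a, b]) g (x + k).
Proof.
move=> ab cg; rewrite /Rintegral.
have dS (x : R) : is_derive x (1 : R) (fun s : R => s + k) 1 by exact: is_derive_shift.
have DE : (fun s : R => s + k)^`()%classic = fun=> 1.
  by apply/funext => x; rewrite derive1E; apply: derive_val.
rewrite (@integration_by_substitution_increasing R (fun s => s + k) g a b ab) ?DE.
- by congr fine; apply: eq_integral => x _ /=; rewrite mulr1.
- by move=> x y _ _; rewrite ltrD2r.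
- by move=> x _; exact: cvg_cst.
- exact: is_cvg_cst.
- exact: is_cvg_cst.
- have cs (x : R) : (fun s : R => s + k) @ x --> x + k.
    by apply: cvgD; [exact: cvg_id|exact: cvg_cst].
  split; first by move=> x _; exact: ex_derive.
    by apply: cvg_at_right_filter; exact: cs.
  by apply: cvg_at_left_filter; exact: cs.
- by apply: continuous_subspaceT.
Qed.

Lemma Rintegral_support f a b (A : set R) : `[a, b]%classic `<=` A ->
  (forall x, A x -> ~ (a <= x <= b) -> f x = 0) ->
  \int[leb]_(x in A) f x = \int[leb]_(x in `[a, b]) f x.
Proof.
move=> sA f0; rewrite Rintegral_mkcond [RHS]Rintegral_mkcond.
apply: eq_Rintegral => x _; rewrite !patchE.
have [xab|xab] := pselect (a <= x <= b).
  have h1 : `[a, b]%classic x by rewrite /= in_itv.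
  by rewrite !mem_set//; exact: sA.
rewrite [in RHS]memNset; last by rewrite /= in_itv.
by case: ifPn => // /set_mem Ax; rewrite f0.
Qed.

Lemma compact_exp_growth h T Bh (c : R) : continuous h ->
  (forall s, T <= s -> h s = 0) -> (forall s, `|h s| <= Bh) ->
  exp_growth h c (Bh * expR (`|c| * `|T|)).
Proof.
move=> ch h0 hB; split=> // x x0.
have Bh0 : 0 <= Bh by apply: le_trans (normr_ge0 _) (hB 0).
have [Tx|xT] := leP T x.
  by rewrite h0// normr0 !mulr_ge0 ?expR_ge0.
apply: le_trans (hB x) _; rewrite -mulrA ler_peMr// -expRD -expR0 ler_expR.
have T0 : 0 < T := le_lt_trans x0 xT.
rewrite (gtr0_norm T0).
have h1 : `|c * x| <= `|c| * T by rewrite normrM (ger0_norm x0) ler_wpM2l// ltW.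
by have := ler_norm (- (c * x)); rewrite normrN; lra.
Qed.

Section conv.
Variables (K h v : R -> R) (c B T Bh : R) (z : C).
Hypotheses (KB : exp_growth K c B) (K0 : forall x, x < 0 -> K x = 0).
Hypotheses (ch : continuous h) (T0 : 0 <= T).
Hypotheses (h0 : forall s, s <= 0 \/ T <= s -> h s = 0) (hB : forall s, `|h s| <= Bh).
Hypothesis cz : c < Im z.
Hypothesis vE : forall r, 0 <= r -> v r = volterra K h r.

Let w (k : C) r : R := Re (k * cexp (r%:C * ('i%C * z))).

Let wD (k : C) x s : w k (s + x) = w (k * cexp (x%:C * ('i%C * z))) s.
Proof.
by rewrite /w rmorphD /= mulrDl addrC cexpD mulrA.
Qed.

Let w_cont (k : C) : continuous (w k).
Proof.
have [H _] : ccontinuous (fun r : R => k * cexp (r%:C * ('i%C * z))).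
  apply: ccontinuousM; last exact: ccontinuous_cexp.
  by split=> x; exact: cvg_cst.
exact: H.
Qed.

Let w_le (k : C) r : `|w k r| <= normc k * expR (- Im z * r).
Proof.
apply: le_trans (normc_Re _) _.
by rewrite normcM expi_norm.
Qed.

Let hw_int (k : C) x : \int[leb]_r (h (r - x) * w k r) =
  Re (k * cexp (x%:C * ('i%C * z)) * lap h z).
Proof.
have hsplit : forall r, ~ (x <= r <= T + x) -> h (r - x) = 0.
  move=> r nr; apply: h0; case: (leP r x) => rx; [left|right]; first by lra.
  by apply: contrapT => tr; apply: nr; lra.
rewrite (@Rintegral_support _ x (T + x) setT) //; last first.
  by move=> r _ /hsplit ->; rewrite mul0r.
have -> : \int[leb]_(r in `[x, T + x]) (h (r - x) * w k r) =
    \int[leb]_(s in `[0, T]) (h s * w (k * cexp (x%:C * ('i%C * z))) s).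
  rewrite -{1}[x]add0r seg_shift//.
    by apply: seg_eq => s _; rewrite addrK wD.
  move=> r; apply: cvgM; last exact: w_cont.
  apply: (@continuous_comp _ _ _ (fun r => r - x) h); last exact: ch.
  by apply: cvgB; [exact: cvg_id|exact: cvg_cst].
set k' := k * _.
have hi : cintegrable halfline (fun s => (h s)%:C * cexp (s%:C * ('i%C * z))).
  have G := @compact_exp_growth h T Bh (Im z - 1) ch (fun s Ts => h0 (or_intror Ts)) hB.
  by apply: lap_cintegrable G _; rewrite ltrBlDr ltrDl.
have -> : Re (k' * lap h z) = \int[leb]_(s in halfline) (h s * w k' s).
  rewrite /lap (Cintegral_Zl _ (measurable_itv _) hi).
  by apply: eq_Rintegral => s _; rewrite /w mulrCA Re_realM.
rewrite -(@Rintegral_support _ 0 T halfline)//.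
- by move=> s /=; rewrite !in_itv /= andbT => /andP[].
- move=> s /=; rewrite in_itv /= andbT => s0 ns; rewrite h0 ?mul0r//; right.
  by apply: contrapT => /negP; rewrite -ltNge => sT; apply: ns; rewrite s0 ltW.
Qed.

Let mhalf : measurable (halfline : set (measurableTypeR R)).
Proof. exact: measurable_itv. Qed.

(** The complex factor k turns one real-valued application of Fubini's theorem
into an equality of complex numbers: k = 1 and k = -i give both parts. *)
Let F (k : C) (p : R * R) : R := K p.1 * (h (p.2 - p.1) * w k p.2).

Let F_meas (k : C) : measurable_fun setT (F k).
Proof.
have mK : measurable_fun setT K := continuous_measurable_fun KB.1.
have mh : measurable_fun setT h := continuous_measurable_fun ch.
have mw : measurable_fun setT (w k) := continuous_measurable_fun (@w_cont k).
apply: measurable_funM.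
  exact: (measurableT_comp mK measurable_fst).
apply: measurable_funM; last exact: (measurableT_comp mw measurable_snd).
apply: (measurableT_comp mh).
by apply: measurable_funB; [exact: measurable_snd|exact: measurable_fst].
Qed.

Let Bh0 : 0 <= Bh. Proof. by apply: le_trans (normr_ge0 _) (hB 0). Qed.

(** For a given x only r in [x, x + T] contribute, and there the exponential is
comparable to e^(- Im z x); so the growth of K is compensated. *)
Let F_inner (k : C) x : (\int[leb]_r `|(F k (x, r))%:E| <=
   (`|K x| * (expR (- Im z * x) * (Bh * normc k * expR (`|Im z| * T) * T)))%:E)%E.
Proof.
pose q : R := `|K x| * (Bh * (normc k * (expR (- Im z * x) * expR (`|Im z| * T)))).
have q0 : 0 <= q by rewrite /q !mulr_ge0 ?expR_ge0 ?normc_ge0.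
apply: le_trans (_ : (\int[leb]_(r in setT) (q * \1_(`[x, T + x]%classic) r)%:E <= _)%E).
  apply: ge0_le_integral => //.
  - apply/measurable_EFinP; apply: measurableT_comp => //.
    exact: (measurableT_comp (F_meas k) (pair1_measurable x)).
  - apply/measurable_EFinP; apply: measurable_funM => //; exact: measurable_indic.
  - move=> r _; rewrite lee_fin indicE /F /=.
    have [xr|nxr] := pselect (x <= r <= T + x).
      rewrite mem_set ?mulr1 /= ?in_itv//= !normrM /q ler_wpM2l//.
      apply: ler_pM => //; apply: le_trans (w_le _ _) _.
      rewrite ler_wpM2l ?normc_ge0// -expRD ler_expR.
      have : - Im z * (r - x) <= `|Im z| * T.
        apply: le_trans (ler_norm _) _; rewrite normrM normrN ler_wpM2l//.
        by rewrite ger0_norm; lra.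
      lra.
    rewrite memNset ?mulr0 /= ?in_itv//= h0 ?mul0r ?mulr0 ?normr0//.
    case: (leP r x) => rx; [left; lra|right].
    by apply: contrapT => tr; apply: nxr; lra.
under eq_integral do rewrite EFinM.
rewrite ge0_integralZl//; last by apply/measurable_EFinP; exact: measurable_indic.
rewrite integral_indic// setIT.
have := lebesgue_measure_itv `[x, T + x] => /= ->.
have -> : (if (x%:E < (T + x)%:E)%E then ((T + x)%:E - x%:E)%E else 0%E) = T%:E.
  rewrite lte_fin; case: ltP => h1; first by rewrite -EFinB addrK.
  by congr (_%:E); apply/eqP; rewrite eq_le T0 -(lerD2r x) add0r h1.
by rewrite -EFinM lee_fin le_eqVlt; apply/orP; left; apply/eqP; rewrite /q; ring.
Qed.

Let F_int (k : C) : (leb \x leb)%E.-integrable setT (EFin \o F k).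
Proof.
apply/integrable12ltyP; first by apply/measurable_EFinP; exact: F_meas.
pose k0 := Bh * normc k * expR (`|Im z| * T) * T.
have k00 : 0 <= k0 by rewrite !mulr_ge0 ?normc_ge0 ?expR_ge0.
pose d := Im z - c; have d0 : 0 < d by rewrite subr_gt0.
have B0 : 0 <= B.
  by have := KB.2 0 (lexx 0); rewrite mulr0 expR0 mulr1; exact: le_trans.
have I : leb.-integrable halfline (EFin \o (fun x => (B * k0) * expR (- d * x))).
  by apply: integrableZ_R => //; exact: integrable_expR.
apply: le_lt_trans (_ : (\int[leb]_(x in halfline) ((B * k0) * expR (- d * x))%:E < +oo)%E).
  rewrite [leRHS]integral_mkcond; apply: ge0_le_integral => //.
  - by move=> x _; apply: integral_ge0.
  - apply: (@measurable_fun_fubini_tonelli_F _ _ _ _ R leb (abse \o (EFin \o F k))).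
      apply/measurableT_comp => //; apply/measurable_EFinP; exact: F_meas.
    by move=> p; exact: abse_ge0.
  - apply/(measurable_restrictT _ mhalf); exact: (measurable_int leb I).
  - move=> x _; apply: le_trans (F_inner k x) _; rewrite -/k0 patchE.
    case: ifPn => [|]; [rewrite inE|rewrite notin_setE] => /=; rewrite in_itv /= andbT.
      move=> x0; rewrite lee_fin.
      apply: le_trans (ler_wpM2r _ (KB.2 x x0)) _; first by rewrite mulr_ge0 ?expR_ge0.
      have -> : expR (- d * x) = expR (c * x) * expR (- Im z * x).
        by rewrite -expRD; congr expR; rewrite /d; ring.
      by rewrite le_eqVlt; apply/orP; left; apply/eqP; ring.
    by move=> /negP; rewrite -ltNge => /K0 ->; rewrite normr0 mul0r.
exact: integrable_lty I.
Qed.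

Let EFin_Rintegral f : leb.-integrable setT (EFin \o f) ->
  (\int[leb]_x (f x)%:E)%E = (\int[leb]_x f x)%:E.
Proof. by move=> fi; rewrite /Rintegral fineK//; exact: integrable_fin_num. Qed.

Let integrable_support f a b : cont_on a b f ->
  (forall x, ~ (a <= x <= b) -> f x = 0) -> leb.-integrable setT (EFin \o f).
Proof.
move=> cf f0.
have mI : measurable (`[a, b]%classic : set (measurableTypeR R)) by exact: measurable_itv.
have /(@integrable_mkcond _ _ R leb _ _ mI) := integrable_seg cf.
rewrite (_ : (EFin \o f) \_ `[a, b] = EFin \o f)//.
apply/funext => x; rewrite patchE; case: ifPn => //; rewrite notin_setE /= in_itv.
by move=> /f0 ->.
Qed.

Let F_x (k : C) x : (\int[leb]_r (F k (x, r))%:E)%E =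
  (K x * Re (k * cexp (x%:C * ('i%C * z)) * lap h z))%:E.
Proof.
have hz r : ~ (x <= r <= T + x) -> h (r - x) = 0.
  move=> nr; apply: h0; case: (leP r x) => rx; [left|right]; first by lra.
  by apply: contrapT => tr; apply: nr; lra.
have gc : continuous (fun r => h (r - x) * w k r).
  move=> r; apply: cvgM; last exact: w_cont.
  apply: (@continuous_comp _ _ _ (fun r => r - x) h); last exact: ch.
  by apply: cvgB; [exact: cvg_id|exact: cvg_cst].
have gi : leb.-integrable setT (EFin \o (fun r => h (r - x) * w k r)).
  apply: (@integrable_support _ x (T + x)); first by move=> r _; exact: gc.
  by move=> r /hz ->; rewrite mul0r.
rewrite (EFin_Rintegral (f := fun r => K x * (h (r - x) * w k r))).
  by rewrite RintegralZl// hw_int.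
exact: integrableZ_R.
Qed.

Let v_integrand r : v r = \int[leb]_x (K x * h (r - x)) \/ r < 0.
Proof.
have [r0|r0] := ltP r 0; [by right|left].
rewrite vE// /volterra Rintegral_mkcond; apply: eq_Rintegral => x _; rewrite patchE.
case: ifPn => [_|].
  by case: ltP => // rx; rewrite h0 ?mulr0//; left; lra.
by rewrite notin_setE /= in_itv /= andbT => /negP; rewrite -ltNge => /K0 ->; rewrite mul0r.
Qed.

Let F_r (k : C) r : (\int[leb]_x (F k (x, r))%:E)%E = (if 0 <= r then v r * w k r else 0)%:E.
Proof.
case: leP => [r0|r0]; last first.
  rewrite integral0_eq// => x _; rewrite /F /=.
  have [x0|x0] := ltP x 0; first by rewrite K0 ?mul0r.
  by rewrite h0 ?mul0r ?mulr0//; left; lra.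
have hz x : ~ (r - T <= x <= r) -> h (r - x) = 0.
  move=> nx; apply: h0; case: (leP r x) => rx; [left|right]; first by lra.
  by apply: contrapT => tr; apply: nx; lra.
have gi : leb.-integrable setT (EFin \o (fun x => K x * h (r - x))).
  apply: (@integrable_support _ (r - T) r); last by move=> x /hz ->; rewrite mulr0.
  move=> x _; apply: cvgM; first exact: KB.1.
  apply: (@continuous_comp _ _ _ (fun x => r - x) h); last exact: ch.
  by apply: cvgB; [exact: cvg_cst|exact: cvg_id].
have -> : (fun x => (F k (x, r))%:E) = EFin \o (fun x => w k r * (K x * h (r - x))).
  by apply/funext => x; rewrite /F /=; congr (_%:E); ring.
rewrite (EFin_Rintegral (f := fun x => w k r * (K x * h (r - x)))); last exact: integrableZ_R.
rewrite RintegralZl// mulrC; case: (v_integrand r) => [->//|].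
by rewrite ltNge r0.
Qed.

(** Fubini's theorem for K(x) h(r - x) e^(izr): integrating first in r gives the
product of the transforms, first in x the transform of the convolution. *)
Theorem lap_convolution c' B' : exp_growth v c' B' -> c' < Im z ->
  lap v z = lap K z * lap h z.
Proof.
move=> vB c'z.
have H (k : C) : Re (k * lap v z) = Re (k * (lap K z * lap h z)).
  have := Fubini (F_int k); rewrite /comp.
  under eq_integral do rewrite F_x.
  under [X in _ = X -> _]eq_integral do rewrite F_r.
  move=> /(congr1 fine) E.
  have -> : Re (k * lap v z) = \int[leb]_r (if 0 <= r then v r * w k r else 0).
    rewrite /lap (Cintegral_Zl _ (measurable_itv _) (lap_cintegrable vB c'z)) /Cintegral.
    rewrite [LHS]Rintegral_mkcond; apply: eq_Rintegral => r _; rewrite patchE.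
    case: ifPn; [rewrite inE|rewrite notin_setE] => /=; rewrite in_itv /= andbT.
      by move=> ->; rewrite /w mulrCA Re_realM.
    by move=> /negP/negbTE ->.
  rewrite /Rintegral -E.
  have -> : k * (lap K z * lap h z) = k * lap h z * lap K z by ring.
  rewrite {2}/lap (Cintegral_Zl _ (measurable_itv _) (lap_cintegrable KB cz)) /Cintegral.
  rewrite [RHS]Rintegral_mkcond /Rintegral; congr fine; apply: eq_integral => x _.
  rewrite patchE; congr (_%:E).
  have -> : k * cexp (x%:C * ('i%C * z)) * lap h z = k * lap h z * cexp (x%:C * ('i%C * z)) by ring.
  case: ifPn; [rewrite inE|rewrite notin_setE] => /=; rewrite in_itv /= andbT.
    by move=> _; rewrite [in RHS]mulrCA Re_realM.
  by move=> /negP; rewrite -ltNge => /K0 ->; rewrite mul0r.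
apply: complex_eq; first by have := H 1; rewrite !mul1r.
have := H (- 'i%C); move: (lap v z) (lap K z * lap h z) => [a b] [d e] /=.
by move=> E; have : b = e by move: E; lra.
Qed.

End conv.
End fubini.

(** * Uniqueness of the Laplace transform *)

Section uniqueness.
Context (R : realType).
Local Notation C := R[i].
Local Notation leb := (@lebesgue_measure R).
Implicit Types (x y s t eta tau T : R) (h : R -> R) (n N : nat).
Local Notation halfline := (`[0, +oo[%classic : set R).

Lemma bernoulli_ge x N : 0 <= x <= 1 -> 1 - N%:R * x <= (1 - x) ^+ N.
Proof.
move=> /andP[x0 x1]; elim: N => [|N IH]; first by rewrite mul0r subr0 expr0.
have p0 : 0 <= 1 - x by rewrite subr_ge0.
have H := ler_wpM2l p0 IH; rewrite -exprS in H; apply: le_trans H.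
have : 0 <= N%:R * x ^+ 2 by rewrite mulr_ge0// sqr_ge0.
rewrite -natr1; move: (N%:R : R) => m; nra.
Qed.

Lemma power_le_exp x N : 0 <= x <= 1 -> (1 - x) ^+ N <= expR (- (N%:R * x)).
Proof.
move=> /andP[x0 x1]; rewrite -mulrN expRM_natl lerXn2r ?nnegrE ?subr_ge0 ?expR_ge0//.
by have := expR_ge1Dx (- x).
Qed.

(** A polynomial in e^(- eta s), so that its integral against h is a
combination of transforms at multiples of i eta. It tends to the indicator function of
s > ln 2 / eta, where 2 e^(- eta s) < 1. *)
Definition stepper eta n s : R := (1 - expR (- (eta * n%:R * s))) ^+ (2 ^ n).

Lemma stepper_ge0_le1 eta n s : 0 < eta -> 0 <= s -> 0 <= stepper eta n s <= 1.
Proof.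
move=> e0 s0; have p0 : 0 <= 1 - expR (- (eta * n%:R * s)).
  by rewrite subr_ge0 -expR0 ler_expR oppr_le0 !mulr_ge0// ltW.
rewrite exprn_ge0//= exprn_ile1// gerBl; exact: expR_ge0.
Qed.

(** With u = e^(- eta s), Bernoulli's inequality bounds (1 - u^n)^(2^n) below by
1 - (2u)^n, and 1 - x <= e^-x bounds it above by exp(- (2u)^n) <= (2u)^-n. *)
Lemma stepper_cvg eta s : 0 < eta -> 0 <= s -> s != ln 2 / eta ->
  stepper eta n s @[n --> \oo] --> (if ln 2 / eta < s then 1 else 0 : R).
Proof.
move=> e0 s0 sn.
pose u := expR (- (eta * s)).
have u0 : 0 < u by exact: expR_gt0.
have un n : expR (- (eta * n%:R * s)) = u ^+ n.
  by rewrite /u -expRM_natl; congr expR; ring.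
have u1 : u <= 1 by rewrite -expR0 ler_expR oppr_le0 mulr_ge0// ltW.
have un01 n : 0 <= u ^+ n <= 1 by rewrite exprn_ge0 ?(ltW u0)//= exprn_ile1 ?(ltW u0).
have pow2 n : (2 ^ n)%:R * u ^+ n = (2 * u) ^+ n by rewrite natrX exprMn.
have u2E : 2 * u = expR (ln 2 - eta * s) by rewrite expRD lnK ?posrE.
case: ltP => [lt|le].
  have u2 : 2 * u < 1.
    rewrite u2E expR_lt1 subr_lt0.
    by move: lt; rewrite ltr_pdivrMr// mulrC.
  have c1 : (1 - (2 * u) ^+ n) @[n --> \oo] --> (1 : R).
    rewrite -[X in _ --> X]subr0; apply: cvgB; first exact: cvg_cst.
    by apply: cvg_expr; rewrite ger0_norm// ltW// mulr_gt0.
  apply: (squeeze_cvgr _ c1); last exact: cvg_cst.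
  apply: nearW => n.
  have /andP[_ ->] := stepper_ge0_le1 n e0 s0; rewrite andbT.
  by rewrite /stepper un -pow2; exact: bernoulli_ge.
have lt : s < ln 2 / eta by rewrite lt_neqAle sn.
have u2 : 1 < 2 * u.
  rewrite u2E expR_gt1 subr_gt0.
  by move: lt; rewrite ltr_pdivlMr// mulrC.
have u2p : 0 < 2 * u by lra.
have c1 : ((2 * u)^-1 ^+ n) @[n --> \oo] --> (0 : R).
  apply: cvg_expr; rewrite ger0_norm ?invr_ge0 ?(ltW u2p)//.
  by rewrite invf_lt1.
apply: (squeeze_cvgr _ _ c1); last exact: (cvg_cst (0 : R)).
apply: nearW => n.
have /andP[-> _] := stepper_ge0_le1 n e0 s0; rewrite /=.
rewrite /stepper un; apply: le_trans (power_le_exp _ (un01 n)) _; rewrite pow2.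
have p0 : 0 < (2 * u) ^+ n by rewrite exprn_gt0.
rewrite expRN exprVn lef_pV2 ?posrE ?expR_gt0//.
by apply: le_trans (expR_ge1Dx _); rewrite lerDr.
Qed.

Lemma support_bounded (g : R -> R) T : continuous g -> (forall s, s <= 0 \/ T <= s -> g s = 0) ->
  exists2 M, 0 <= M & forall s, `|g s| <= M.
Proof.
move=> cg g0; have [M M0 gM] := @cont_on_bounded R 0 T g (fun x _ => cg x).
exists M => // s; have [st|nst] := pselect (0 <= s <= T); first exact: gM.
rewrite g0 ?normr0//; case: (leP s 0) => hs; [by left|right].
by apply: contrapT => tr; apply: nst; lra.
Qed.

(** If all transforms vanish at the points iy, the integral of h against every
[stepper] is zero, hence so are the integrals of h over all [tau, T] and h
itself. *)
Lemma lap_neq0 h T s0 : continuous h -> (forall s, s <= 0 \/ T <= s -> h s = 0) ->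
  h s0 != 0 -> exists z, lap h z != 0.
Proof.
move=> ch h0 hs0; apply: contrapT => Hn.
have lap0 z : lap h z = 0 by apply: contrapT => /eqP Hz; apply: Hn; exists z.
have [s00 s0T] : 0 < s0 /\ s0 < T.
  by split; rewrite ltNge; apply/negP => H; move: hs0; rewrite h0 ?eqxx//; [left|right].
have T0 : 0 < T by lra.
have chh a b : cont_on a b h by move=> x _; exact: ch.
have cexpR (y : R) : continuous (fun s => expR (- (y * s))).
  move=> x; apply: (@continuous_comp _ _ _ (fun s => - (y * s)) expR); last exact: continuous_expR.
  by apply: cvgN; apply: cvgM; [exact: cvg_cst|exact: cvg_id].
have [Bh Bh0 hB] := support_bounded ch h0.
have E0 y : \int[leb]_(s in `[0, T]) (h s * expR (- (y * s))) = 0.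
  have G := @compact_exp_growth R h T Bh (y - 1) ch (fun s Ts => h0 s (or_intror Ts)) hB.
  have [I _] := lap_cintegrable (z := 0 +i* y) G ltac:(by rewrite /= ltrBlDr ltrDl).
  have Z : \int[leb]_(s in halfline) Re ((h s)%:C * cexp (s%:C * ('i%C * (0 +i* y)))) = 0.
    exact: (congr1 (@complex.Re R) (lap0 (0 +i* y))).
  rewrite -[RHS]Z -(@Rintegral_support _ _ 0 T halfline).
  - apply: eq_Rintegral => s _.
    have -> : s%:C * ('i%C * (0 +i* y)) = (- (y * s))%:C.
      by apply: complex_eq; rewrite ?(cReM, cImM) /=; ring.
    by rewrite cexp_real Re_realM.
  - by move=> s; rewrite /= !in_itv /= andbT => /andP[].
  - move=> s; rewrite /= in_itv /= andbT => sp ns.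
    rewrite h0 ?mul0r//; right.
    by apply: contrapT => /negP; rewrite -ltNge => sT; apply: ns; rewrite sp ltW.
have Estep eta n : \int[leb]_(s in `[0, T]) (h s * stepper eta n s) = 0.
  pose f (i : nat) s := ((-1) ^+ i *+ 'C(2 ^ n, i)) * (h s * expR (- (eta * n%:R * i%:R * s))).
  have cf i : cont_on 0 T (f i).
    apply: cont_onM; first by move=> x _; exact: cvg_cst.
    by apply: cont_onM => // x _; exact: cexpR.
  have [_ S] := seg_sum (index_enum 'I_(2 ^ n).+1) (fun i : 'I_(2 ^ n).+1 => cf i).
  transitivity (\int[leb]_(s in `[0, T]) (\sum_(i < (2 ^ n).+1) f i s)).
    apply: seg_eq => s _; rewrite /stepper exprBn mulr_sumr; apply: eq_bigr => i _.
    rewrite /f expr1n mulr1 -expRM_natl.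
    have -> : i%:R * - (eta * n%:R * s) = - (eta * n%:R * i%:R * s) by ring.
    by rewrite -[in LHS]mulr_natr -[in RHS]mulr_natr; move: (expR _) => ?; ring.
  rewrite S big1// => i _; rewrite segZ ?E0 ?mulr0//.
  by apply: cont_onM => // x _; exact: cexpR.
have tail tau : 0 < tau -> tau < T -> \int[leb]_(s in `[tau, T]) h s = 0.
  move=> tau0 tauT; pose eta := ln 2 / tau.
  have ln2 : 0 < ln 2 :> R by rewrite ln_gt0// ltr1n.
  have eta0 : 0 < eta by rewrite divr_gt0.
  have etau : ln 2 / eta = tau by rewrite /eta; field; rewrite !gt_eqF.
  have mT : measurable (`[0, T]%classic : set (measurableTypeR R)) by exact: measurable_itv.
  have cst_step n : cont_on 0 T (stepper eta n).
    move=> x _; apply: (@continuous_comp _ _ _ (fun s => 1 - expR (- (eta * n%:R * s)))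
      (fun y => y ^+ (2 ^ n))); last exact: exprn_continuous.
    by apply: cvgB; [exact: cvg_cst|exact: cexpR].
  have mc f : cont_on 0 T f -> measurable_fun `[0, T] f.
    by move=> /integrable_seg/integrableP[/measurable_EFinP].
  have L : \int[leb]_(s in `[0, T]) (h s * stepper eta n s) @[n --> \oo] -->
      \int[leb]_(s in `[0, T]) (h s * (if tau < s then 1 else 0)).
    apply: (@Rdominated R `[0, T] _ _ (fun s => `|h s|) mT _ _ _ _ _).2.
    - by move=> n; apply: mc; apply: cont_onM.
    - apply: measurable_funM; first exact: mc.
      rewrite (_ : (fun s => _) = \1_(`]tau, +oo[%classic : set R)); first exact: measurable_indic.
      apply/funext => s; rewrite indicE; case: ltP => ts.
        by rewrite mem_set//= in_itv /= ts.
      by rewrite memNset//= in_itv /= andbT; apply/negP; rewrite -leNgt.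
    - exists [set tau]; split; [exact: measurable_set1|exact: lebesgue_measure_set1|].
      move=> s /= nP; apply: contrapT => /eqP st; apply: nP.
      rewrite in_itv /= => /andP[sp _]; apply: cvgM; first exact: cvg_cst.
      have := @stepper_cvg eta s eta0 sp; rewrite etau; exact.
    - by apply: integrable_seg => x _; apply: cvg_norm; exact: ch.
    - move=> n s; rewrite /= in_itv /= => /andP[sp _].
      have /andP[q0 q1] := stepper_ge0_le1 n eta0 sp.
      by rewrite normrM (ger0_norm q0) ler_piMr.
  have Z : \int[leb]_(s in `[0, T]) (h s * (if tau < s then 1 else 0)) = 0.
    have E : (fun n => \int[leb]_(s in `[0, T]) (h s * stepper eta n s)) = fun=> 0.
      by apply/funext => n; exact: Estep.
    by rewrite E in L; apply: (cvg_unique _ L); [exact: norm_hausdorff|exact: cvg_cst].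
  rewrite -(@Rintegral_itv_obnd_cbnd R tau (BRight T)); last first.
    apply: (@integrableS _ _ R leb `[tau, T]) => //; last exact: integrable_seg.
    by move=> s /=; rewrite !in_itv /= => /andP[/ltW -> ->].
  rewrite -Z [LHS]Rintegral_mkcond [RHS]Rintegral_mkcond.
  apply: eq_Rintegral => s _; rewrite !patchE.
  have [ts|ts] := ltP tau s.
    have [sT|sT] := leP s T.
      by rewrite !mem_set ?mulr1//= in_itv /= ?ts ?sT// (ltW (lt_trans tau0 ts)).
    by rewrite !memNset//= in_itv /=; apply/negP; rewrite negb_and -!ltNge sT orbT.
  rewrite memNset ?mulr0 ?if_same//= in_itv /=.
  by apply/negP; rewrite negb_and -leNgt ts.
have d0 : 0 < `|h s0| / 2 by rewrite divr_gt0// normr_gt0.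
have [d dp dP] := (cont_epsP h s0).1 (ch s0) _ d0.
(* The integral of h over [s0, s1] vanishes although h stays near h s0 there. *)
pose s1 := s0 + Num.min d (T - s0) / 2.
have m0 : 0 < Num.min d (T - s0) by rewrite lt_min dp subr_gt0.
have md : Num.min d (T - s0) <= d by rewrite ge_min lexx.
have mT : Num.min d (T - s0) <= T - s0 by rewrite ge_min lexx orbT.
have s01 : s0 < s1 by rewrite /s1; lra.
have s1T : s1 < T by rewrite /s1; lra.
have := @seg_split R s0 s1 T h (ltW s01) (ltW s1T) (chh _ _).
rewrite !tail//; last by lra.
rewrite addr0 => Z.
have := @seg_near_cst R s0 s1 h (h s0) (`|h s0| / 2) (ltW s01) (chh _ _).
rewrite -Z sub0r normrN normrM (ger0_norm (_ : 0 <= s1 - s0)) ?subr_ge0 ?(ltW s01)//.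
rewrite ler_pM2r ?subr_gt0// => H.
have : `|h s0| <= `|h s0| / 2.
  apply: H => s /andP[q1 q2]; apply/ltW/dP; rewrite ger0_norm ?subr_ge0//.
  by move: q2; rewrite /s1; lra.
have : 0 < `|h s0| by rewrite normr_gt0.
lra.
Qed.

End uniqueness.

(** * The symbol and the excluded quotient *)

Section assembly.
Context (R : realType).
Local Notation C := R[i].
Local Notation leb := (@lebesgue_measure R).
Local Notation halfline := (`[0, +oo[%classic : set R).
Implicit Types (z w p : C) (h v : R -> R) (x y T Y : R).

Lemma locally_finite_discrete (Z : set C) :
  limit_point (Z : set C^o) = set0 -> locally_finite Z.
Proof.
move=> L w; have : ~ limit_point (Z : set C^o) w by rewrite L.
rewrite /limit_point /= => /existsNP[U /not_implyP[/nbhs_ballP[r /= r0 rU] nU]].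
have [Im0 r0R] : Im r = 0 /\ 0 < Re r.
  by move: r0; rewrite ltcE /= => /andP[/eqP -> ->].
exists (Re r) => // z zw zr Zz; apply: nU; exists z; split=> //; apply: rU.
rewrite /ball /= complexnormE normcB.
have -> : r = (Re r)%:C by apply: complex_eq.
by rewrite ltcR.
Qed.

Section setup.
Variables (c B : R) (Z : set C) (E : C -> C) (K : R -> R).
Hypotheses (hK1 : condK1 c Z E) (hK6 : condK6 Z E) (KB : exp_growth K c B).
Hypothesis hquot : sharp_quotient_eq_on [set z : C | c < Im z] Z E (lap K).

Let c0 : 0 < c. Proof. by case: hK1. Qed.

Let lfZ : locally_finite Z.
Proof. by case: hK1 => _ [? _ _ _ _] _ _; exact: locally_finite_discrete. Qed.

Let notZ_high z : c < Im z -> ~ Z z.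
Proof.
case: hK1 => _ [_ _ H _ _] _ _ cz /H /andP[_].
by rewrite leNgt cz.
Qed.

Let Ehol z : ~ Z z -> chol E z.
Proof. by case: hK1 => _ _ H _; exact: H. Qed.

Let Enhol z : ~ Z z -> chol (fun w => E (- w)) z.
Proof.
move=> Zz; apply: chol_comp.
  have := cholB (@chol_cst R 0 z) (@chol_id R z).
  by under eq_fun do rewrite sub0r.
apply: Ehol; case: hK1 => _ [_ _ _ _ H] _ _ /H; by rewrite opprK.
Qed.

Lemma ball_high z p : normc (z - p) < Im p - c -> c < Im z.
Proof.
move=> H; have := normc_Im (z - p); rewrite cImB => H2.
by move: (le_lt_trans H2 H); rewrite ltr_norml => /andP[]; lra.
Qed.

(** Otherwise E would vanish identically by the identity theorem, and the
quotient 1 / 1 would agree with E^sharp / E wherever E does not vanish. *)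
Lemma E_dense p e : c < Im p -> 0 < e ->
  exists z, [/\ normc (z - p) < e, c < Im z & E z != 0].
Proof.
move=> cp e0; apply: contrapT => H; apply: hK6.
have m0 : 0 < Num.min e (Im p - c) by rewrite lt_min e0 subr_gt0.
have EZ : zero_near E p.
  exists (Num.min e (Im p - c)) => // z; rewrite lt_min => /andP[z1 z2].
  apply: contrapT => /eqP Ez; apply: H; exists z; split=> //; exact: ball_high z2.
have E0 := identity_theorem lfZ Ehol EZ.
have H1 : holomorphic_on setT (fun=> 1 : C) /\ exponential_type (fun=> 1 : C).
  split; first by move=> z _; exact: (@chol_cst R 1 z).
  by exists 1, 0 => z; rewrite normc1' mul0r expR0 mulr1.
exists (fun=> 1), (fun=> 1); split; [exact: H1|exact: H1|by exists 0; apply: oner_neq0|].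
by move=> z _ /E0 ->; rewrite eqxx.
Qed.

Section inner.
Variable theta : C -> C.
Hypothesis thin : inner_function theta.
Hypothesis thq : sharp_quotient_eq_on (@upper_half_plane R) Z E theta.

Let thol z : 0 < Im z -> chol theta z.
Proof. by case: thin => H _ _; exact: H. Qed.

(** Both sides equal E^sharp / E where E does not vanish, which is a dense set. *)
Lemma theta_lap z : c < Im z -> theta z = lap K z.
Proof.
move=> cz; apply/eqP; rewrite -subr_eq0; apply: contrapT => /negP D0.
have CD := chol_cont (cholB (thol (lt_trans c0 cz)) (chol_lap KB cz)).
rewrite -normc_gt0 in D0; have [r r0 rP] := CD _ D0.
have [w [wr cw Ew]] := E_dense cz r0.
have := rP (w - z) wr; rewrite [z + _]addrC subrK.
rewrite -(thq (lt_trans c0 cw) (notZ_high cw) Ew) -(hquot cw (notZ_high cw) Ew).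
by rewrite subrr sub0r normcN ltxx.
Qed.

(** [toeplitz_contraction] for w |-> theta(iY(1 - w)). The imaginary part of
iY(1 - w) is Y(1 - Re w), positive in the unit disc and above c near w = 0, where
the Taylor coefficients are read off from the Laplace transform. *)
Lemma moment_contraction Y : c < Y -> forall (g : nat -> R) N,
  \sum_(n < N) (\sum_(k < N | (k <= n)%N) g k * poisson_moment K Y (n - k)%N) ^+ 2 <=
  \sum_(k < N) g k ^+ 2.
Proof.
move=> cY g N; have Y0 : 0 < Y := lt_trans c0 cY.
have ImE w : Im ((0 +i* Y) * (1 - w)) = Y * (1 - Re w).
  by rewrite cImM cReB /=; ring.
have Re1 w : normc w < 1 -> 0 < 1 - Re w.
  by move=> w1; have := le_lt_trans (normc_Re w) w1; rewrite ltr_norml => /andP[]; lra.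
apply: (@toeplitz_contraction R (fun w => theta ((0 +i* Y) * (1 - w)))).
- move=> w w1; apply: chol_comp.
    by apply: cholM; [exact: chol_cst|apply: cholB; [exact: chol_cst|exact: chol_id]].
  by apply: thol; rewrite ImE mulr_gt0// Re1.
- by move=> w w1; apply: inner_le1 => //; rewrite ImE mulr_gt0// Re1.
move=> M; have [B' [r [r0 H]]] := lap_taylor_at0 KB cY Y0 M.
have q0 : 0 < (Y - c) / Y by rewrite divr_gt0// subr_gt0.
exists B', (Num.min r ((Y - c) / Y)); split; first by rewrite lt_min r0.
move=> w; rewrite lt_min => /andP[wr wq]; rewrite theta_lap; first exact: H.
rewrite ImE; move: wq; rewrite ltr_pdivlMr// => wq.
have := normc_Re w; rewrite ler_norml => /andP[_ H2].
have := ler_wpM2r (ltW Y0) H2; lra.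
Qed.

End inner.

Section quotient.
Variables (h v : R -> R) (T : R).
Hypotheses (T0 : 0 <= T) (ch : continuous h) (cv : continuous v).
Hypotheses (h0 : forall s, s <= 0 \/ T <= s -> h s = 0).
Hypotheses (v0 : forall s, s <= 0 \/ T <= s -> v s = 0).

Lemma lap_compact_entire (g : R -> R) : continuous g -> (forall s, s <= 0 \/ T <= s -> g s = 0) ->
  holomorphic_on setT (lap g) /\ exponential_type (lap g).
Proof.
move=> cg g0; have [M M0 gM] := support_bounded cg g0.
have G c' := @compact_exp_growth R g T M c' cg (fun s Ts => g0 s (or_intror Ts)) gM.
split.
  by move=> z _; apply: (chol_lap (G (Im z - 1))); rewrite ltrBlDr ltrDl.
exists (M * T), T => z.
have I : cintegrable halfline (fun x => (g x)%:C * cexp (x%:C * ('i%C * z))).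
  by apply: lap_cintegrable (G (Im z - 1)) _; rewrite ltrBlDr ltrDl.
pose q : R := M * expR (T * normc z).
have q0 : 0 <= q by rewrite mulr_ge0// expR_ge0.
pose b x : R := if 0 <= x <= T then q else 0.
have bI : leb.-integrable halfline (EFin \o b).
  apply: (@integrableS _ _ R leb setT) => //.
  have mI : measurable (`[0, T]%classic : set (measurableTypeR R)) by exact: measurable_itv.
  have := integrable_cst_seg 0 T q; move=> /(@integrable_mkcond _ _ R leb _ _ mI).
  rewrite (_ : (EFin \o _) \_ `[0, T] = EFin \o b)//.
  apply/funext => x; rewrite patchE /= /b.
  case: ifPn; [rewrite inE|rewrite notin_setE] => /=; rewrite in_itv /=; first by move=> ->.
  by move=> /negP/negbTE ->.
have /le_trans : normc (lap g z) <= \int[leb]_(x in halfline) b x.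
  have half x : halfline x -> 0 <= x by rewrite /= in_itv /= andbT.
  apply: normc_Cintegral_le => // x /half x0.
  rewrite normcM normc_real expi_norm /b x0 /=.
  case: ifPn => xT; last by rewrite g0 ?normr0 ?mul0r//; right; rewrite ltW// ltNge.
  apply: ler_pM => //; rewrite ?expR_ge0// ler_expR.
  apply: le_trans (ler_norm _) _; rewrite normrM normrN mulrC.
  by rewrite (ger0_norm x0) ler_pM// normc_Im.
apply.
rewrite (@Rintegral_support _ b 0 T).
- rewrite (@seg_eq _ _ _ _ (fun=> q)) ?seg_cst// /q.
    by rewrite subr0 le_eqVlt; apply/orP; left; apply/eqP; ring.
  by move=> x xT; rewrite /b xT.
- by move=> x; rewrite /= !in_itv /= andbT => /andP[].
- by move=> x _ /negP/negbTE H; rewrite /b H.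
Qed.

(** The function E(-z) W(z) - V(z) E(z) is analytic off the singularities and
vanishes for Im z > c, hence everywhere. *)
Lemma quotient_excluded : (forall z, c < Im z -> lap v z = lap K z * lap h z) ->
  (exists z, lap h z != 0) -> False.
Proof.
move=> conv hz; apply: hK6; exists (lap v), (lap h); split=> //;
  [exact: lap_compact_entire|exact: lap_compact_entire|].
have [hh _] := lap_compact_entire ch h0; have [hv _] := lap_compact_entire cv v0.
pose H w := E (- w) * lap h w - lap v w * E w.
have cH w : ~ Z w -> chol H w.
  by move=> Zw; apply: cholB; apply: cholM; [exact: Enhol|exact: hh|exact: hv|exact: Ehol].
have sE w : ~ Z w -> sharp E w = E (- w) by case: hK1 => _ _ _; exact.
pose p : C := 0 +i* (c + 1).
have cp : c < Im p by rewrite /= ltrDl.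
have Hp : zero_near H p.
  exists (Im p - c); first by rewrite subr_gt0.
  move=> w /ball_high cw; have Zw := notZ_high cw.
  rewrite /H conv// -sE//; have [Ew|Ew] := eqVneq (E w) 0; last first.
    by rewrite -hquot// mulrAC divfK// subrr.
  have Ec := chol_cont (cH _ Zw).
  apply: contrapT => /eqP Hw.
  have Hn : 0 < normc (H w) by rewrite normc_gt0 /H conv// -sE.
  have [r r0 rP] := Ec _ Hn; have [u [ur cu Eu]] := E_dense cw r0.
  have Zu := notZ_high cu.
  have := rP _ ur; rewrite [w + _]addrC subrK {1}/H conv// -sE// -hquot// mulrAC divfK// subrr.
  by rewrite sub0r normcN ltxx.
move=> z /= hz0 Zz Ez.
have /eqP := identity_theorem lfZ cH Hp Zz; rewrite subr_eq0 => /eqP Hz.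
by rewrite sE//; apply/eqP; rewrite eqr_div// Hz.
Qed.

End quotient.
End setup.
End assembly.

(** * From eigenfunctions to compactly supported solutions *)

Section eigenfunction.
Context (R : realType).
Local Notation leb := (@lebesgue_measure R).
Local Notation halfline := (`[0, +oo[%classic : set R).
Implicit Types (x y r s T X : R).

Lemma seg_reflect (f : R -> R) T : 0 <= T -> continuous f ->
  \int[leb]_(s in `[0, T]) f (T - s) = \int[leb]_(s in `[0, T]) f s.
Proof.
move=> T0 cf.
have cf' : continuous (fun s => f (s + T)).
  move=> s; apply: (@continuous_comp _ _ _ (fun s => s + T) f); last exact: cf.
  by apply: cvgD; [exact: cvg_id|exact: cvg_cst].
have := @integration_by_substitution_oppr R (fun s => f (s + T)) 0 T T0.
rewrite oppr0 => /(_ (continuous_subspaceT cf'))/(congr1 fine) H.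
have -> : \int[leb]_(s in `[0, T]) f (T - s) = \int[leb]_(s in `[- T, 0]) f (s + T).
  by rewrite /Rintegral H; congr fine; apply: eq_integral => s _ /=; rewrite addrC.
have := @seg_shift R f (- T) 0 T; rewrite addNr add0r oppr_le0 => ->//.
Qed.

(** The point s may be the left end but not the right end of the segment: the
neighbourhood used is to the right of s. *)
Lemma seg_sqr_eq0 (f : R -> R) a b s : continuous f -> a <= s -> s < b ->
  \int[leb]_(x in `[a, b]) f x ^+ 2 <= 0 -> f s = 0.
Proof.
move=> cf as_ sb I0; apply: contrapT => /eqP fs.
have cf2 : continuous (fun x => f x ^+ 2).
  move=> x; apply: (@continuous_comp _ _ _ f (fun y => y ^+ 2)); first exact: cf.
  exact: exprn_continuous.
have cc p q : cont_on p q (fun x => f x ^+ 2) by move=> x _; exact: cf2.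
have f20 : 0 < f s ^+ 2 by rewrite lt_neqAle sqr_ge0 andbT eq_sym expf_neq0.
have d0 : 0 < f s ^+ 2 / 2 by rewrite divr_gt0.
have [d dp dP] := (cont_epsP (fun x => f x ^+ 2) s).1 (cf2 s) _ d0.
pose e := Num.min d (b - s) / 2.
have m0 : 0 < Num.min d (b - s) by rewrite lt_min dp subr_gt0.
have md : Num.min d (b - s) <= d by rewrite ge_min lexx.
have mb : Num.min d (b - s) <= b - s by rewrite ge_min lexx orbT.
have e0 : 0 < e by rewrite divr_gt0.
have se : s <= s + e by lra.
have seb : s + e <= b by rewrite /e; lra.
have n0 p q : 0 <= \int[leb]_(x in `[p, q]) f x ^+ 2.
  by apply: Rintegral_ge0 => // x _; exact: sqr_ge0.
have mid : 0 < \int[leb]_(x in `[s, s + e]) f x ^+ 2.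
  apply: (@lt_le_trans _ _ (f s ^+ 2 / 2 * (s + e - s))).
    by rewrite mulr_gt0// [s + e]addrC addrK.
  apply: seg_ge_cst => // x /andP[x1 x2].
  have : `|x - s| < d by rewrite ger0_norm ?subr_ge0//; move: x2; rewrite /e; lra.
  by move=> /dP; rewrite ltr_norml => /andP[]; lra.
have : 0 < \int[leb]_(x in `[a, b]) f x ^+ 2.
  rewrite (seg_split as_ (ltW sb) (cc _ _)) (seg_split se seb (cc _ _)).
  by rewrite ltr_wpDl// ltr_pwDl.
by rewrite ltNge I0.
Qed.

Section eigen.
Variables (K : R -> R) (c B t lam : R) (g : R -> R).
Hypotheses (KB : exp_growth K c B) (K0 : forall x, x < 0 -> K x = 0) (c0 : 0 < c).
Hypothesis ctr : forall Y, c < Y -> forall (g : nat -> R) N,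
  \sum_(n < N) (\sum_(k < N | (k <= n)%N) g k * poisson_moment K Y (n - k)%N) ^+ 2 <=
  \sum_(k < N) g k ^+ 2.
Hypotheses (t0 : 0 <= t) (lam2 : lam * lam = 1).
Local Notation A := (`]-oo, t[%classic : set R).
Hypothesis mg : measurable_fun A g.
Hypothesis g2 : (\int[leb]_(x in A) (g x ^+ 2)%:E < +oo)%E.
Hypothesis gnz : ~ {ae leb, forall x, A x -> g x = 0}.
Let u x := \int[leb]_(y in A) (K (x + y) * g y).
Hypothesis gE : {ae leb, forall x, A x -> u x = lam * g x}.

Let mA : measurable (A : set (measurableTypeR R)).
Proof. exact: measurable_itv. Qed.

Let g2_int : leb.-integrable A (EFin \o (fun x => g x ^+ 2)).
Proof.
apply/integrableP; split.
  by apply/measurable_EFinP; exact: measurable_funX.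
under eq_integral do rewrite /= ger0_norm ?sqr_ge0//.
exact: g2.
Qed.

(** An integrable bound for |g| on bounded sets, as |g| <= 1 + g^2. *)
Let loc_int a k : leb.-integrable A
  (EFin \o (fun y => k * (if a <= y then 1 + g y ^+ 2 else 0))).
Proof.
apply: integrableZ_R => //.
have mI : measurable (`[a, t]%classic : set (measurableTypeR R)) by exact: measurable_itv.
have I1 : leb.-integrable A (EFin \o (\1_(`[a, t]%classic) : R -> R)).
  apply: (@integrableS _ _ R leb setT) => //.
  have := integrable_cst_seg a t 1; move=> /(@integrable_mkcond _ _ R leb _ _ mI).
  rewrite (_ : (EFin \o _) \_ `[a, t] = EFin \o (\1_(`[a, t]%classic) : R -> R))//.
  by apply/funext => x; rewrite patchE /= indicE; case: ifPn.
have mind : measurable_fun A (fun y => if a <= y then 1 + g y ^+ 2 else 0).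
  have m1 : measurable_fun A (fun y => 1 + g y ^+ 2).
    by apply: measurable_funD; [exact: measurable_cst|exact: measurable_funX].
  have m2 : measurable_fun A (fun y => \1_(`[a, t]%classic) y * (1 + g y ^+ 2)).
    by apply: measurable_funM => //; exact: measurable_indic.
  apply: eq_measurable_fun m2 => y; rewrite inE /= in_itv /= => yt.
  rewrite indicE; case: ifPn => ay; first by rewrite mem_set ?mul1r//= in_itv /= ay ltW.
  by rewrite memNset ?mul0r//= in_itv /=; apply/negP; rewrite (negbTE ay).
apply: (integrable_dom mA mind (integrableD_R mA I1 g2_int)) => y.
rewrite /= in_itv /= => yt; rewrite indicE; case: ifPn => ay.
  have p0 : 0 <= 1 + g y ^+ 2 by rewrite addr_ge0// sqr_ge0.
  by rewrite ger0_norm// mem_set//= in_itv /= ay ltW.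
by rewrite normr0 addr_ge0 ?sqr_ge0.
Qed.

(** The condition x + y >= 0 for K(x + y) not to vanish keeps y in a bounded set,
uniformly for x near x0. *)
Let Kg_bound x0 : exists2 M, 0 <= M & forall x, `]x0 - 1, x0 + 1[%classic x ->
  forall y, A y -> `|K (x + y) * g y| <= M * (if - x0 - 1 <= y then 1 + g y ^+ 2 else 0).
Proof.
have [M M0 KM] := @cont_on_bounded R (- 2) (x0 + 1 + t) K (fun x _ => KB.1 x).
exists M => // x; rewrite /= in_itv /= => /andP[x1 x2] y; rewrite in_itv /= => yt.
case: ifPn => [ay|]; last by rewrite -ltNge => ay; rewrite K0 ?mul0r ?normr0 ?mulr0//; lra.
rewrite normrM; apply: ler_pM => //; first by apply: KM; lra.
have := sqr_ge0 (`|g y| - 1); rewrite sqrrB1 real_normK ?num_real//.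
have := sqr_ge0 (g y); have := normr_ge0 (g y); rewrite -mulr_natr; lra.
Qed.

Let Kg_meas x : measurable_fun A (fun y => K (x + y) * g y).
Proof.
apply: measurable_funM => //; apply: (measurable_funS measurableT) => //.
apply: continuous_measurable_fun => y.
apply: (@continuous_comp _ _ _ (fun y => x + y) K); last exact: KB.1.
by apply: cvgD; [exact: cvg_cst|exact: cvg_id].
Qed.

Let u_cont : continuous u.
Proof.
move=> x0; have [M M0 HM] := Kg_bound x0.
have := @continuity_under_integral R _ _ leb (fun x y => K (x + y) * g y) A mA
  (x0 - 1) (x0 + 1) _ _ _ (loc_int (- x0 - 1) M) _ x0.
apply.
- move=> x Ix; apply: (integrable_dom mA (Kg_meas x) (loc_int (- x0 - 1) M)).
  exact: HM.
- apply/aeW => y _ x _; apply: cvgM; last exact: cvg_cst.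
  apply: (@continuous_comp _ _ _ (fun x => x + y) K); last exact: KB.1.
  by apply: cvgD; [exact: cvg_id|exact: cvg_cst].
- by move=> x Ix; apply/aeW => y Ay; exact: HM.
- by apply/mem_set; rewrite /= in_itv /= ltrBlDr !ltrDl ltr01.
Qed.

Let u_neg x : x <= - t -> u x = 0.
Proof.
move=> xt; rewrite /u (_ : 0 = \int[leb]_(y in A) (0 : R)); last first.
  by rewrite Rintegral_cst ?mul0r.
apply: eq_Rintegral => y /set_mem; rewrite /= in_itv /= => yt.
by rewrite K0 ?mul0r//; lra.
Qed.

Let u_eq x : u x = \int[leb]_(y in A) (K (x + y) * (lam * u y)).
Proof.
rewrite {1}/u /Rintegral; congr fine; apply: ae_eq_integral => //.
- by apply/measurable_EFinP; exact: Kg_meas.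
- apply/measurable_EFinP; apply: (measurable_funS measurableT) => //.
  apply: continuous_measurable_fun => y; apply: cvgM.
    apply: (@continuous_comp _ _ _ (fun y => x + y) K); last exact: KB.1.
    by apply: cvgD; [exact: cvg_cst|exact: cvg_id].
  by apply: cvgM; [exact: cvg_cst|exact: u_cont].
apply: ae_mono gE => y Hy Ay; congr (_%:E); congr (_ * _).
by rewrite Hy// mulrA lam2 mul1r.
Qed.

Let T := 2 * t.
Let v r := u (r - t).
Let h s := lam * v (T - s).

Let v_cont : continuous v.
Proof.
move=> r; apply: (@continuous_comp _ _ _ (fun r => r - t) u); last exact: u_cont.
by apply: cvgB; [exact: cvg_id|exact: cvg_cst].
Qed.

Let h_cont : continuous h.
Proof.
move=> s; apply: cvgM; first exact: cvg_cst.
apply: (@continuous_comp _ _ _ (fun s => T - s) v); last exact: v_cont.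
by apply: cvgB; [exact: cvg_cst|exact: cvg_id].
Qed.

Let T0 : 0 <= T. Proof. by rewrite mulr_ge0. Qed.

Let v_le0 r : r <= 0 -> v r = 0.
Proof. by move=> r0; apply: u_neg; rewrite gerDr. Qed.

Let vE r : 0 <= r -> v r = volterra K h r.
Proof.
move=> r0; rewrite /v u_eq.
pose f y := K (r - t + y) * (lam * u y).
have cf : continuous f.
  move=> y; apply: cvgM.
    apply: (@continuous_comp _ _ _ (fun y => r - t + y) K); last exact: KB.1.
    by apply: cvgD; [exact: cvg_cst|exact: cvg_id].
  by apply: cvgM; [exact: cvg_cst|exact: u_cont].
transitivity (\int[leb]_(y in `[t - r, t]) f y).
  rewrite -(@Rintegral_itv_bndo_bndc R (BLeft (t - r)) t); last first.
    apply: (@integrableS _ _ R leb `[t - r, t]) => //; last first.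
      by apply: integrable_seg => x _; exact: cf.
    by move=> s /=; rewrite !in_itv /= => /andP[-> /ltW ->].
  rewrite Rintegral_mkcond [RHS]Rintegral_mkcond; apply: eq_Rintegral => y _.
  rewrite !patchE; have [yt|ty] := ltP y t; last first.
    rewrite memNset; last by rewrite /= in_itv /= ltNge ty.
    by rewrite memNset// /= in_itv /= ltNge ty andbF.
  rewrite mem_set; last by rewrite /= in_itv.
  have [ry|yr] := leP (t - r) y; first by rewrite mem_set//= in_itv /= ry.
  rewrite memNset; last by rewrite /= in_itv /= leNgt yr.
  by rewrite K0 ?mul0r//; lra.
have := @seg_shift R f 0 r (t - r) r0 cf; rewrite add0r [r + _]addrC subrK => ->.
rewrite /volterra.
transitivity (\int[leb]_(x in `[0, r[) (K x * h (r - x))).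
  rewrite (@Rintegral_itv_bndo_bndc R (BLeft 0) r); last first.
    apply: (@integrableS _ _ R leb `[0, r]) => //; last first.
      apply: integrable_seg => x _; apply: cvgM; first exact: KB.1.
      apply: (@continuous_comp _ _ _ (fun x => r - x) h); last exact: h_cont.
      by apply: cvgB; [exact: cvg_cst|exact: cvg_id].
    by move=> s /=; rewrite !in_itv /= => /andP[-> /ltW ->].
  apply: seg_eq => x _; rewrite /f /h /v /T; congr (K _ * (_ * u _)); ring.
rewrite Rintegral_mkcond [RHS]Rintegral_mkcond; apply: eq_Rintegral => x _.
rewrite !patchE; have [x0|x0] := leP 0 x; last first.
  rewrite memNset; last by rewrite /= in_itv /= leNgt x0.
  by rewrite memNset//= in_itv /= leNgt x0.
rewrite [in RHS]mem_set; last by rewrite /= in_itv /= x0.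
case: ltP => xr; first by rewrite mem_set//= in_itv /= x0.
by rewrite memNset ?mulr0//= in_itv /= ltNge xr andbF.
Qed.

(** For r >= T: the reflection s |-> T - s shows that h and v have the same norm
on [0, T], and h vanishes beyond T, so [volterra_contraction] on a longer
interval leaves nothing for v beyond T. *)
Let v_geT r : T <= r -> v r = 0.
Proof.
(* X lies strictly beyond r, as [seg_sqr_eq0] requires. *)
move=> Tr; pose X := r + 1.
have X0 : 0 < X by rewrite /X; have := T0; lra.
have TX : T <= X by rewrite /X; lra.
have cf2 (f : R -> R) : continuous f -> continuous (fun x => f x ^+ 2).
  move=> cf x; apply: (@continuous_comp _ _ _ f (fun y => y ^+ 2)); first exact: cf.
  exact: exprn_continuous.
have cc (f : R -> R) p q : continuous f -> cont_on p q (fun x => f x ^+ 2).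
  by move=> cf x _; exact: cf2.
have vX s : 0 <= s < X -> v s = volterra K h s by move=> /andP[s0 _]; exact: vE.
have := volterra_contraction KB c0 h_cont X0 v_cont ctr vX.
have clo (f : R -> R) : continuous f -> \int[leb]_(x in `[0, X[) f x ^+ 2 = \int[leb]_(x in `[0, X]) f x ^+ 2.
  move=> cf; rewrite (@Rintegral_itv_bndo_bndc R (BLeft 0) X)//.
  apply: (@integrableS _ _ R leb `[0, X]) => //; last exact/integrable_seg/cc.
  by move=> s /=; rewrite !in_itv /= => /andP[-> /ltW ->].
rewrite !clo// (seg_split T0 TX (cc _ 0 X v_cont)) (seg_split T0 TX (cc _ 0 X h_cont)).
have -> : \int[leb]_(x in `[0, T]) h x ^+ 2 = \int[leb]_(x in `[0, T]) v x ^+ 2.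
  rewrite -[RHS](seg_reflect T0 (cf2 _ v_cont)); apply: seg_eq => s _.
  by rewrite /h exprMn expr2 lam2 mul1r.
have -> : \int[leb]_(x in `[T, X]) h x ^+ 2 = 0.
  rewrite (@seg_eq _ _ _ _ (fun=> 0)) ?seg_cst ?mul0r// => s /andP[Ts _].
  by rewrite /h v_le0 ?mulr0 ?expr0n//; lra.
rewrite addr0 gerDl => I0.
by apply: (seg_sqr_eq0 v_cont Tr _ I0); rewrite /X; lra.
Qed.

(** The substitution r = x + t, s = t - y turns the integral of
K(x + y) lambda u(y) into the convolution of K with h(s) = lambda u(t - s). *)
Lemma eigenfunction_volterra : exists T' h' v',
  [/\ 0 <= T', continuous h' /\ (forall s, s <= 0 \/ T' <= s -> h' s = 0),
      continuous v' /\ (forall s, s <= 0 \/ T' <= s -> v' s = 0),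
      forall r, 0 <= r -> v' r = volterra K h' r
    & exists s, h' s != 0].
Proof.
exists T, h, v; split=> //.
- split=> // s [s0|Ts]; rewrite /h; [rewrite v_geT|rewrite v_le0]; rewrite ?mulr0//; lra.
- by split=> // s [/v_le0|/v_geT].
apply: contrapT => nh; apply: gnz; apply: ae_mono gE => x ux Ax.
have h0 s : h s = 0 by apply: contrapT => /eqP hs; apply: nh; exists s.
have u0 : lam * u x = 0.
  by have := h0 (t - x); rewrite /h /v /T (_ : 2 * t - (t - x) - t = x)//; ring.
by move: u0; rewrite (ux Ax) mulrA lam2 mul1r.
Qed.

End eigen.
End eigenfunction.

Section conclusion.
Context (R : realType).
Local Notation C := R[i].
Local Notation leb := (@lebesgue_measure R).

(** Near infinity this is the growth condition on K, and elsewhere K is bounded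
while the exponential is at least 1. *)
Lemma growth_condK2 c Z E (K : R -> R) : 0 < c -> condK2 c Z E K -> exists B, exp_growth K c B.
Proof.
move=> c0 [cK [M [[x0 [x0r Hx0]] _]] _].
have [Mb Mb0 KM] := @cont_on_bounded R 0 (x0 + 1) K (fun x _ => cK x).
exists (Mb + `|M|); split=> // x x0'.
have e1 : 1 <= expR (c * x) by rewrite -expR0 ler_expR mulr_ge0// ltW.
have [xx|xx] := leP x (x0 + 1).
  apply: le_trans (KM x _) _; first by rewrite x0'.
  apply: (@le_trans _ _ (Mb * expR (c * x))); first by rewrite ler_peMr.
  by rewrite ler_wpM2r ?expR_ge0// lerDl.
apply: le_trans (Hx0 x _) _; first by lra.
rewrite (ger0_norm x0') ler_wpM2r ?expR_ge0//.
by apply: le_trans (ler_norm _) _; rewrite lerDr.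
Qed.

Section main.
Variables (c : R) (Z : set C) (E : C -> C) (K : R -> R).
Hypotheses (hK1 : condK1 c Z E) (hK2 : condK2 c Z E K) (hK3 : condK3 K).
Hypotheses (hK6 : condK6 Z E) (hinner : sharp_quotient_inner Z E).
Variables (t lam : R).
Hypotheses (t0 : 0 <= t) (lam2 : lam * lam = 1).
Local Notation A := (`]-oo, t[%classic : set R).

Let c0 : 0 < c. Proof. by case: hK1. Qed.

Let hquot : sharp_quotient_eq_on [set z : C | c < Im z] Z E (lap K).
Proof.
by case: hK2 => _ _ H z cz Zz Ez; rewrite H// fourier_lap.
Qed.

Lemma no_real_eigenfunction (g : R -> R) : measurable_fun A g ->
  (\int[leb]_(x in A) (g x ^+ 2)%:E < +oo)%E ->
  {ae leb, forall x, A x -> \int[leb]_(y in A) (K (x + y) * g y) = lam * g x} ->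
  {ae leb, forall x, A x -> g x = 0}.
Proof.
move=> mg g2 gE; apply: contrapT => gnz.
have [B KB] := growth_condK2 c0 hK2.
have [theta [thin thq]] := hinner.
have ctr := moment_contraction hK1 hK6 KB hquot thin thq.
have [T [h [v [T0 [ch h0] [cv v0] vE [s0 hs0]]]]] :=
  eigenfunction_volterra KB hK3 c0 ctr t0 lam2 mg g2 gnz gE.
have [Mh Mh0 hM] := support_bounded ch h0; have [Mv Mv0 vM] := support_bounded cv v0.
apply: (quotient_excluded hK1 hK6 hquot T0 ch cv h0 v0).
  move=> z cz; have G := @compact_exp_growth R v T Mv c cv (fun s Ts => v0 s (or_intror Ts)) vM.
  exact: (lap_convolution KB hK3 ch T0 h0 hM cz vE G cz).
exact: lap_neq0 ch h0 hs0.
Qed.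

Lemma not_eigenvalue : ~ is_eigenvalue A (opK K t) lam%:C.
Proof.
move=> [f [[mRe mIm f2] fnz fE]]; apply: fnz.
have mA : measurable (A : set (measurableTypeR R)) by exact: measurable_itv.
have mn : measurable_fun A (fun x => normc (f x) ^+ 2).
  rewrite (_ : (fun x => _) = (fun x => Re (f x) ^+ 2 + Im (f x) ^+ 2)).
    by apply: measurable_funD; exact: measurable_funX.
  by apply/funext => x; rewrite normcE2.
have fin (g : R -> R) : measurable_fun A g -> (forall x, g x ^+ 2 <= normc (f x) ^+ 2) ->
    (\int[leb]_(x in A) (g x ^+ 2)%:E < +oo)%E.
  move=> mg gf; apply: le_lt_trans f2; apply: ge0_le_integral => //.
  - by move=> x _; rewrite lee_fin sqr_ge0.
  - by apply/measurable_EFinP; exact: measurable_funX.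
  - exact/measurable_EFinP.
  - by move=> x _; rewrite lee_fin.
have opE x : A x -> opK K t f x =
    (\int[leb]_(y in A) (K (x + y) * Re (f y))) +i* (\int[leb]_(y in A) (K (x + y) * Im (f y))).
  move=> Ax; rewrite /opK indicE mem_set// mul1r /Cintegral.
  by congr (_ +i* _); apply: eq_Rintegral => y _; rewrite ?Re_realM ?Im_realM.
have ReE : {ae leb, forall x, A x -> Re (f x) = 0}.
  apply: no_real_eigenfunction => //.
    by apply: fin => // x; rewrite normcE2 lerDl sqr_ge0.
  by apply: ae_mono fE => x H Ax; rewrite -Re_realM -H// opE.
have ImE : {ae leb, forall x, A x -> Im (f x) = 0}.
  apply: no_real_eigenfunction => //.
    by apply: fin => // x; rewrite normcE2 lerDr sqr_ge0.
  by apply: ae_mono fE => x H Ax; rewrite -Im_realM -H// opE.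
apply: (@filterS2 _ _ (ae_filter_ringOfSetsType leb) _ _ _ _ ReE ImE) => x H1 H2 Ax; apply: complex_eq; [exact: H1|exact: H2].
Qed.

End main.
End conclusion.

Theorem theorem1p3 (R : realType) (c : R) (Z : set R[i]) (E : R[i] -> R[i])
    (K : R -> R)
    (hK1 : condK1 c Z E) (hK2 : condK2 c Z E K) (hK3 : condK3 K)
    (hK6 : condK6 Z E) (hinner : sharp_quotient_inner Z E) :
  forall t : R, 0 <= t ->
    ~ is_eigenvalue `]-oo, t[ (opK K t) 1 /\
    ~ is_eigenvalue `]-oo, t[ (opK K t) (-1).
Proof.
move=> t t0; split.
  have := not_eigenvalue hK1 hK2 hK3 hK6 hinner t0 (mulr1 1); exact.
have m1 : -1 * -1 = 1 :> R by rewrite mulrNN mulr1.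
have := not_eigenvalue hK1 hK2 hK3 hK6 hinner t0 m1.
by rewrite rmorphN1.
Qed.
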